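(* Let $X\subset\mathbb{R}^N$ be a closed semialgebraic set and let $F:X\to\mathbb{R}^m$ be a polynomial mapping. Let $D=\max\{2,\kappa(X)\}$, $d=\max\{\deg F,D\}$ and $r=2r(X)$. Then there exists a positive constant $C$ such that $$|F(x)|\ge C\left(\frac{\operatorname{dist}(x,F^{-1}(0)\cap X)}{1+|x|^{D}}\right)^{d(6d-3)^{N+r-1}}\quad\text{for } x\in X.$$ In particular, if $X$ is an unbounded set and $F^{-1}(0)\cap X$ is a compact set, then $$\mathcal{L}^{\mathbb{R}}_\infty(F|X)\ge-\frac{D}{2}\,d(6d-3)^{N+r-1}.$$
   Context: $|\cdot|$ is the Euclidean norm, $\operatorname{dist}$ the Euclidean distance to a set, with the convention $\operatorname{dist}(x,\emptyset)=1$. A polynomial mapping $F:X\to\mathbb{R}^m$ is the restriction to $X$ of a polynomial mapping $\mathbb{R}^N\to\mathbb{R}^m$; $\deg F$ is the maximum of the degrees of its components. Łojasiewicz exponent at infinity. $\mathcal{L}^{\mathbb{R}}_\infty(F|X)$ is the supremum of the exponents $\nu$ for which there exist $C,R>0$ with $|F(x)|\ge C|x|^{\nu}$ for all $x\in X$, $|x|\ge R$. Complexity numbers. Every closed semialgebraic set $X\subset\mathbb{R}^N$ has a decomposition $X=X_1\cup\dots\cup X_k$ into closed basic semialgebraic sets $$X_i=\{x\in\mathbb{R}^N: g_{i,1}(x)\ge 0,\dots,g_{i,r_i}(x)\ge 0,\ h_{i,1}(x)=\dots=h_{i,l_i}(x)=0\},\quad i=1,\dots,k,$$ with $g_{i,j},h_{i,s}\in\mathbb{R}[x_1,\dots,x_N]$,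 where $r_i$ is taken to be the smallest possible number of inequalities in the definition of $X_i$. The number $r(X)$ is the minimum of $\max\{r_1,\dots,r_k\}$ over all such decompositions of $X$. The number $\kappa(X)$ is the minimum of the maximal degree of all the polynomials $g_{i,j},h_{i,s}$ over all such decompositions (descriptions) of $X$ that satisfy $r_i\le r(X)$ for all $i$. *)

(* Defs.v *)
From mathcomp Require Import all_boot all_order all_algebra.
From mathcomp Require Import all_classical all_reals all_analysis.
(* The notations of mpoly clash with those of mathcomp-analysis. *)
From mathcomp Require Import (canonicals, coercions) mpoly.

Set Implicit Arguments.
Unset Strict Implicit.
Unset Printing Implicit Defensive.

Import Order.TTheory GRing.Theory Num.Theory.
Import numFieldNormedType.Exports.

Local Open Scope classical_set_scope.
Local Open Scope ring_scope.

Notation realpoly R N := (mpoly.mpoly N R).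

(* The library norm on 'rV[R]_N is the sup norm; it induces the usual topology
   and the usual bounded sets, but metric statements need the Euclidean one. *)
Definition eucl_norm (R : realType) (N : nat) (x : 'rV[R]_N) : R :=
  Num.sqrt (\sum_(i < N) x 0 i ^+ 2).

Definition eucl_dist (R : realType) (N : nat) (x : 'rV[R]_N) (A : set 'rV[R]_N) : R :=
  if A == set0 then 1 else inf [set eucl_norm (x - y) | y in A].

Definition peval (R : realType) (N : nat) (p : realpoly R N) (x : 'rV[R]_N) : R :=
  mpoly.meval (fun i => x 0 i) p.

(* Total degree; the zero polynomial gets degree 0. *)
Definition pdeg (R : realType) (N : nat) (p : realpoly R N) : nat :=
  (mpoly.msize p).-1.

(* A polynomial mapping X -> R^m is represented by the components of a
   polynomial mapping R^N -> R^m restricting to it. *)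
Definition polymap (R : realType) (N m : nat) : Type := 'I_m -> realpoly R N.

Definition polymap_eval (R : realType) (N m : nat) (F : polymap R N m)
    (x : 'rV[R]_N) : 'rV[R]_m :=
  \row_(j < m) peval (F j) x.

Definition polymap_deg (R : realType) (N m : nat) (F : polymap R N m) : nat :=
  (\max_(j < m) pdeg (F j))%N.

Inductive semialgebraic (R : realType) (N : nat) : set 'rV[R]_N -> Prop :=
| semialgebraic_eq0 (p : realpoly R N) :
    semialgebraic [set x | peval p x = 0]
| semialgebraic_gt0 (p : realpoly R N) :
    semialgebraic [set x | 0 < peval p x]
| semialgebraic_setC (A : set 'rV[R]_N) :
    semialgebraic A -> semialgebraic (~` A)
| semialgebraic_setU (A B : set 'rV[R]_N) :
    semialgebraic A -> semialgebraic B -> semialgebraic (A `|` B).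

(* (gs, hs) describes the closed basic semialgebraic set
   { x | g(x) >= 0 for g in gs and h(x) = 0 for h in hs }. *)
Definition description (R : realType) (N : nat) : Type :=
  (seq (realpoly R N) * seq (realpoly R N))%type.

Definition basic_set (R : realType) (N : nat) (b : description R N) :
    set 'rV[R]_N :=
  [set x | (forall g, g \in b.1 -> 0 <= peval g x) /\
           (forall h, h \in b.2 -> peval h x = 0)].

Definition num_ineqs (R : realType) (N : nat) (b : description R N) : nat :=
  size b.1.

Definition min_ineqs (R : realType) (N : nat) (b : description R N) : Prop :=
  forall b' : description R N,
    basic_set b' = basic_set b -> (num_ineqs b <= num_ineqs b')%N.

Definition decomposition (R : realType) (N : nat) (X : set 'rV[R]_N)
    (s : seq (description R N)) : Prop :=
  X = \big[setU/set0]_(b <- s) basic_set b /\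
  (forall b, b \in s -> min_ineqs b).

Definition max_num_ineqs (R : realType) (N : nat) (s : seq (description R N)) :
    nat :=
  (\max_(b <- s) num_ineqs b)%N.

Definition max_degree (R : realType) (N : nat) (s : seq (description R N)) :
    nat :=
  (\max_(b <- s) \max_(p <- b.1 ++ b.2) pdeg p)%N.

(* Junk value 0 on the empty set; nonempty in the uses below by the finiteness
   theorem for closed semialgebraic sets. *)
Definition nat_min (A : set nat) : nat :=
  xget 0%N [set n | A n /\ forall k, A k -> (n <= k)%N].

Definition rnum (R : realType) (N : nat) (X : set 'rV[R]_N) : nat :=
  nat_min [set max_num_ineqs s | s in decomposition X].

Definition kappa (R : realType) (N : nat) (X : set 'rV[R]_N) : nat :=
  nat_min [set max_degree s | s in
    [set s | decomposition X s /\
             forall b, b \in s -> (num_ineqs b <= rnum X)%N]].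

Definition zero_set (R : realType) (N m : nat) (F : polymap R N m)
    (X : set 'rV[R]_N) : set 'rV[R]_N :=
  [set x | polymap_eval F x = 0] `&` X.

Definition lojasiewicz_infty (R : realType) (N m : nat) (F : polymap R N m)
    (X : set 'rV[R]_N) : \bar R :=
  ereal_sup [set nu%:E | nu in
    [set nu : R | exists C r : R, [/\ 0 < C, 0 < r &
       forall x, X x -> r <= eucl_norm x ->
         C * (eucl_norm x `^ nu) <= eucl_norm (polymap_eval F x)]]].

(* Main.v *)
(* On a basic closed piece {g >= 0, h = 0} of X, the slack equations g_i = y_i^2
   reduce everything to the distance from w = (x, sqrt (g x)) to the zero set of
   p = |F|^2 + |h|^2 + |g - y^2|^2, a sum of squares of degree at most 2 d in
   n = N + k variables; here |w|^2 is at most a multiple of 1 + |x|^D.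

   For p >= 0 of degree at most D on a cube, let x(l) minimize |grad p|^2 - l p on a
   sublevel set of p. By quantifier elimination x(l) can be chosen monotone and
   continuous near l = 0, and along it |grad p|^2 <= l t with t(l) = p(x(l))
   nondecreasing and tending to 0. Integrating grad p along the curve gives
   t <= l s^2, where s is the length of the curve from 0 to l. On the other hand each
   coordinate of x(l) is algebraic over l, or over t, of bounded degree: after adding
   eta * sum x_i^(2D-1) / (2D-1), the critical equations have leading terms
   x_i^(2D-2), so that a relation of degree (2D-2)^n is found by counting monomials,
   and it survives the limit eta -> 0. Hence s^(E-2) = O(l) or s^E = O(t), with
   E = D (3D-3)^(n-1), and both give t^(E-2) = O(l^E). Minimality turns this into
   the gradient inequality |grad p|^(2E) >= c p^(2E-2) near the zeros of p, and Ekeland's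
   argument into p >= c dist^E. The projective charts make the estimate global. *)

Require Import Defs.
From mathcomp Require Import all_boot all_order all_algebra.
From mathcomp Require Import all_classical all_reals all_analysis.
From mathcomp Require Import (canonicals, coercions) mpoly.
(* Importing these would hide the propositional connectives. *)
From mathcomp Require qe_rcf ordered_qelim.
From mathcomp Require Import ring lra zify.

Set Implicit Arguments.
Unset Strict Implicit.
Unset Printing Implicit Defensive.

Import Order.TTheory GRing.Theory Num.Theory.
Import numFieldNormedType.Exports.

Local Open Scope classical_set_scope.
Local Open Scope ring_scope.

(** * First-order definability over the reals *)

(** The exponent has two sources. Each inequality of a basic piece costs one slack variable, so n =
    N + k with k <= r(X). The sum of squares p has degree 2d, but p = |F|^2 at the lifted points, so
    E = 2d(6d-3)^(n-1) is halved by a final square root.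

    Two estimates of the length s are needed because of the margin 2 in s^(E-2) = O(l). Over l the
    critical equations leave (2D-2)^n reduced monomials, and this number has to be at most E - 2.
    That holds for n >= 3, and also when some coordinate of the minimizer is on the boundary of the
    cube, where its equation is linear. It fails in the interior for n <= 2; there the multiplier is
    eliminated, the critical points lie on a line or on a plane curve of degree 3D - 3, and this
    gives degree E over t = p(x).

    The perturbation is removed by compactness: the relations all have the same format and
    normalized coefficients, and they converge along an ultrafilter. Zeros at infinity of a
    projective chart produce a second alternative, |F|^2 >= c (1+|w|)^(-E), which also implies the
    claim. *)

Section Definable.
Variable R : realType.
Implicit Types (v : nat -> R) (A B : (nat -> R) -> Prop) (F G : (nat -> R) -> R).

Definition upd v i x : nat -> R := fun j => if j == i then x else v j.

(** Formulas are evaluated in finite lists, so a predicate on valuations is tested only at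
    [nth 0 e]; real parameters enter as constants of the formula. Keeping [A] semantic lets the
    closure lemmas act on ordinary propositions. *)
Definition dfn A : Prop :=
  exists f : ordered_qelim.ord.formula R,
    forall e : seq R, A (nth 0 e) <-> ordered_qelim.ord.holds e f.

Definition dterm F : Prop :=
  exists2 t : GRing.term R,
    GRing.rterm t & forall e : seq R, F (nth 0 e) = GRing.eval e t.

Lemma nth_upd (e : seq R) i x : nth 0 (set_nth 0 e i x) = upd (nth 0 e) i x.
Proof. by apply/funext => j; rewrite nth_set_nth. Qed.

Lemma dfn_ext A B : (forall v, A v <-> B v) -> dfn A -> dfn B.
Proof. by move=> AB [f fP]; exists f => e; rewrite -AB. Qed.

Lemma dfn_const (P : Prop) : dfn (fun=> P).
Proof.
exists (ordered_qelim.ord.Bool `[<P>]) => e /=.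
by split=> [/asboolP//|/asboolP].
Qed.

Lemma dfn_and A B : dfn A -> dfn B -> dfn (fun v => A v /\ B v).
Proof.
by move=> [f fP] [g gP]; exists (ordered_qelim.ord.And f g) => e /=; rewrite fP gP.
Qed.

Lemma dfn_or A B : dfn A -> dfn B -> dfn (fun v => A v \/ B v).
Proof.
by move=> [f fP] [g gP]; exists (ordered_qelim.ord.Or f g) => e /=; rewrite fP gP.
Qed.

Lemma dfn_imp A B : dfn A -> dfn B -> dfn (fun v => A v -> B v).
Proof.
by move=> [f fP] [g gP]; exists (ordered_qelim.ord.Implies f g) => e /=; rewrite fP gP.
Qed.

Lemma dfn_not A : dfn A -> dfn (fun v => ~ A v).
Proof. by move=> [f fP]; exists (ordered_qelim.ord.Not f) => e /=; rewrite fP. Qed.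

Lemma dfn_ex_upd i A : dfn A -> dfn (fun v => exists x, A (upd v i x)).
Proof.
move=> [f fP]; exists (ordered_qelim.ord.Exists i f) => e /=.
by split=> -[x xP]; exists x; move: xP; rewrite -fP nth_upd.
Qed.

Lemma upd_same v i x : upd v i x i = x.
Proof. by rewrite /upd eqxx. Qed.

(* The invariance hypothesis says that [P v x] does not read the variable [i]
   of [v]; it holds by conversion whenever [i] is fresh. *)
Lemma dfn_ex i (P : (nat -> R) -> R -> Prop) :
  (forall v x, P (upd v i x) x <-> P v x) ->
  dfn (fun v => P v (v i)) -> dfn (fun v => exists x, P v x).
Proof.
move=> Pi /(dfn_ex_upd i); apply: dfn_ext => v.
by split=> -[x]; [rewrite upd_same Pi|rewrite -Pi -{2}(upd_same v i x)] => Px; exists x.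
Qed.

Lemma dfn_all i (P : (nat -> R) -> R -> Prop) :
  (forall v x, P (upd v i x) x <-> P v x) ->
  dfn (fun v => P v (v i)) -> dfn (fun v => forall x, P v x).
Proof.
move=> Pi dP.
have dnP : dfn (fun v => exists x, ~ P v x).
  by apply: (dfn_ex (i := i)) => [v x|]; [rewrite Pi|exact: dfn_not].
apply: dfn_ext (dfn_not dnP) => v; split=> [h x|h [x]]; last exact.
by apply: contrapT => nP; apply: h; exists x.
Qed.

Lemma dfn_allord n (A : 'I_n -> (nat -> R) -> Prop) :
  (forall i, dfn (A i)) -> dfn (fun v => forall i, A i v).
Proof.
move=> dA.
suff H (s : seq 'I_n) : dfn (fun v => forall i, i \in s -> A i v).
  apply: dfn_ext (H (enum 'I_n)) => v.
  by split=> [h i|h i _]; apply: h; rewrite mem_enum.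
elim: s => [|j s IH].
  by apply: dfn_ext (dfn_const True) => v; split.
apply: dfn_ext (dfn_and (dA j) IH) => v; split.
  by move=> [hj hs] i; rewrite inE => /predU1P[->|/hs].
by move=> h; split=> [|i si]; apply: h; rewrite inE ?eqxx ?si ?orbT.
Qed.

Lemma dfn_allseq (T : eqType) (s : seq T) (A : T -> (nat -> R) -> Prop) :
  (forall i, i \in s -> dfn (A i)) -> dfn (fun v => forall i, i \in s -> A i v).
Proof.
elim: s => [|j s IH] dA.
  by apply: dfn_ext (dfn_const True) => v; split.
have dAj : dfn (A j) by apply: dA; rewrite mem_head.
have {}IH : dfn (fun v => forall i, i \in s -> A i v).
  by apply: IH => i si; apply: dA; rewrite inE si orbT.
apply: dfn_ext (dfn_and dAj IH) => v; split.
  by move=> [hj hs] i; rewrite inE => /predU1P[->|/hs].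
by move=> h; split=> [|i si]; apply: h; rewrite inE ?eqxx ?si ?orbT.
Qed.

Lemma dfn_le F G : dterm F -> dterm G -> dfn (fun v => F v <= G v).
Proof.
by move=> [f _ fP] [g _ gP]; exists (ordered_qelim.ord.Le f g) => e /=; rewrite fP gP.
Qed.

Lemma dfn_lt F G : dterm F -> dterm G -> dfn (fun v => F v < G v).
Proof.
by move=> [f _ fP] [g _ gP]; exists (ordered_qelim.ord.Lt f g) => e /=; rewrite fP gP.
Qed.

Lemma dfn_eq F G : dterm F -> dterm G -> dfn (fun v => F v = G v).
Proof.
by move=> [f _ fP] [g _ gP]; exists (ordered_qelim.ord.Equal f g) => e /=; rewrite fP gP.
Qed.

Lemma dterm_const c : dterm (fun=> c).
Proof. by exists (GRing.Const c). Qed.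

Lemma dterm_var i : dterm (fun v => v i).
Proof. by exists (GRing.Var R i). Qed.

Lemma dterm_add F G : dterm F -> dterm G -> dterm (fun v => F v + G v).
Proof.
move=> [f rf fP] [g rg gP]; exists (GRing.Add f g) => [|e] /=; first by rewrite rf.
by rewrite fP gP.
Qed.

Lemma dterm_opp F : dterm F -> dterm (fun v => - F v).
Proof. by move=> [f rf fP]; exists (GRing.Opp f) => [//|e] /=; rewrite fP. Qed.

Lemma dterm_sub F G : dterm F -> dterm G -> dterm (fun v => F v - G v).
Proof. by move=> dF dG; apply: dterm_add => //; apply: dterm_opp. Qed.

Lemma dterm_mul F G : dterm F -> dterm G -> dterm (fun v => F v * G v).
Proof.
move=> [f rf fP] [g rg gP]; exists (GRing.Mul f g) => [|e] /=; first by rewrite rf.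
by rewrite fP gP.
Qed.

Lemma dterm_exp F k : dterm F -> dterm (fun v => F v ^+ k).
Proof. by move=> [f rf fP]; exists (GRing.Exp f k) => [//|e] /=; rewrite fP. Qed.

Lemma dterm_sum (I : Type) (s : seq I) (P : pred I) (FF : I -> (nat -> R) -> R) :
  (forall i, dterm (FF i)) -> dterm (fun v => \sum_(i <- s | P i) FF i v).
Proof.
move=> dF; elim: s => [|i s IH].
  by under [X in dterm X]eq_fun do rewrite big_nil; apply: dterm_const.
under [X in dterm X]eq_fun do rewrite big_cons.
by case: (P i) => //; apply: dterm_add.
Qed.

Lemma dterm_prod (I : Type) (s : seq I) (P : pred I) (FF : I -> (nat -> R) -> R) :
  (forall i, dterm (FF i)) -> dterm (fun v => \prod_(i <- s | P i) FF i v).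
Proof.
move=> dF; elim: s => [|i s IH].
  by under [X in dterm X]eq_fun do rewrite big_nil; apply: dterm_const.
under [X in dterm X]eq_fun do rewrite big_cons.
by case: (P i) => //; apply: dterm_mul.
Qed.

(* A row vector occupies the variables 10 + 4 i + k; the number k < 4 of the
   block and the variables below 10 keep blocks and scalars apart. *)
Definition blk n k v : 'rV[R]_n := \row_i v (10 + 4 * i + k)%N.

Definition updb n k v (x : 'rV[R]_n) : nat -> R := fun j =>
  if (10 <= j)%N then
    if [pick i : 'I_n | j == 10 + 4 * i + k]%N is Some i then x 0 i else v j
  else v j.

Lemma blk_updb n k v (x : 'rV[R]_n) : blk n k (updb k v x) = x.
Proof.
apply/rowP => i; rewrite mxE /updb.
have -> : (9 < 10 + 4 * i + k)%N = true by lia.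
case: pickP => [j /eqP e|/(_ i)]; last by rewrite eqxx.
by congr (x _ _); apply/val_inj => /=; lia.
Qed.

Lemma blk_updb_neq n k k' v (x : 'rV[R]_n) :
  (k < 4)%N -> (k' < 4)%N -> k != k' -> blk n k (updb k' v x) = blk n k v.
Proof.
move=> k4 k'4 kk'; apply/rowP => i; rewrite !mxE /updb.
have -> : (9 < 10 + 4 * i + k)%N = true by lia.
by case: pickP => // j /eqP e; exfalso; move: kk'; apply/negP/negPn/eqP; lia.
Qed.

Lemma dfn_exb_updb n k A :
  dfn A -> dfn (fun v => exists x : 'rV[R]_n, A (updb k v x)).
Proof.
move=> dA.
(* Scalar quantifiers are introduced one at a time; the witness may differ from [v] only at the
   variables in [s]. *)
have H (s : seq nat) :
    dfn (fun v => exists2 v', (forall j, j \notin s -> v' j = v j) & A v').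
  elim: s => [|i s IH].
    apply: dfn_ext dA => v; split=> [Av|[v' v'P]]; first by exists v.
    by congr A; apply/funext => j; apply: v'P.
  apply: dfn_ext (dfn_ex_upd i IH) => v; split=> [[x [v' v'P Av']]|[v' v'P Av']].
    exists v' => // j; rewrite inE negb_or => /andP[ji js].
    by rewrite v'P// /upd (negbTE ji).
  exists (v' i), v' => // j js; rewrite /upd; case: eqP => [->//|/eqP ji].
  by rewrite v'P// inE negb_or ji.
apply: dfn_ext (H [seq (10 + 4 * i + k)%N | i <- iota 0 n]) => v; split.
  move=> [v' v'P Av']; exists (blk n k v'); suff -> : updb k v (blk n k v') = v' by [].
  apply/funext => j; rewrite /updb; case: ifP => j10.
    case: pickP => [i /eqP ->|jP]; first by rewrite mxE.
    rewrite v'P//; apply/negP => /mapP[i]; rewrite mem_iota add0n /= => il e.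
    by have := jP (Ordinal il); rewrite e eqxx.
  rewrite v'P//; apply/negP => /mapP[i]; rewrite mem_iota add0n /= => il e.
  by move: j10; rewrite e; lia.
move=> [x Ax]; exists (updb k v x) => // j jn; rewrite /updb; case: ifP => // j10.
case: pickP => // i /eqP e; exfalso; move/negP: jn; apply.
by apply/mapP; exists (val i) => //; rewrite mem_iota add0n ltn_ord.
Qed.

Lemma dfn_exb n k (P : (nat -> R) -> 'rV[R]_n -> Prop) :
  (forall v x, P (updb k v x) x <-> P v x) ->
  dfn (fun v => P v (blk n k v)) -> dfn (fun v => exists x, P v x).
Proof.
move=> Pk /(dfn_exb_updb n k); apply: dfn_ext => v.
by split=> -[x Px]; exists x; move: Px; rewrite blk_updb Pk.
Qed.

Lemma dfn_allb n k (P : (nat -> R) -> 'rV[R]_n -> Prop) :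
  (forall v x, P (updb k v x) x <-> P v x) ->
  dfn (fun v => P v (blk n k v)) -> dfn (fun v => forall x, P v x).
Proof.
move=> Pk dP.
have dnP : dfn (fun v => exists x, ~ P v x).
  by apply: (dfn_exb (k := k)) => [v x|]; [rewrite Pk|exact: dfn_not].
apply: dfn_ext (dfn_not dnP) => v; split=> [h x|h [x]]; last exact.
by apply: contrapT => nP; apply: h; exists x.
Qed.

Lemma dterm_blk n k i : dterm (fun v => blk n k v 0 i).
Proof.
by under [X in dterm X]eq_fun do rewrite mxE; apply: dterm_var.
Qed.

Lemma dterm_peval n k (p : realpoly R n) : dterm (fun v => peval p (blk n k v)).
Proof.
under [X in dterm X]eq_fun do rewrite /peval mpoly.mevalE.
apply: dterm_sum => m; apply: dterm_mul; first exact: dterm_const.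
by apply: dterm_prod => i; apply: dterm_exp; apply: dterm_blk.
Qed.

Lemma semialgebraic_dfn n k (X : set 'rV[R]_n) :
  semialgebraic X -> dfn (fun v => X (blk n k v)).
Proof.
elim=> [p|p|A _ dA|A B _ dA _ dB].
- by apply: dfn_eq; [apply: dterm_peval|apply: dterm_const].
- by apply: dfn_lt; [apply: dterm_const|apply: dterm_peval].
- exact: dfn_not.
- exact: dfn_or.
Qed.

Lemma poly_bounded01 (p : {poly R}) :
  exists2 M : R, 0 < M & forall s : R, 0 <= s <= 1 -> `|p.[s]| <= M.
Proof.
elim/poly_ind: p => [|p c [M M0 MP]].
  by exists 1 => // s _; rewrite horner0 normr0.
exists (M + `|c|) => [|s s01]; first by rewrite ltr_wpDr.
rewrite !hornerE (le_trans (ler_normD _ _))// lerD2r normrM.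
have /andP[s0 s1] := s01; rewrite (ger0_norm s0) -[leRHS]mulr1.
by apply: ler_pM => //; apply: MP.
Qed.

Lemma bipoly_bounded01 (q : {poly {poly R}}) :
  exists2 M : R, 0 < M &
    forall s a : R, 0 <= s <= 1 -> 0 <= a <= 1 -> `|q.[a%:P].[s]| <= M.
Proof.
elim/poly_ind: q => [|q c [M M0 MP]].
  by exists 1 => // s a _ _; rewrite !horner0 normr0.
have [N N0 NP] := poly_bounded01 c.
exists (M + N) => [|s a s01 a01]; first exact: addr_gt0.
rewrite !hornerE (le_trans (ler_normD _ _))// lerD ?NP// normrM.
have /andP[a0 a1] := a01; rewrite (ger0_norm a0) -[leRHS]mulr1.
by apply: ler_pM => //; apply: MP.
Qed.

(** Near 0 the lowest term dominates: [k] is the order of vanishing of [p] at 0 and [b] the sign of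
    its lowest nonzero coefficient. *)
Lemma poly_lower_bound0 (p : {poly R}) : p != 0 ->
  exists (k : nat) (s1 c b : R), [/\ 0 < s1, 0 < c, b != 0, `|b| = 1 &
    forall s : R, 0 < s < s1 -> c * s ^+ k <= b * p.[s]].
Proof.
elim/poly_ind: p => [|p c IH]; first by rewrite eqxx.
have [->|c0 _] := eqVneq c 0.
  rewrite addr0 mulf_eq0 polyX_eq0 orbF => /IH[k [s1 [c1 [b [s10 c10 b0 b1 H]]]]].
  exists k.+1, s1, c1, b; split=> // s s01; have /andP[s0 _] := s01.
  rewrite hornerMX exprSr !mulrA; apply: ler_wpM2r; first exact: ltW.
  exact: H.
have [M M0 MP] := poly_bounded01 p.
have nc : 0 < `|c| by rewrite normr_gt0.
exists 0%N, (Num.min 1 (`|c| / (2 * M))), (`|c| / 2), (Num.sg c); split.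
- by rewrite lt_min ltr01 divr_gt0// mulr_gt0.
- by rewrite divr_gt0.
- by rewrite sgr_eq0.
- by rewrite normr_sg c0.
move=> s /andP[s0]; rewrite lt_min ltr_pdivlMr ?mulr_gt0// => /andP[s1 sM].
rewrite expr0 mulr1 !hornerE /= mulrDr -normrEsg.
have : `|Num.sg c * (p.[s] * s)| <= M * s.
  rewrite normrM normr_sg c0 mul1r normrM (gtr0_norm s0) ler_wpM2r ?(ltW s0)//.
  by apply: MP; rewrite !ltW.
rewrite ler_norml => /andP[+ _]; lra.
Qed.

(** For large [k], [a] is negligible on this region against every nonzero coefficient in [s], so the
    lowest nonzero coefficient in [a] fixes the sign. This is the ordering in which [a] is positive
    and infinitely small over the germs in [s]. *)
Lemma bipoly_sg (q : {poly {poly R}}) : exists (k : nat) (s1 b : R), 0 < s1 /\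
  forall s a : R, 0 < s < s1 -> 0 < a < s ^+ k -> Num.sg (q.[a%:P].[s]) = b.
Proof.
elim/poly_ind: q => [|q c [k [s1 [b [s10 H]]]]].
  by exists 0%N, 1, 0; split=> // s a _ _; rewrite !horner0 sgr0.
have [->|c0] := eqVneq c 0.
  exists k, s1, b; split=> // s a hs ha; rewrite !hornerE sgrM (H s a)//.
  by case/andP: ha => a0 _; rewrite gtr0_sg// mulr1.
have [j [s2 [c2 [b2 [s20 c20 b20 b21 H2]]]]] := poly_lower_bound0 c0.
have [M M0 MP] := bipoly_bounded01 q.
(* One more factor [s] than the order [j] of [c] absorbs, for small [s], the bound [M] on the higher
   terms. *)
exists j.+1, (Num.min (Num.min 1 s2) (c2 / M)), (Num.sg b2); split.
  by rewrite !lt_min ltr01 s20 divr_gt0.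
move=> s a /andP[s0]; rewrite !lt_min ltr_pdivlMr// => /andP[/andP[s1' s2'] sM].
move=> /andP[a0 ak].
have a1 : a <= 1 by rewrite (le_trans (ltW ak))// exprn_ile1// ltW.
rewrite !hornerE.
have cs : c2 * s ^+ j <= b2 * c.[s] by apply: H2; rewrite s0.
have qs : `|b2 * (q.[a%:P].[s] * a)| <= M * a.
  rewrite normrM b21 mul1r normrM (gtr0_norm a0) ler_wpM2r ?(ltW a0)//.
  by apply: MP; rewrite ?a1 ?(ltW a0) ?(ltW s0) ?(ltW s1').
have sj : 0 < s ^+ j by rewrite exprn_gt0.
have pos : 0 < b2 * (q.[a%:P].[s] * a + c.[s]).
  rewrite mulrDr; move: qs; rewrite ler_norml => /andP[qs _].
  have : M * a < c2 * s ^+ j.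
    apply: (@lt_trans _ _ (M * s ^+ j.+1)); first by rewrite ltr_pM2l.
    by rewrite exprS mulrA ltr_pM2r// mulrC.
  lra.
have /eqP := gtr0_sg pos; rewrite sgrM => /eqP e.
have b22 : Num.sg b2 * Num.sg b2 = 1 by rewrite -expr2 sqr_sg b20.
by rewrite -[LHS]mul1r -b22 -mulrA e mulr1.
Qed.

Lemma term_bipoly (t : GRing.term R) : GRing.rterm t ->
  exists q : {poly {poly R}},
    forall s a, GRing.eval [:: s; a] t = q.[a%:P].[s].
Proof.
elim: t => //=.
- move=> [|[|n]] _.
  + by exists 'X%:P => s a; rewrite !hornerE.
  + by exists 'X => s a; rewrite !hornerE.
  + by exists 0 => s a; rewrite !hornerE /= nth_nil.
- by move=> c _; exists c%:P%:P => s a; rewrite !hornerE.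
- by move=> n _; exists n%:R%:P%:P => s a; rewrite !hornerE.
- move=> t1 IH1 t2 IH2 /andP[/IH1[q1 h1] /IH2[q2 h2]].
  by exists (q1 + q2) => s a; rewrite !hornerE h1 h2.
- by move=> t1 IH1 /IH1[q1 h1]; exists (- q1) => s a; rewrite !hornerE h1.
- by move=> t1 IH1 n /IH1[q1 h1]; exists (q1 *+ n) => s a; rewrite !hornerMn h1.
- move=> t1 IH1 t2 IH2 /andP[/IH1[q1 h1] /IH2[q2 h2]].
  by exists (q1 * q2) => s a; rewrite !hornerE h1 h2.
- by move=> t1 IH1 n /IH1[q1 h1]; exists (q1 ^+ n) => s a; rewrite !horner_exp h1.
Qed.

Lemma term2_sg (t1 t2 : GRing.term R) : GRing.rterm t1 -> GRing.rterm t2 ->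
  exists (k : nat) (s1 b : R), 0 < s1 /\ forall s a : R, 0 < s < s1 -> 0 < a < s ^+ k ->
    Num.sg (GRing.eval [:: s; a] t1 - GRing.eval [:: s; a] t2) = b.
Proof.
move=> /term_bipoly[q1 h1] /term_bipoly[q2 h2].
have [k [s1 [b [s10 H]]]] := bipoly_sg (q1 - q2).
by exists k, s1, b; split=> // s a hs ha; rewrite -(H s a hs ha) h1 h2 !hornerE.
Qed.

Lemma qf_germ (f : ordered_qelim.ord.formula R) :
  ordered_qelim.ord.qf_form f -> ordered_qelim.ord.rformula f ->
  exists (k : nat) (s1 : R) b, 0 < s1 /\ forall s a : R, 0 < s < s1 -> 0 < a < s ^+ k ->
    ordered_qelim.ord.qf_eval [:: s; a] f = b.
Proof.
have combine (f1 f2 : ordered_qelim.ord.formula R) (op : bool -> bool -> bool) :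
  (exists (k : nat) (s1 : R) b, 0 < s1 /\ forall s a : R, 0 < s < s1 -> 0 < a < s ^+ k ->
    ordered_qelim.ord.qf_eval [:: s; a] f1 = b) ->
  (exists (k : nat) (s1 : R) b, 0 < s1 /\ forall s a : R, 0 < s < s1 -> 0 < a < s ^+ k ->
    ordered_qelim.ord.qf_eval [:: s; a] f2 = b) ->
  exists k s1 b, 0 < s1 /\ forall s a, 0 < s < s1 -> 0 < a < s ^+ k ->
    op (ordered_qelim.ord.qf_eval [:: s; a] f1)
       (ordered_qelim.ord.qf_eval [:: s; a] f2) = b.
  move=> [k1 [s1 [b1 [s10 H1]]]] [k2 [s2 [b2 [s20 H2]]]].
  exists (k1 + k2)%N, (Num.min 1 (Num.min s1 s2)), (op b1 b2); split.
    by rewrite !lt_min ltr01 s10 s20.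
  move=> s a /andP[s0]; rewrite !lt_min => /and3P[s1' ss1 ss2] /andP[a0 ak].
  have le k k' : s ^+ (k + k') <= s ^+ k.
    by rewrite exprD ler_piMr ?exprn_ge0 ?exprn_ile1// ltW.
  rewrite H1 ?H2 ?s0 ?ss1 ?ss2//.
    by rewrite a0 (lt_le_trans ak)// addnC le.
  by rewrite a0 (lt_le_trans ak)// le.
elim: f => //=.
- by move=> b _ _; exists 0%N, 1, b; split.
- move=> t1 t2 _ /andP[r1 r2]; have [k [s1 [b [s10 H]]]] := term2_sg r1 r2.
  exists k, s1, (b == 0); split=> // s a hs ha; rewrite -(H s a hs ha).
  by rewrite sgr_eq0 subr_eq0.
- move=> t1 t2 _ /andP[r1 r2]; have [k [s1 [b [s10 H]]]] := term2_sg r1 r2.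
  exists k, s1, (b < 0); split=> // s a hs ha; rewrite -(H s a hs ha).
  by rewrite sgr_lt0 subr_lt0.
- move=> t1 t2 _ /andP[r1 r2]; have [k [s1 [b [s10 H]]]] := term2_sg r1 r2.
  exists k, s1, (b <= 0); split=> // s a hs ha; rewrite -(H s a hs ha).
  by rewrite sgr_le0 subr_le0.
- move=> f1 IH1 f2 IH2 /andP[q1 q2] /andP[r1 r2].
  exact: (combine f1 f2 andb (IH1 q1 r1) (IH2 q2 r2)).
- move=> f1 IH1 f2 IH2 /andP[q1 q2] /andP[r1 r2].
  exact: (combine f1 f2 orb (IH1 q1 r1) (IH2 q2 r2)).
- move=> f1 IH1 f2 IH2 /andP[q1 q2] /andP[r1 r2].
  exact: (combine f1 f2 implb (IH1 q1 r1) (IH2 q2 r2)).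
- move=> f1 IH1 q1 r1.
  exact: (combine f1 f1 (fun x _ => ~~ x) (IH1 q1 r1) (IH1 q1 r1)).
Qed.

(** Quantifier elimination reduces the claim to signs of polynomials. The gain is uniformity: a
    property which at each [s] holds for all sufficiently small radii [a] holds for all radii below
    a fixed power of [s]. *)
Lemma dfn_germ2 (A : R -> R -> Prop) : dfn (fun v => A (v 0) (v 1)) ->
  exists (k : nat) (s1 : R), 0 < s1 /\
   ((forall s a : R, 0 < s < s1 -> 0 < a < s ^+ k -> A s a) \/
    (forall s a : R, 0 < s < s1 -> 0 < a < s ^+ k -> ~ A s a)).
Proof.
move=> [f fP].
set w := fun i bc => qe_rcf.qfr_to_formula (@qe_rcf.wproj R i bc).
set g := ordered_qelim.ord.quantifier_elim w (ordered_qelim.ord.to_rform f).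
have /andP[qg rg] : ordered_qelim.ord.qf_form g && ordered_qelim.ord.rformula g.
  apply: ordered_qelim.ord.quantifier_elim_wf; first exact: qe_rcf.wf_QE_wproj.
  exact: ordered_qelim.ord.to_rform_rformula.
have [k [s1 [b [s10 H]]]] := qf_germ qg rg.
have AP s a : reflect (A s a) (ordered_qelim.ord.qf_eval [:: s; a] g).
  apply: (equivP (ordered_qelim.ord.quantifier_elim_rformP
    (@qe_rcf.wf_QE_wproj R) (@qe_rcf.valid_QE_wproj R) [:: s; a]
    (ordered_qelim.ord.to_rform_rformula f))).
  by rewrite (fP [:: s; a]); apply: ordered_qelim.ord.to_rformP.
exists k, s1; split=> //; case: b H => H; [left|right] => s a hs ha.
  by apply/AP; rewrite H.
by apply/AP; rewrite H.
Qed.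

Lemma dfn_germ (A : R -> Prop) : dfn (fun v => A (v 0)) ->
  exists s1 : R, 0 < s1 /\
   ((forall s : R, 0 < s < s1 -> A s) \/ (forall s : R, 0 < s < s1 -> ~ A s)).
Proof.
move=> /(dfn_germ2 (A := fun s _ => A s))[k [s1 [s10 H]]]; exists s1; split=> //.
case: H => H; [left|right] => s hs; (apply: (H s (s ^+ k / 2)) => //);
  by have /andP[s0 _] := hs; have := exprn_gt0 k s0; lra.
Qed.

End Definable.

(** * Germs and curves of definable sets *)

Section Renaming.
Variable R : realType.
Variable rho : nat -> nat.

Fixpoint ren_term (t : GRing.term R) : GRing.term R :=
  match t with
  | GRing.Var i => GRing.Var R (rho i)
  | GRing.Const c => GRing.Const c
  | GRing.NatConst n => GRing.NatConst R n
  | GRing.Add a b => GRing.Add (ren_term a) (ren_term b)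
  | GRing.Opp a => GRing.Opp (ren_term a)
  | GRing.NatMul a n => GRing.NatMul (ren_term a) n
  | GRing.Mul a b => GRing.Mul (ren_term a) (ren_term b)
  | GRing.Inv a => GRing.Inv (ren_term a)
  | GRing.Exp a n => GRing.Exp (ren_term a) n
  end.

Fixpoint ren_qf (f : ordered_qelim.ord.formula R) : ordered_qelim.ord.formula R :=
  match f with
  | ordered_qelim.ord.Bool b => ordered_qelim.ord.Bool b
  | ordered_qelim.ord.Equal a b => ordered_qelim.ord.Equal (ren_term a) (ren_term b)
  | ordered_qelim.ord.Lt a b => ordered_qelim.ord.Lt (ren_term a) (ren_term b)
  | ordered_qelim.ord.Le a b => ordered_qelim.ord.Le (ren_term a) (ren_term b)
  | ordered_qelim.ord.Unit a => ordered_qelim.ord.Unit (ren_term a)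
  | ordered_qelim.ord.And f g => ordered_qelim.ord.And (ren_qf f) (ren_qf g)
  | ordered_qelim.ord.Or f g => ordered_qelim.ord.Or (ren_qf f) (ren_qf g)
  | ordered_qelim.ord.Implies f g => ordered_qelim.ord.Implies (ren_qf f) (ren_qf g)
  | ordered_qelim.ord.Not f => ordered_qelim.ord.Not (ren_qf f)
  | _ => ordered_qelim.ord.Bool false
  end.

Variables e e' : seq R.
Hypothesis ee' : forall i, e'`_i = e`_(rho i).

Lemma eval_ren (t : GRing.term R) : GRing.eval e (ren_term t) = GRing.eval e' t.
Proof. by elim: t => //=; do ?[move=> ? ->|move=> ?]. Qed.

Lemma holds_ren (f : ordered_qelim.ord.formula R) : ordered_qelim.ord.qf_form f ->
  (ordered_qelim.ord.holds e (ren_qf f) <-> ordered_qelim.ord.holds e' f).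
Proof.
elim: f => //=; try by move=> *; rewrite !eval_ren.
- by move=> f IHf g IHg /andP[/IHf -> /IHg ->].
- by move=> f IHf g IHg /andP[/IHf -> /IHg ->].
- by move=> f IHf g IHg /andP[/IHf -> /IHg ->].
- by move=> f IHf /IHf ->.
Qed.

End Renaming.

(** Quantifiers are eliminated first, so that the renaming meets no bound variable. Since [rho] is
    the identity from [m] on, the renamed valuation is again given by a finite list. *)
Lemma dfn_ren (R : realType) (rho : nat -> nat) (m : nat) (A : (nat -> R) -> Prop) :
  (forall i, (m <= i)%N -> rho i = i) -> dfn A -> dfn (fun v => A (fun i => v (rho i))).
Proof.
move=> rhom [f fP].
set w := fun i bc => qe_rcf.qfr_to_formula (@qe_rcf.wproj R i bc).
set g := ordered_qelim.ord.quantifier_elim w (ordered_qelim.ord.to_rform f).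
have /andP[qg rg] : ordered_qelim.ord.qf_form g && ordered_qelim.ord.rformula g.
  apply: ordered_qelim.ord.quantifier_elim_wf; first exact: qe_rcf.wf_QE_wproj.
  exact: ordered_qelim.ord.to_rform_rformula.
exists (ren_qf rho g) => e.
set e' := mkseq (fun i => e`_(rho i)) (maxn m (size e)).
have ee' i : e'`_i = e`_(rho i).
  have [ie|ie] := ltnP i (maxn m (size e)); first by rewrite nth_mkseq.
  rewrite nth_default ?size_mkseq// rhom ?nth_default//; move: ie; rewrite geq_max;
    by case/andP.
have -> : (fun i => e`_(rho i)) = nth 0 e' by apply/funext => i; rewrite ee'.
rewrite (holds_ren ee' qg) (fP e') -(ordered_qelim.ord.to_rformP e' f).
apply: (iff_trans _ (iff_sym (rwP (ordered_qelim.ord.qf_evalP e' qg)))).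
exact: (rwP (ordered_qelim.ord.quantifier_elim_rformP
    (@qe_rcf.wf_QE_wproj R) (@qe_rcf.valid_QE_wproj R) e'
    (ordered_qelim.ord.to_rform_rformula f))).
Qed.

Lemma dfn_subst2 (R : realType) (A : R -> R -> Prop) i j :
  dfn (fun v => A (v 0) (v 1)) -> dfn (fun v => A (v i) (v j)).
Proof.
pose rho k := match k with 0 => i | 1 => j | _ => k end%N.
by apply: (@dfn_ren R rho 2) => -[|[|k]].
Qed.

Lemma dfn_block1 (R : realType) n (A : R -> 'rV[R]_n -> Prop) :
  dfn (fun v => A (v 0) (blk n 0 v)) -> dfn (fun v => A (v 0) (blk n 1 v)).
Proof.
pose rho k := if (10 <= k < 10 + 4 * n)%N && ((k - 10) %% 4 == 0)%N then k.+1 else k.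
move=> /(@dfn_ren R rho (10 + 4 * n)) dA.
have {}dA := dA _; apply: dfn_ext (dA _) => [v|i ni].
  have -> : blk n 0 (fun i => v (rho i)) = blk n 1 v; last by [].
  apply/rowP => i; rewrite !mxE /rho; have i_n := ltn_ord i.
  rewrite ifT; first by congr v; lia.
  by apply/andP; split; [lia|apply/eqP; lia].
by rewrite /rho ifF//; apply/negbTE; lia.
Qed.

(** * Monotonicity and continuity of bounded definable functions near 0 *)

Section Monotonicity.
Variable R : realType.
Implicit Types (f : R -> R) (s : R).

Definition mono_on f (s1 : R) : Prop :=
  (forall s u, 0 < s -> s <= u -> u < s1 -> f s <= f u) \/
  (forall s u, 0 < s -> s <= u -> u < s1 -> f u <= f s).

Definition cont_on f (s1 : R) : Prop :=
  forall s, 0 < s < s1 -> {for s, continuous f}.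

(** Subdivide the interval into steps shorter than [c]. *)
Lemma chain_le (f : R -> R) (s u c : R) : 0 < c -> s <= u ->
  (forall w w', s <= w -> w < w' -> w' < w + c -> w' <= u -> f w <= f w') ->
  f s <= f u.
Proof.
move=> c0 su H.
have [->//|neq] := eqVneq s u.
have {}su : s < u by rewrite lt_neqAle neq.
pose N := Num.bound ((u - s) / c).
have hN : (u - s) / c < N%:R by apply: archi_boundP; rewrite divr_ge0 ?subr_ge0 ?ltW.
have N0 : (0 : R) < N%:R.
  by apply: le_lt_trans hN; rewrite divr_ge0 ?subr_ge0 ?ltW.
pose p k := s + k%:R * ((u - s) / N%:R).
have d0 : 0 < (u - s) / N%:R by rewrite divr_gt0// subr_gt0.
have dc : (u - s) / N%:R < c by rewrite ltr_pdivrMr// mulrC -ltr_pdivrMr.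
have pN : p N = u by rewrite /p mulrC divfK ?gt_eqF// addrC subrK.
have : forall k, (k <= N)%N -> f s <= f (p k).
  elim=> [|k IH] kN; first by rewrite /p mul0r addr0.
  have pS : p k.+1 = p k + (u - s) / N%:R by rewrite /p -natr1 mulrDl mul1r addrA.
  apply: le_trans (IH (ltnW kN)) _; apply: H.
  - by rewrite /p lerDl mulr_ge0// ltW.
  - by rewrite pS ltrDl.
  - by rewrite pS ltrD2l.
  - by rewrite -pN /p lerD2l ler_pM2r// ler_nat.
by move=> /(_ N (leqnn N)); rewrite pN.
Qed.

Section DefinableFunction.
Variables (D : R -> R -> Prop) (f : R -> R) (s0 B : R).
Hypothesis s0_gt0 : 0 < s0.
Hypothesis dD : dfn (fun v => D (v 0) (v 1)).
Hypothesis Df : forall s, 0 < s < s0 -> forall y, D s y <-> y = f s.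
Hypothesis fB : forall s, 0 < s < s0 -> `|f s| <= B.

Let dD' i j : dfn (fun v => D (v i) (v j)). Proof. exact: dfn_subst2. Qed.

(** Just to the right of each [s], either [f u >= f s] throughout or [f u < f s] throughout.
    [dfn_germ2] makes the same case occur at all small [s], on an interval whose length is bounded
    below by a power of [s], and [chain_le] passes from these local comparisons to monotonicity. *)
Lemma definable_mono : exists2 s1 : R, 0 < s1 <= s0 & mono_on f s1.
Proof.
pose Q1 s a := forall u, s < u -> u < s + a -> u < s0 ->
  forall y z, D s y -> D u z -> y <= z.
pose Q2 s a := forall u, s < u -> u < s + a -> u < s0 ->
  forall y z, D s y -> D u z -> z < y.
have V := @dterm_var R.
have dQ1 : dfn (fun v => Q1 (v 0) (v 1)).
  apply: (dfn_all (i := 2)) => //; apply: dfn_imp; first exact: dfn_lt.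
  apply: dfn_imp; first by apply: dfn_lt => //; apply: dterm_add.
  apply: dfn_imp; first by apply: dfn_lt => //; apply: dterm_const.
  apply: (dfn_all (i := 3)) => //; apply: (dfn_all (i := 4)) => //; apply: dfn_imp; first exact: (dD' 0 3).
  by apply: dfn_imp; [exact: (dD' 2 4)|apply: dfn_le].
have dQ2 : dfn (fun v => Q2 (v 0) (v 1)).
  apply: (dfn_all (i := 2)) => //; apply: dfn_imp; first exact: dfn_lt.
  apply: dfn_imp; first by apply: dfn_lt => //; apply: dterm_add.
  apply: dfn_imp; first by apply: dfn_lt => //; apply: dterm_const.
  apply: (dfn_all (i := 3)) => //; apply: (dfn_all (i := 4)) => //; apply: dfn_imp; first exact: (dD' 0 3).
  by apply: dfn_imp; [exact: (dD' 2 4)|apply: dfn_lt].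
have Q1E s a : 0 < s < s0 ->
    Q1 s a <-> (forall u, s < u -> u < s + a -> u < s0 -> f s <= f u).
  move=> /[dup] hs /andP[sp _]; split=> [h u su ua us|h u su ua us y z].
    by apply: (h u) => //; apply/Df => //; rewrite us (lt_trans sp).
  by rewrite (Df hs) Df ?us ?(lt_trans sp)// => -> ->; apply: h.
have Q2E s a : 0 < s < s0 ->
    Q2 s a <-> (forall u, s < u -> u < s + a -> u < s0 -> f u < f s).
  move=> /[dup] hs /andP[sp _]; split=> [h u su ua us|h u su ua us y z].
    by apply: (h u) => //; apply/Df => //; rewrite us (lt_trans sp).
  by rewrite (Df hs) Df ?us ?(lt_trans sp)// => -> ->; apply: h.
have [k1 [s1 [s10 H1]]] := dfn_germ2 dQ1.
have step (k : nat) (s w : R) : 0 < s -> s <= w -> 0 < s ^+ k / 2 < w ^+ k.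
  move=> sp sw; have := exprn_gt0 k sp => h; rewrite divr_gt0//=.
  have : s ^+ k <= w ^+ k by rewrite lerXn2r// nnegrE ltW// (lt_le_trans sp).
  by lra.
case: H1 => H1.
  exists (Num.min s1 s0); first by rewrite lt_min s10 s0_gt0 ge_min lexx orbT.
  left=> s u sp su; rewrite lt_min => /andP[us1 us0].
  apply: (@chain_le f s u (s ^+ k1 / 2)) => //; first by rewrite divr_gt0 ?exprn_gt0.
  move=> w w' sw ww' w'c w'u.
  have wp : 0 < w by apply: lt_le_trans sw.
  have ws1 : w < s1 by apply: lt_trans ww' _; apply: le_lt_trans us1.
  have ws0 : w < s0 by apply: lt_trans ww' _; apply: le_lt_trans us0.
  have := H1 w (s ^+ k1 / 2); rewrite wp ws1 => /(_ isT (step _ _ _ sp sw)).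
  by rewrite Q1E ?wp//; apply => //; apply: le_lt_trans us0.
have [k2 [s2 [s20 H2]]] := dfn_germ2 dQ2.
case: H2 => H2.
  exists (Num.min s2 s0); first by rewrite lt_min s20 s0_gt0 ge_min lexx orbT.
  right=> s u sp su; rewrite lt_min => /andP[us2 us0].
  rewrite -lerN2; apply: (@chain_le (fun x => - f x) s u (s ^+ k2 / 2)) => //.
    by rewrite divr_gt0 ?exprn_gt0.
  move=> w w' sw ww' w'c w'u; rewrite lerN2; apply: ltW.
  have wp : 0 < w by apply: lt_le_trans sw.
  have ws2 : w < s2 by apply: lt_trans ww' _; apply: le_lt_trans us2.
  have ws0 : w < s0 by apply: lt_trans ww' _; apply: le_lt_trans us0.
  have := H2 w (s ^+ k2 / 2); rewrite wp ws2 => /(_ isT (step _ _ _ sp sw)).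
  by rewrite Q2E ?wp//; apply => //; apply: le_lt_trans us0.
(* If both properties fail for all small [s], they fail at this one; but the germ at 0 of
   [f (s + x) < f s], as a property of [x], decides in favour of one of them. *)
exfalso.
pose s := Num.min (Num.min s1 s2) s0 / 2.
have m0 : 0 < Num.min (Num.min s1 s2) s0 by rewrite !lt_min s10 s20 s0_gt0.
have sp : 0 < s by rewrite divr_gt0.
have : s < Num.min (Num.min s1 s2) s0 by rewrite /s; lra.
rewrite !lt_min => /andP[/andP[ss1 ss2] ss0].
have dG : dfn (fun v => forall t u, t = s -> u = s + v 0 ->
    forall y z, D t y -> D u z -> z < y).
  apply: (dfn_all (i := 1)) => //; apply: (dfn_all (i := 2)) => //.
  apply: dfn_imp; first by apply: dfn_eq => //; apply: dterm_const.
  apply: dfn_imp.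
    by apply: dfn_eq => //; apply: dterm_add => //; apply: dterm_const.
  apply: (dfn_all (i := 3)) => //; apply: (dfn_all (i := 4)) => //; apply: dfn_imp; first exact: (dD' 1 3).
  by apply: dfn_imp; [exact: (dD' 2 4)|apply: dfn_lt].
have [r [r0 H]] := dfn_germ (A := fun x => forall t u, t = s -> u = s + x ->
    forall y z, D t y -> D u z -> z < y) dG.
have hs : 0 < s < s0 by rewrite sp.
case: H => H.
  have sk : 0 < s ^+ k2 by rewrite exprn_gt0.
  pose a := Num.min r (s ^+ k2) / 2.
  have a0 : 0 < Num.min r (s ^+ k2) by rewrite lt_min r0.
  have : a < Num.min r (s ^+ k2) by rewrite /a; lra.
  have ap : 0 < a by rewrite divr_gt0.
  rewrite lt_min => /andP[ar ak].
  apply: (H2 s a); rewrite ?sp ?ap//; apply/Q2E => // u su ua us.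
  have hu : 0 < u < s0 by rewrite us (lt_trans sp).
  apply: (H (u - s) _ s u) => //; rewrite ?Df//; last by rewrite addrC subrK.
  by rewrite subr_gt0 su/= ltrBlDl (lt_trans ua)// ltrD2l.
have sk : 0 < s ^+ k1 by rewrite exprn_gt0.
pose a := Num.min r (s ^+ k1) / 2.
have a0 : 0 < Num.min r (s ^+ k1) by rewrite lt_min r0.
have : a < Num.min r (s ^+ k1) by rewrite /a; lra.
have ap : 0 < a by rewrite divr_gt0.
rewrite lt_min => /andP[ar ak].
apply: (H1 s a); rewrite ?sp ?ap//; apply/Q1E => // u su ua us.
have hu : 0 < u < s0 by rewrite us (lt_trans sp).
rewrite leNgt; apply/negP => fuf; apply: (H (u - s)).
  by rewrite subr_gt0 su/= ltrBlDl (lt_trans ua)// ltrD2l.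
move=> t u' -> -> y z; rewrite addrC subrK Df// Df// => -> ->; exact: fuf.
Qed.

(** [J s a] says that [f] jumps by at least [a] at [s]. If at all small [s] the jump exceeds every
    [a < s ^+ k], then many jumps of a fixed size [c] between [s2 / 2] and [s2] contradict the bound
    [B]. Otherwise the jump at every small [s] is below every positive number, and monotonicity
    gives continuity. *)
Lemma definable_cont_nondec s1 : 0 < s1 <= s0 ->
  (forall s u, 0 < s -> s <= u -> u < s1 -> f s <= f u) ->
  exists2 s2 : R, 0 < s2 <= s1 & cont_on f s2.
Proof.
move=> /andP[s10 s1s0] fm; have V := @dterm_var R.
pose J s a := forall u w, 0 < u -> u < s -> s < w -> w < s1 ->
  forall y z, D u y -> D w z -> a <= z - y.
have dJ : dfn (fun v => J (v 0) (v 1)).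
  apply: (dfn_all (i := 2)) => //; apply: (dfn_all (i := 3)) => //.
  apply: dfn_imp; first by apply: dfn_lt => //; apply: dterm_const.
  apply: dfn_imp; first exact: dfn_lt.
  apply: dfn_imp; first exact: dfn_lt.
  apply: dfn_imp; first by apply: dfn_lt => //; apply: dterm_const.
  apply: (dfn_all (i := 4)) => //; apply: (dfn_all (i := 5)) => //; apply: dfn_imp; first exact: (dD' 2 4).
  apply: dfn_imp; first exact: (dD' 3 5).
  by apply: dfn_le => //; apply: dterm_sub.
have JE s a : J s a <->
    (forall u w, 0 < u -> u < s -> s < w -> w < s1 -> a <= f w - f u).
  split=> [h u w u0 us sw ws|h u w u0 us sw ws y z].
    have ws0 := lt_le_trans ws s1s0; have uw := lt_trans us sw.
    apply: (h u w) => //; apply/Df => //.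
      by rewrite u0 (lt_trans uw).
    by rewrite ws0 (lt_trans u0).
  have ws0 := lt_le_trans ws s1s0; have uw := lt_trans us sw.
  rewrite !Df ?u0 ?ws0 ?(lt_trans uw)// ?(lt_trans u0 uw)// => -> ->; exact: h.
have [k [s2' [s2'0 H]]] := dfn_germ2 dJ.
pose s2 := Num.min s2' s1.
have s20 : 0 < s2 by rewrite lt_min s2'0.
have s21 : s2 <= s1 by rewrite ge_min lexx orbT.
have s22 : s2 <= s2' by rewrite ge_min lexx.
case: H => H; last first.
  exists s2; first by rewrite s20.
  move=> s /andP[sp ss2]; apply/cvgrPdist_lt => e e0.
  have sk : 0 < s ^+ k by rewrite exprn_gt0.
  pose a := Num.min e (s ^+ k) / 2.
  have a0 : 0 < Num.min e (s ^+ k) by rewrite lt_min e0.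
  have : a < Num.min e (s ^+ k) by rewrite /a; lra.
  have ap : 0 < a by rewrite divr_gt0.
  rewrite lt_min => /andP[ae ak].
  have nJ : ~ J s a by apply: H; rewrite ?sp ?ap ?(lt_le_trans ss2).
  have [u [w [u0 us sw ws fa]]] : exists u w, [/\ 0 < u, u < s, s < w, w < s1 &
      f w - f u < a].
    apply: contrapT => nex; apply: nJ; apply/JE => u w u0 us sw ws.
    by rewrite leNgt; apply/negP => fa; apply: nex; exists u, w.
  have nb : \forall t \near s, t \in `]u, w[.
    by apply: near_in_itvoo; rewrite in_itv /= us.
  near=> t.
  have /andP[ut tw] : u < t < w.
    have : t \in `]u, w[ by near: t.
    by rewrite in_itv.
  have t0 := lt_trans u0 ut; have ts1 := lt_trans tw ws.
  have ss1 := lt_trans sw ws.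
  have h1 : f u <= f t by apply: fm => //; exact: ltW.
  have h2 : f t <= f w by apply: fm => //; exact: ltW.
  have h3 : f u <= f s by apply: fm => //; exact: ltW.
  have h4 : f s <= f w by apply: fm => //; exact: ltW.
  by rewrite ltr_norml; apply/andP; split; lra.
exfalso.
pose c := (s2 / 2) ^+ k / 2.
have h2 : 0 < s2 / 2 by rewrite divr_gt0.
have c0 : 0 < c by rewrite divr_gt0// exprn_gt0.
have B0 : 0 <= B.
  have : 0 < s0 / 2 < s0 by rewrite divr_gt0//=; lra.
  by move=> /fB; apply: le_trans.
pose N := Num.bound (2 * B / c).
have hN : 2 * B / c < N%:R.
  by apply: archi_boundP; apply: divr_ge0; [apply: mulr_ge0|apply: ltW].
have {}hN : 2 * B < N%:R * c by rewrite -ltr_pdivrMr.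
have N0 : (0 : R) < N.+1%:R by [].
pose d := s2 / 2 / N.+1%:R.
have d0 : 0 < d by rewrite divr_gt0.
pose p (j : nat) : R := s2 / 2 + j%:R * d.
have p0 j : 0 < p j by rewrite /p ltr_wpDr// mulr_ge0// ltW.
have pS j : p j.+1 = p j + d by rewrite /p -[in j.+1%:R]natr1 mulrDl mul1r addrA.
have pl j : (j <= N)%N -> p j < s2.
  move=> jN; have : j%:R * d < N.+1%:R * d by rewrite ltr_pM2r// ltr_nat.
  by rewrite [N.+1%:R * d]mulrC divfK ?gt_eqF// /p; lra.
have inc j : (j.+1 <= N)%N -> f (p j) + c <= f (p j.+1).
  move=> jN; pose s := p j + d / 2.
  have s2s : s2 / 2 <= s.
    rewrite /s /p -addrA lerDl; apply: addr_ge0; last by lra.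
    by apply: mulr_ge0 => //; apply: ltW.
  have sp : 0 < s by apply: lt_le_trans s2s.
  have ss2 : s < s2 by have := pl _ jN; rewrite pS /s; lra.
  have : J s c.
    apply: H; first by rewrite sp (lt_le_trans ss2).
    rewrite c0 /c; have : (s2 / 2) ^+ k <= s ^+ k by rewrite lerXn2r// nnegrE ltW.
    by have := exprn_gt0 k h2; lra.
  move=> /JE/(_ (p j) (p j.+1) (p0 j)) h.
  rewrite -lerBrDl; apply: h.
  - by rewrite /s; lra.
  - by rewrite pS /s; lra.
  - by apply: lt_le_trans (pl _ jN) s21.
have : forall j, (j <= N)%N -> f (p 0%N) + j%:R * c <= f (p j).
  elim=> [|j IH] jN; first by rewrite mul0r addr0.
  apply: le_trans (inc _ jN); rewrite -natr1 mulrDl mul1r addrA lerD2r.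
  exact: IH (ltnW jN).
move=> /(_ N (leqnn N)).
have pin j : (j <= N)%N -> 0 < p j < s0.
  by move=> jN; rewrite p0 (lt_le_trans (pl _ jN))// (le_trans s21).
have := fB (pin _ (leqnn N)); have := fB (pin _ (leq0n N)).
by rewrite !ler_norml => /andP[? _] /andP[_ ?]; lra.
Unshelve. all: by end_near.
Qed.

End DefinableFunction.

Lemma definable_regular (D : R -> R -> Prop) (f : R -> R) (s0 B : R) :
  0 < s0 -> dfn (fun v => D (v 0) (v 1)) ->
  (forall s, 0 < s < s0 -> forall y, D s y <-> y = f s) ->
  (forall s, 0 < s < s0 -> `|f s| <= B) ->
  exists2 s1 : R, 0 < s1 <= s0 & mono_on f s1 /\ cont_on f s1.
Proof.
move=> s00 dD Df fB.
have [s1 s1P fm] := definable_mono s00 dD Df.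
have [s2 /andP[s20 s21] fc] : exists2 s2 : R, 0 < s2 <= s1 & cont_on f s2.
  case: fm => fm; first exact: definable_cont_nondec dD Df fB _ s1P fm.
  pose D' s y := D s (- y).
  have dD' : dfn (fun v => D' (v 0) (v 1)).
    apply: (@dfn_ext _ (fun v => forall x, x = - v 1 -> D (v 0) x)).
      by move=> v; split=> [|h x ->//]; exact.
    apply: (dfn_all (i := 2)) => //; apply: dfn_imp; last exact: (dfn_subst2 0 2 dD).
    by apply: dfn_eq; [|apply: dterm_opp]; apply: dterm_var.
  have [|s hs|s u sp su us|s2 s2P fc] :=
      @definable_cont_nondec D' (fun s => - f s) s0 B s00 dD' _ _ s1 s1P.
  - by move=> s hs y; rewrite /D' Df//; split=> [<-|->]; rewrite opprK.
  - by rewrite normrN; apply: fB.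
  - by rewrite lerN2; apply: fm.
  exists s2 => // s /fc /(@continuousN _ _ _ (fun s => - f s)).
  by apply: (eq_ind_r (fun g => {for s, continuous g} -> _)); last
    (by apply/funext => x /=; rewrite opprK); [].
exists s2; first by rewrite s20 (le_trans s21)//; case/andP: s1P.
split=> //; case: fm => fm; [left|right] => s u sp su us; apply: fm => //;
  exact: lt_le_trans us s21.
Qed.

End Monotonicity.

(** * Definable selection of curves and their length *)

Section Curves.
Variables (R : realType) (n : nat).

Lemma cube_compact (B : R) : compact [set x : 'rV[R]_n | forall i, `|x 0 i| <= B].
Proof.
have -> : [set x : 'rV[R]_n | forall i, `|x 0 i| <= B] =
    [set v | forall i, `[- B, B]%classic (v ord0 i)].
  by apply/seteqP; split=> x /= H i; have := H i; rewrite /= in_itv /= ler_norml.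
by apply: (@rV_compact R n (fun=> `[- B, B]%classic)) => i; apply: segment_compact.
Qed.

Lemma closed_cube_compact (B : R) (A : set 'rV[R]_n) : closed A ->
  (forall x, A x -> forall i, `|x 0 i| <= B) -> compact A.
Proof. by move=> cA AB; exact: (subclosed_compact cA (@cube_compact B) AB). Qed.

Definition fibers_ok (B l0 : R) (A : R -> 'rV[R]_n -> Prop) : Prop :=
  [/\ dfn (fun v => A (v 0) (blk n 0 v)),
      forall l, 0 < l < l0 -> exists x, A l x,
      forall l, 0 < l < l0 -> closed [set x | A l x] &
      forall l, 0 < l < l0 -> forall x, A l x -> forall i, `|x 0 i| <= B].

Lemma coord_min (B l0 : R) (A : R -> 'rV[R]_n -> Prop) (i : 'I_n) :
  fibers_ok B l0 A ->
  fibers_ok B l0 (fun l x => A l x /\ forall y, A l y -> x 0 i <= y 0 i).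
Proof.
move=> [dA eA cA bA]; split.
- apply: dfn_and => //; apply: (dfn_allb (k := 1)) => [v x|].
    by rewrite blk_updb_neq.
  apply: dfn_imp; first exact: dfn_block1.
  by apply: dfn_le; apply: dterm_blk.
- move=> l hl; have [c /[!inE] Ac cmin] : exists2 c : 'rV[R]_n,
      c \in [set x | A l x] & forall t, t \in [set x | A l x] -> c 0 i <= t 0 i.
    apply: (compact_EVT_min (f := fun x : 'rV[R]_n => x 0 i)).
    - by have [x Ax] := eA l hl; exists x.
    - exact: closed_cube_compact (cA l hl) (bA l hl).
    - by apply: continuous_subspaceT; apply: coord_continuous.
  by exists c; split=> // y Ay; apply: cmin; rewrite inE.
- move=> l hl.
  have -> : [set x | A l x /\ forall y, A l y -> x 0 i <= y 0 i] =
      [set x | A l x] `&` \bigcap_(y in [set y | A l y])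
        ((fun x : 'rV[R]_n => x 0 i) @^-1` [set t | t <= y 0 i]).
    by apply/seteqP; split=> x.
  apply: closedI; first exact: cA.
  apply: closed_bigI => y _; apply: closed_comp; last exact: closed_le.
  by move=> x _; apply: coord_continuous.
- by move=> l hl x [Ax _]; apply: bA hl x Ax.
Qed.

(** Minimizing the coordinates one after another singles out a point of each compact fibre, and does
    so definably, which an arbitrary choice would not. *)
Lemma lex_min (B l0 : R) (A : R -> 'rV[R]_n -> Prop) (s : seq 'I_n) :
  fibers_ok B l0 A -> exists A' : R -> 'rV[R]_n -> Prop,
    [/\ fibers_ok B l0 A', forall l x, A' l x -> A l x &
      forall l x y, A' l x -> A' l y -> forall i, i \in s -> x 0 i = y 0 i].
Proof.
move=> okA; elim: s => [|i s [A' [okA' A'A A'eq]]]; first by exists A.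
exists (fun l x => A' l x /\ forall y, A' l y -> x 0 i <= y 0 i); split.
- exact: coord_min.
- by move=> l x [/A'A].
- move=> l x y [Ax xmin] [Ay ymin] j; rewrite inE => /predU1P[->|js].
    by apply/eqP; rewrite eq_le xmin// ymin.
  exact: A'eq Ax Ay j js.
Qed.

Lemma eventually_all (P : 'I_n -> R -> Prop) (s0 : R) : 0 < s0 ->
  (forall i s s', 0 < s' <= s -> P i s -> P i s') ->
  (forall i, exists2 s, 0 < s <= s0 & P i s) ->
  exists2 s, 0 < s <= s0 & forall i, P i s.
Proof.
move=> s00 Pdown H.
suff [s sP Ps] : exists2 s, 0 < s <= s0 & forall i, i \in enum 'I_n -> P i s.
  by exists s => // i; apply: Ps; rewrite mem_enum.
elim: (enum 'I_n) => [|i t [s /andP[sp ss0] IH]]; first by exists s0; rewrite ?s00 /=.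
have [s' /andP[s'p s's0] Ps'] := H i.
exists (Num.min s s'); first by rewrite lt_min sp s'p/= ge_min ss0.
move=> j; rewrite inE => /predU1P[->|jt].
  by apply: Pdown Ps'; rewrite lt_min sp s'p ge_min lexx orbT.
by apply: Pdown (IH j jt); rewrite lt_min sp s'p ge_min lexx.
Qed.

Definition regular_curve (x : R -> 'rV[R]_n) (l1 : R) : Prop :=
  forall i, mono_on (fun l => x l 0 i) l1 /\ cont_on (fun l => x l 0 i) l1.

Lemma curve_selection (A : R -> 'rV[R]_n -> Prop) (B l0 : R) : 0 < l0 ->
  fibers_ok B l0 A ->
  exists l1 (x : R -> 'rV[R]_n), [/\ 0 < l1 <= l0, regular_curve x l1 &
    forall l, 0 < l < l1 -> A l (x l)].
Proof.
move=> l00 /(lex_min (enum 'I_n))[A' [[dA eA cA bA] A'A A'eq]].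
pose x l := xget 0 [set x | A' l x].
have xP l : 0 < l < l0 -> A' l (x l).
  by move=> /eA[y Ay]; apply: (xgetPex 0 (P := [set x | A' l x])); exists y.
have [l1 l1P l1x] : exists2 l1, 0 < l1 <= l0 &
    forall i, mono_on (fun l => x l 0 i) l1 /\ cont_on (fun l => x l 0 i) l1.
  apply: eventually_all => // [i s s' /andP[s'0 s's] [m c]|i].
    split=> [|u /andP[u0 us']]; last by apply: c; rewrite u0 (lt_le_trans us').
    by case: m => m; [left|right] => u w u0 uw ws'; apply: m => //;
      exact: lt_le_trans ws' s's.
  pose D s y := exists z, A' s z /\ z 0 i = y.
  apply: (@definable_regular _ D _ l0 B) => //.
  - apply: (dfn_exb (k := 0)) => [v z|]; first by [].
    apply: dfn_and => //; apply: dfn_eq; first exact: dterm_blk.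
    exact: dterm_var.
  - move=> s hs y; split=> [[z [Az <-]]|->]; last by exists (x s); split=> //; exact: xP.
    by apply: A'eq Az (xP _ hs) _ _; rewrite mem_enum.
  - by move=> s hs; apply: bA hs _ (xP s hs) i.
exists l1, x; split=> // l /andP[l0' ll1]; apply/A'A/xP.
by rewrite l0' (lt_le_trans ll1)//; case/andP: l1P.
Qed.

(** The sum norm is additive along curves with monotone coordinates, so it serves as arc length
    without any integration. *)
Definition dist1 (x y : 'rV[R]_n) : R := \sum_i `|y 0 i - x 0 i|.

Lemma dist1_ge0 x y : 0 <= dist1 x y.
Proof. by apply: sumr_ge0 => i _. Qed.

Lemma curve_dist1_additive (x : R -> 'rV[R]_n) (l1 a b c : R) :
  regular_curve x l1 -> 0 < a -> a <= b -> b <= c -> c < l1 ->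
  dist1 (x a) (x c) = dist1 (x a) (x b) + dist1 (x b) (x c).
Proof.
move=> rx a0 ab bc cl; rewrite /dist1 -big_split /=; apply: eq_bigr => i _.
have [[m|m] _] := rx i.
  have h1 := m a b a0 ab (le_lt_trans bc cl).
  have h2 := m b c (lt_le_trans a0 ab) bc cl.
  by rewrite !ger0_norm; lra.
have h1 := m a b a0 ab (le_lt_trans bc cl).
have h2 := m b c (lt_le_trans a0 ab) bc cl.
by rewrite !ler0_norm; lra.
Qed.

Lemma curve_dist1_continuous (x : R -> 'rV[R]_n) (l1 a : R) :
  regular_curve x l1 -> forall u, 0 < u < l1 -> {for u, continuous (fun t => dist1 (x a) (x t))}.
Proof.
move=> rx u hu; rewrite /dist1.
elim: (index_enum _) => [|i s IH].
  by under [X in {for u, continuous X}]eq_fun do rewrite big_nil; apply: cvg_cst.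
under [X in {for u, continuous X}]eq_fun do rewrite big_cons.
apply: cvgD IH; apply: cvg_norm; apply: cvgB; last exact: cvg_cst.
by have [_] := rx i; apply.
Qed.

(* Subdividing the curve into pieces of equal length makes the quadratic terms
   add up to an arbitrarily small amount. *)
Lemma curve_increment (x : R -> 'rV[R]_n) (F : R -> R) (l1 a b M C : R) :
  regular_curve x l1 -> 0 < a -> a <= b -> b < l1 -> 0 <= C ->
  (forall u w, a <= u -> u <= w -> w <= b ->
    F w - F u <= M * dist1 (x u) (x w) + C * dist1 (x u) (x w) ^+ 2) ->
  F b - F a <= M * dist1 (x a) (x b).
Proof.
move=> rx a0 ab bl C0 H.
set V := dist1 (x a) (x b).
have V0 : 0 <= V by apply: dist1_ge0.
have [V00|Vn0] := eqVneq V 0.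
  by have := H a b (lexx a) ab (lexx b); rewrite -/V V00 expr0n /=; lra.
have {Vn0}V0' : 0 < V by rewrite lt_neqAle eq_sym Vn0.
pose v t := dist1 (x a) (x t).
have va : v a = 0 by rewrite /v /dist1 big1// => i _; rewrite subrr normr0.
have vc : {within `[a, b], continuous v}.
  apply: continuous_in_subspaceT => u; rewrite inE /= in_itv /= => /andP[au ub].
  have hu : 0 < u < l1 by rewrite (lt_le_trans a0 au) (le_lt_trans ub).
  exact: (@curve_dist1_continuous x l1 a rx u hu).
have ve y : 0 <= y <= V -> exists2 c, a <= c <= b & v c = y.
  move=> /andP[y0 yV]; have [|c + <-] := @IVT R v a b y ab vc.
    by rewrite va ge_min y0 /= le_max; apply/orP; right; exact: yV.
  by rewrite in_itv /= => cab; exists c.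
suff step N : F b - F a <= M * V + C * V ^+ 2 / N.+1%:R.
  rewrite leNgt; apply/negP => lt.
  pose e := F b - F a - M * V.
  have e0 : 0 < e by rewrite /e; lra.
  have := step (Num.bound (C * V ^+ 2 / e)).
  set N := Num.bound _.
  have hN : C * V ^+ 2 / e < N%:R.
    apply: archi_boundP; apply: divr_ge0; last exact: ltW.
    by apply: mulr_ge0 => //; apply: sqr_ge0.
  have : C * V ^+ 2 / N.+1%:R < e.
    rewrite ltr_pdivrMr ?ltr0Sn// [ltRHS]mulrC -ltr_pdivrMr//.
    by rewrite (lt_le_trans hN)// ler_nat.
  by rewrite /e; move: (C * V ^+ 2 / N.+1%:R) => z; lra.
have yP j : (j <= N.+1)%N -> 0 <= j%:R * (V / N.+1%:R) <= V.
  move=> jN; rewrite mulr_ge0 ?divr_ge0 ?ler0n//=.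
  by rewrite mulrA ler_pdivrMr ?ltr0Sn// mulrC ler_pM2l// ler_nat.
have d0 : 0 < V / N.+1%:R by rewrite divr_gt0// ltr0Sn.
have /choice[c cP] : forall j : nat, exists t : R, (j <= N.+1)%N ->
    a <= t <= b /\ v t = j%:R * (V / N.+1%:R).
  move=> j; have [jN|_] := leqP j N.+1; last by exists 0.
  by have [t tab vt] := ve _ (yP _ jN); exists t.
have vmono u w : a <= u -> u <= w -> w <= b -> v u <= v w.
  move=> au uw wb; rewrite /v (curve_dist1_additive rx a0 au uw (le_lt_trans wb bl)).
  by rewrite lerDl dist1_ge0.
have cS j : (j.+1 <= N.+1)%N -> c j <= c j.+1.
  move=> jN; have [/andP[ac cb] vj] := cP j (ltnW jN).
  have [/andP[ac' cb'] vj'] := cP j.+1 jN.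
  rewrite leNgt; apply/negP => lt; have := vmono _ _ ac' (ltW lt) cb.
  by rewrite vj vj' ler_pM2r// ler_nat ltnn.
have dS j : (j.+1 <= N.+1)%N -> dist1 (x (c j)) (x (c j.+1)) = V / N.+1%:R.
  move=> jN; have [/andP[ac cb] vj] := cP j (ltnW jN).
  have [/andP[ac' cb'] vj'] := cP j.+1 jN.
  have := curve_dist1_additive rx a0 ac (cS j jN) (le_lt_trans cb' bl).
  by rewrite -/(v (c j.+1)) -/(v (c j)) vj vj' -natr1 mulrDl mul1r => /addrI.
have {}step j : (j <= N.+1)%N ->
    F (c j) - F (c 0%N) <= j%:R * (M * (V / N.+1%:R) + C * (V / N.+1%:R) ^+ 2).
  elim: j => [|j IH] jN; first by rewrite mul0r subrr.
  have [/andP[ac cb] vj] := cP j (ltnW jN).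
  have [/andP[ac' cb'] vj'] := cP j.+1 jN.
  have := H (c j) (c j.+1) ac (cS j jN) cb'; rewrite dS//.
  have := IH (ltnW jN); rewrite -[in j.+1%:R]natr1 mulrDl mul1r.
  by move: (M * _ + _) => z; move: (j%:R * z) => t; lra.
(* The outer division points need not be [a] and [b], but they are at length zero from them. *)
have zero u w : a <= u -> u <= w -> w <= b -> v u = v w -> F w <= F u.
  move=> au uw wb vuw; have := H u w au uw wb.
  have := curve_dist1_additive rx a0 au uw (le_lt_trans wb bl).
  rewrite -/(v u) -/(v w) vuw -[LHS]addr0 => /addrI <-.
  by rewrite expr0n /=; lra.
have [/andP[ac0 c0b] v0] := cP 0%N isT.
have [/andP[acN cNb] vN] := cP N.+1 (leqnn _).
have Fa : F (c 0%N) <= F a by apply: zero => //; rewrite va v0 mul0r.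
have Fb : F b <= F (c N.+1).
  by apply: zero => //; rewrite vN mulrC divfK// gt_eqF ?ltr0Sn.
have := step N.+1 (leqnn _).
have -> : N.+1%:R * (M * (V / N.+1%:R) + C * (V / N.+1%:R) ^+ 2) =
    M * V + C * V ^+ 2 / N.+1%:R.
  have nz : (N.+1%:R : R) != 0 by rewrite pnatr_eq0.
  by field.
by move: (M * V + _) => z; lra.
Qed.

End Curves.

(** * Closed semialgebraic sets are finite unions of basic closed ones *)

Section PolynomialEvaluation.
Variables (R : realType) (n : nat).
Implicit Types (p q : realpoly R n) (x y : 'rV[R]_n).

Definition pvar (i : 'I_n) : realpoly R n := mpoly.mpolyX R (mpoly.mnm1 i).

Lemma pevalD p q x : peval (p + q) x = peval p x + peval q x.
Proof. exact: mpoly.mevalD. Qed.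

Lemma pevalN p x : peval (- p) x = - peval p x.
Proof. exact: mpoly.mevalN. Qed.

Lemma pevalB p q x : peval (p - q) x = peval p x - peval q x.
Proof. exact: mpoly.mevalB. Qed.

Lemma pevalM p q x : peval (p * q) x = peval p x * peval q x.
Proof. exact: mpoly.mevalM. Qed.

Lemma peval0 x : peval 0 x = 0.
Proof. exact: mpoly.meval0. Qed.

Lemma peval1 x : peval 1 x = 1.
Proof. exact: mpoly.meval1. Qed.

Lemma pevalC c x : peval (mpoly.mpolyC n c) x = c.
Proof. exact: mpoly.mevalC. Qed.

Lemma pevalZ c p x : peval (c *: p) x = c * peval p x.
Proof. exact: mpoly.mevalZ. Qed.

Lemma pevalXn p k x : peval (p ^+ k) x = peval p x ^+ k.
Proof. by rewrite /peval rmorphXn. Qed.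

Lemma peval_var i x : peval (pvar i) x = x 0 i.
Proof. exact: mpoly.mevalXU. Qed.

Lemma peval_sum (I : Type) (s : seq I) (P : pred I) (F : I -> realpoly R n) x :
  peval (\sum_(i <- s | P i) F i) x = \sum_(i <- s | P i) peval (F i) x.
Proof. by rewrite /peval rmorph_sum. Qed.

Lemma peval_prod (I : Type) (s : seq I) (P : pred I) (F : I -> realpoly R n) x :
  peval (\prod_(i <- s | P i) F i) x = \prod_(i <- s | P i) peval (F i) x.
Proof. by rewrite /peval rmorph_prod. Qed.

Definition pevalE := (pevalD, pevalB, pevalN, pevalM, peval0, peval1, pevalC,
  pevalZ, pevalXn, peval_var, peval_sum, peval_prod).

Lemma continuous_bigsum (T : topologicalType) (I : Type) (s : seq I)
    (F : I -> T -> R) :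
  (forall i, continuous (F i)) -> continuous (fun t => \sum_(i <- s) F i t).
Proof.
move=> cF t; elim: s => [|i s IH].
  by under [X in continuous_at t X]eq_fun do rewrite big_nil; apply: cvg_cst.
under [X in continuous_at t X]eq_fun do rewrite big_cons.
by apply: cvgD IH; apply: cF.
Qed.

Lemma continuous_bigprod (T : topologicalType) (I : Type) (s : seq I)
    (F : I -> T -> R) :
  (forall i, continuous (F i)) -> continuous (fun t => \prod_(i <- s) F i t).
Proof.
move=> cF t; elim: s => [|i s IH].
  by under [X in continuous_at t X]eq_fun do rewrite big_nil; apply: cvg_cst.
under [X in continuous_at t X]eq_fun do rewrite big_cons.
by apply: cvgM IH; apply: cF.
Qed.

Lemma peval_continuous p : continuous (peval p).
Proof.
have -> : peval p = fun x => \sum_(m <- mpoly.msupp p)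
    mpoly.mcoeff m p * \prod_(i <- index_enum 'I_n) x 0 i ^+ m i.
  by apply/funext => x; rewrite /peval mpoly.mevalE.
apply: (@continuous_bigsum _ _ _ (fun m (x : 'rV[R]_n) =>
  mpoly.mcoeff m p * \prod_(i <- index_enum 'I_n) x 0 i ^+ m i)) => m x.
have cprod : continuous (fun x : 'rV[R]_n =>
    \prod_(i <- index_enum 'I_n) x 0 i ^+ m i).
  apply: (@continuous_bigprod _ _ _ (fun i (x : 'rV[R]_n) => x 0 i ^+ m i)) => i y.
  apply: (@continuous_comp _ _ _ (fun x : 'rV[R]_n => x 0 i) (fun t => t ^+ m i)).
    exact: coord_continuous.
  exact: exprn_continuous.
exact: (cvgM (@cvg_cst _ _ _ _ _) (cprod x)).
Qed.

Definition pnorm2 : realpoly R n := \sum_i pvar i ^+ 2.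

Lemma peval_norm2 x : peval pnorm2 x = \sum_i x 0 i ^+ 2.
Proof. by rewrite !pevalE; apply: eq_bigr => i _; rewrite !pevalE. Qed.

End PolynomialEvaluation.

Section Finiteness.
Variables (R : realType) (N : nat).
Local Notation poly := (realpoly R N).
Local Notation vec := 'rV[R]_N.

Definition sbasic (b : poly * seq poly) : set vec :=
  [set x | peval b.1 x = 0 /\ forall g, g \in b.2 -> 0 < peval g x].

Definition snormal (s : seq (poly * seq poly)) : set vec :=
  [set x | exists2 b, b \in s & sbasic b x].

Lemma snormalI s t : exists u, snormal u = snormal s `&` snormal t.
Proof.
exists [seq (b.1 ^+ 2 + c.1 ^+ 2, b.2 ++ c.2) | b <- s, c <- t].
apply/seteqP; split=> [x [_ /allpairsP[[b c] [bs ct ->]] [/= + gP]]|x].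
  rewrite !pevalE => /eqP; rewrite paddr_eq0 ?sqr_ge0// !sqrf_eq0.
  move=> /andP[/eqP b0 /eqP c0]; split.
    by exists b => //; split=> // g gb; apply: gP; rewrite mem_cat gb.
  by exists c => //; split=> // g gc; apply: gP; rewrite mem_cat gc orbT.
move=> [[b bs [b0 bP]] [c ct [c0 cP]]].
exists (b.1 ^+ 2 + c.1 ^+ 2, b.2 ++ c.2).
  by apply/allpairsP; exists (b, c).
split=> /= [|g]; first by rewrite !pevalE b0 c0 expr0n addr0.
by rewrite mem_cat => /orP[/bP|/cP].
Qed.

Lemma snormalC s : exists u, snormal u = ~` snormal s.
Proof.
elim: s => [|b s [u uE]].
  exists [:: (0, [::])]; apply/seteqP; split=> x //=.
    by move=> _ [b]; rewrite in_nil.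
  by move=> _; exists (0, [::]); rewrite ?inE//; split=> //=; rewrite peval0.
pose w := [:: (0, [:: b.1]), (0, [:: - b.1]) &
  flatten [seq [:: (g, [::]); (0, [:: - g])] | g <- b.2]].
have wE : snormal w = ~` sbasic b.
  apply/seteqP; split=> x.
    move=> [c]; rewrite !inE => /or3P[/eqP ->|/eqP ->|].
    - move=> [_ /(_ b.1 (mem_head _ _)) /= h] [b0 _].
      by move: h; rewrite b0 ltxx.
    - move=> [_ /(_ _ (mem_head _ _)) /= h] [b0 _].
      by move: h; rewrite pevalN b0 oppr0 ltxx.
    - move=> /flattenP[_ /mapP[g gb ->]]; rewrite !inE => /orP[/eqP ->|/eqP ->].
        by move=> [/= g0 _] [_ /(_ g gb)]; rewrite g0 ltxx.
      move=> [_ /(_ _ (mem_head _ _)) /=]; rewrite pevalN oppr_gt0 => g0.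
      by move=> [_ /(_ g gb)] /(lt_trans g0); rewrite ltxx.
  move=> nb; have [b0|b0|b0] := ltgtP (peval b.1 x) 0.
  - exists (0, [:: - b.1]); first by rewrite !inE eqxx orbT.
    split=> /= [|g]; first by rewrite peval0.
    by rewrite inE => /eqP ->; rewrite pevalN oppr_gt0.
  - exists (0, [:: b.1]); first by rewrite !inE eqxx.
    by split=> /= [|g]; [rewrite peval0|rewrite inE => /eqP ->].
  - have [g [gb g0]] : exists g, g \in b.2 /\ peval g x <= 0.
      apply: contrapT => h; apply: nb; split=> // g gb.
      by rewrite ltNge; apply/negP => g0; apply: h; exists g.
    have gw c : c \in [:: (g, [::]); (0, [:: - g])] -> c \in w.
      move=> cg; rewrite /w !inE; apply/orP; right; apply/orP; right.
      apply/flattenP; exists [:: (g, [::]); (0, [:: - g])] => //.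
      by apply/mapP; exists g.
    move: g0; rewrite le_eqVlt => /orP[/eqP g0|g0].
      by exists (g, [::]); [apply: gw; rewrite !inE eqxx|split].
    exists (0, [:: - g]); first by apply: gw; rewrite !inE eqxx orbT.
    split=> /= [|h]; first by rewrite peval0.
    by rewrite inE => /eqP ->; rewrite pevalN oppr_gt0.
have [v vE] := snormalI w u; exists v; rewrite vE wE uE -setCU; congr (~` _).
apply/seteqP; split=> x.
  by move=> [bx|[c cs cx]]; [exists b|exists c]; rewrite // inE ?eqxx ?cs ?orbT.
by move=> [c]; rewrite inE => /predU1P[-> bx|cs cx]; [left|right; exists c].
Qed.

Lemma semialgebraic_normal (A : set vec) :
  semialgebraic A -> exists s, A = snormal s.
Proof.
elim=> [p|p|B _ [s ->]|B C _ [s ->] _ [t ->]].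
- exists [:: (p, [::])]; apply/seteqP; split=> x /=.
    by move=> px; exists (p, [::]); rewrite ?inE.
  by move=> [c]; rewrite inE => /eqP -> [].
- exists [:: (0, [:: p])]; apply/seteqP; split=> x /=.
    move=> px; exists (0, [:: p]); rewrite ?inE//; split=> /= [|g].
      by rewrite peval0.
    by rewrite inE => /eqP ->.
  by move=> [c]; rewrite inE => /eqP -> [_]; apply; rewrite inE.
- by have [u <-] := snormalC s; exists u.
- exists (s ++ t); apply/seteqP; split=> x.
    by move=> [] [c cs cx]; exists c => //; rewrite mem_cat cs ?orbT.
  by move=> [c]; rewrite mem_cat => /orP[cs|ct] cx; [left|right]; exists c.
Qed.

Lemma sqr_bound (s t : R) : 0 < s -> s * t ^+ 2 <= 1 -> `|t| <= 1 + s^-1.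
Proof.
move=> s0 h; have si : 0 < s^-1 by rewrite invr_gt0.
have [t1|t1] := leP `|t| 1; first by lra.
have : `|t| <= `|t| ^+ 2 by rewrite expr2 ler_peMl// ltW.
rewrite real_normK ?num_real// => h2.
have : t ^+ 2 <= s^-1 by rewrite -[s^-1]mul1r ler_pdivlMr// mulrC.
by lra.
Qed.

(** A rational substitute for the minimum of finitely many positive numbers: each factor
    [t / (1 + t ^+ 2)] is at most 1 and at most [t]. *)
Lemma prod_ratio_le (T : eqType) (s : seq T) (F : T -> R) :
  (forall t, t \in s -> 0 < F t) ->
  let r := (\prod_(t <- s) F t) / \prod_(t <- s) (1 + F t ^+ 2) in
  0 < r <= 1 /\ forall t, t \in s -> r <= F t.
Proof.
elim: s => [|t s IH] Fpos; first by rewrite /= !big_nil divr1 ltr01 lexx.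
have [|/= /andP[r0 r1] rF] := IH; first by move=> u us; apply: Fpos; rewrite inE us orbT.
have Ft : 0 < F t by apply: Fpos; rewrite mem_head.
have D0 : 0 < 1 + F t ^+ 2 by rewrite ltr_wpDr// sqr_ge0.
have q1 : F t / (1 + F t ^+ 2) <= 1 by rewrite ler_pdivrMr//; nra.
have qF : F t / (1 + F t ^+ 2) <= F t by rewrite ler_pdivrMr//; nra.
have q0 : 0 < F t / (1 + F t ^+ 2) by rewrite divr_gt0.
rewrite /= !big_cons invfM mulrACA; split.
  by rewrite mulr_gt0//= mulr_ile1// ltW.
move=> u; rewrite inE => /predU1P[->|us].
  by apply: le_trans qF; rewrite ler_piMr// ltW.
by apply: le_trans (rF u us); rewrite ler_piMl// ltW.
Qed.

(* A Lojasiewicz inequality for f on X, read off from the germ at 0 of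
   s |-> min {f^2 | x in X, |x|^2 <= 1/s, g >= s for all g}. *)
Lemma sbasic_separation (X : set vec) (b : poly * seq poly) :
  closed X -> semialgebraic X -> sbasic b `&` X = set0 ->
  exists qs : seq poly,
    (forall x, sbasic b x -> forall q, q \in qs -> 0 < peval q x) /\
    (forall x, X x -> exists2 q, q \in qs & peval q x <= 0).
Proof.
case: b => f gs Xc Xsa bX.
pose K s : set vec := [set x | X x /\ (s * \sum_i x 0 i ^+ 2 <= 1 /\
  forall g, g \in gs -> s <= peval g x)].
pose T s a := forall x, K s x -> a <= peval f x ^+ 2.
have dT : dfn (fun v => T (v 0) (v 1)).
  have V := @dterm_var R.
  apply: (dfn_allb (k := 0)) => [v x|]; first by [].
  apply: dfn_imp; last first.
    by apply: dfn_le => //; apply: dterm_exp; apply: dterm_peval.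
  apply: dfn_and; first exact: semialgebraic_dfn.
  apply: dfn_and.
    apply: dfn_le; last exact: dterm_const.
    apply: dterm_mul => //; apply: dterm_sum => i; apply: dterm_exp.
    exact: dterm_blk.
  by apply: dfn_allseq => g _; apply: dfn_le => //; apply: dterm_peval.
have [k [s1 [s10 H]]] := dfn_germ2 dT.
have Tpos s : 0 < s -> exists2 a, 0 < a & T s a.
  move=> s0.
  have cK : compact (K s).
    apply: (@closed_cube_compact _ _ (1 + s^-1)) => [|x [_ [xs _]] i].
      have -> : K s = X `&` ((peval (s *: pnorm2 R N)) @^-1` [set t | t <= 1] `&`
          \bigcap_(g in [set` gs]) ((peval g) @^-1` [set t | s <= t])).
        apply/seteqP; split=> x [Xx [xs gx]]; split=> //; split=> //.
          by rewrite /= pevalZ peval_norm2.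
        by move: xs; rewrite /= pevalZ peval_norm2.
      apply: closedI => //; apply: closedI.
        apply: closed_comp; last exact: closed_le.
        by move=> x _; apply: peval_continuous.
      apply: closed_bigI => g _; apply: closed_comp; last exact: closed_ge.
      by move=> x _; apply: peval_continuous.
    apply: sqr_bound => //; apply: le_trans xs; rewrite ler_pM2l//.
    by rewrite (bigD1 i)//= lerDl sumr_ge0// => j _; apply: sqr_ge0.
  have [K0|/eqP K0] := pselect (K s = set0).
    by exists 1 => // x; rewrite K0.
  have /set0P Kn := K0.
  have [c /[!inE] Kc cmin] := compact_EVT_min Kn cK
    (continuous_subspaceT (@peval_continuous _ _ (f ^+ 2))).
  exists (peval f c ^+ 2); last first.
    by move=> x Kx; rewrite -!pevalXn; apply: cmin; rewrite inE.
  rewrite lt_neqAle sqr_ge0 andbT eq_sym sqrf_eq0; apply/eqP => fc.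
  have : (sbasic (f, gs) `&` X) c.
    case: Kc => Xc' [_ gc]; split=> //; split=> // g gg.
    by apply: lt_le_trans s0 _; apply: gc.
  by rewrite bX.
(* The negative germ is impossible: by [Tpos] each [s] admits some [a > 0] with [T s a], and [T s]
   is inherited by smaller [a]. *)
have {}H s : 0 < s < s1 -> T s (s ^+ k / 2).
  move=> /andP[s0 ss1]; have sk := exprn_gt0 k s0.
  case: H => H; first by apply: H; rewrite ?s0//; lra.
  exfalso; have [a a0 Ta] := Tpos s s0.
  pose a' := Num.min a (s ^+ k) / 2.
  have m0 : 0 < Num.min a (s ^+ k) by rewrite lt_min a0.
  have a'0 : 0 < a' by rewrite divr_gt0.
  have : a' < Num.min a (s ^+ k) by rewrite /a'; lra.
  rewrite lt_min => /andP[a'a a'k]; apply: (H s a'); rewrite ?s0 ?a'0//.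
  by move=> x Kx; apply: le_trans (Ta x Kx); apply: ltW.
pose sg := Num.min s1 1 / 2.
have sg0 : 0 < sg by rewrite divr_gt0// lt_min s10 /=.
have [sg1 sgs1] : sg < 1 /\ sg < s1.
  have m0 : 0 < Num.min s1 1 by rewrite lt_min s10 /=.
  have : sg < Num.min s1 1 by rewrite /sg; lra.
  by rewrite lt_min => /andP[].
pose G : poly := \prod_(g <- gs) g.
pose M : poly := (\prod_(g <- gs) (1 + g ^+ 2)) * (1 + pnorm2 R N).
(* At [s = sg * G / M] a point of [X] with all [g > 0] lies in [K s], because [G / M] is below every
   [g] and its product with [|x|^2] is at most 1. The bound [s ^+ k / 2 <= f ^+ 2], multiplied by
   [2 * M ^+ k], then reads [q <= 0]. *)
pose q : poly := (sg ^+ k) *: G ^+ k - 2 *: (f ^+ 2 * M ^+ k).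
have N0 x : 0 <= peval (pnorm2 R N) x.
  by rewrite peval_norm2 sumr_ge0// => i _; apply: sqr_ge0.
have M0 x : 0 < peval M x.
  rewrite /M pevalM; apply: mulr_gt0; last by rewrite pevalD peval1 ltr_wpDr.
  by rewrite peval_prod prodr_gt0// => g _; rewrite !pevalE ltr_wpDr ?sqr_ge0.
have GE x : peval G x = \prod_(g <- gs) peval g x by rewrite !pevalE.
have ME x : peval M x =
    (\prod_(g <- gs) (1 + peval g x ^+ 2)) * (1 + peval (pnorm2 R N) x).
  by rewrite !pevalE; congr (_ * _); apply: eq_bigr => g _; rewrite !pevalE.
have qE x : peval q x =
    sg ^+ k * peval G x ^+ k - 2 * (peval f x ^+ 2 * peval M x ^+ k).
  by rewrite /q pevalB !pevalZ pevalM !pevalXn.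
have G0 x : (forall g, g \in gs -> 0 < peval g x) -> 0 < peval G x.
  by move=> gx; rewrite GE big_seq prodr_gt0.
exists (q :: gs); split=> [x [fx gx] p|x Xx].
  rewrite inE => /predU1P[->|/gx//]; rewrite qE fx expr0n /= mul0r mulr0 subr0.
  by rewrite mulr_gt0 ?exprn_gt0// G0.
have [gpos|] := pselect (forall g, g \in gs -> 0 < peval g x); last first.
  move=> /existsNP[g /not_implyP[gg /negP]]; rewrite -leNgt => g0.
  by exists g => //; rewrite inE gg orbT.
exists q; first by rewrite mem_head.
pose s := sg * (peval G x / peval M x).
have s0 : 0 < s by rewrite mulr_gt0// divr_gt0// G0.
have [/= + rg] := prod_ratio_le gpos; rewrite -GE.
set r := _ / _ => /andP[r0 r1].
set n2 := peval (pnorm2 R N) x.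
have n20 : 0 <= n2 by apply: N0.
have sE : s * (1 + n2) = sg * r.
  rewrite /s ME /r -/n2 invfM.
  have n2n : 1 + n2 != 0 by rewrite gt_eqF// ltr_wpDr.
  by rewrite -!mulrA mulVf// mulr1.
have sr : s <= sg * r.
  by rewrite -sE mulrDr mulr1 lerDl; apply: mulr_ge0 => //; apply: ltW.
have ssg : s <= sg by apply: le_trans sr _; apply: ler_piMr => //; apply: ltW.
have Ksx : K s x.
  split=> //; split=> [|g gg].
    rewrite -peval_norm2 -/n2; have : s * n2 <= s * (1 + n2) by rewrite ler_pM2l// lerDr.
    rewrite sE => /le_trans; apply; have : sg * r <= 1 * 1 by apply: ler_pM => //; apply: ltW.
    by rewrite mulr1.
  apply: le_trans sr _; apply: le_trans (rg g gg).
  by rewrite -GE -/r; apply: ler_piMl; apply: ltW.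
have := H s; rewrite s0 (le_lt_trans ssg sgs1) => /(_ isT x Ksx).
have sk : s ^+ k * peval M x ^+ k = sg ^+ k * peval G x ^+ k.
  by rewrite -!exprMn /s -mulrA divfK// gt_eqF.
move=> h; rewrite qE -sk subr_le0 mulrA ler_pM2r ?exprn_gt0//.
by rewrite -ler_pdivrMl// mulrC.
Qed.

Definition cnormal (s : seq (description R N)) : set vec :=
  [set x | exists2 b, b \in s & basic_set b x].

Lemma cnormalI s t : exists u, cnormal u = cnormal s `&` cnormal t.
Proof.
exists [seq (b.1 ++ c.1, b.2 ++ c.2) | b <- s, c <- t].
apply/seteqP; split=> [x [_ /allpairsP[[b c] [bs ct ->]] [/= g0 h0]]|x].
  split; [exists b|exists c] => //; split=> g gP;
    by [apply: g0; rewrite mem_cat gP ?orbT|apply: h0; rewrite mem_cat gP ?orbT].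
move=> [[b bs [b1 b2]] [c ct [c1 c2]]].
exists (b.1 ++ c.1, b.2 ++ c.2); first by apply/allpairsP; exists (b, c).
by split=> /= g; rewrite mem_cat => /orP[]; [exact: b1|exact: c1|exact: b2|exact: c2].
Qed.

(** Decompose the complement into pieces given by one equation and strict inequalities. Each piece
    is avoided by a finite union of sets [q <= 0] covering [X]; the intersection of these unions
    over all pieces is exactly [X]. *)
Theorem closed_semialgebraic_cnormal (X : set vec) :
  closed X -> semialgebraic X -> exists s, X = cnormal s.
Proof.
move=> Xc Xsa; have [s sE] := semialgebraic_normal (semialgebraic_setC Xsa).
suff [u Xu uP] : exists2 u, X `<=` cnormal u &
    forall x, cnormal u x -> forall b, b \in s -> ~ sbasic b x.
  exists u; apply/seteqP; split=> // x /uP ux; apply: contrapT.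
  by move=> nXx; have : (~` X) x by []; rewrite sE => -[b /ux].
have disj b : b \in s -> sbasic b `&` X = set0.
  move=> bs; apply/seteqP; split=> x // [bx Xx].
  have : (~` X) x by rewrite sE; exists b.
  exact.
elim: s {sE} disj => [|b s IH] disj.
  by exists [:: ([::], [::])] => // x _; exists ([::], [::]); rewrite ?inE.
have [u Xu uP] : exists2 u, X `<=` cnormal u &
    forall x, cnormal u x -> forall b, b \in s -> ~ sbasic b x.
  by apply: IH => c cs; apply: disj; rewrite inE cs orbT.
have [qs [bq Xq]] := sbasic_separation Xc Xsa (disj b (mem_head _ _)).
pose w : seq (description R N) := [seq ([:: - q], [::]) | q <- qs].
have wE x : cnormal w x <-> exists2 q, q \in qs & peval q x <= 0.
  split=> [[_ /mapP[q qq ->]] [/(_ _ (mem_head _ _)) /= + _]|[q qq qx]].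
    by rewrite pevalN oppr_ge0; exists q.
  exists ([:: - q], [::]); first by apply/mapP; exists q.
  by split=> // g /=; rewrite inE => /eqP ->; rewrite pevalN oppr_ge0.
have [v vE] := cnormalI w u; exists v; rewrite vE => x.
  by move=> Xx; split; [apply/wE; apply: Xq|apply: Xu].
move=> [/wE[q qq qx] ux] c; rewrite inE => /predU1P[->|]; last exact: uP.
by move=> /bq/(_ q qq)/lt_le_trans/(_ qx); rewrite ltxx.
Qed.

Lemma le_bigmaxn (T : eqType) (s : seq T) (F : T -> nat) x :
  x \in s -> (F x <= \max_(i <- s) F i)%N.
Proof. by move=> xs; apply: leq_bigmax_seq. Qed.

Lemma nat_minP (A : set nat) : A !=set0 ->
  A (nat_min A) /\ forall k, A k -> (nat_min A <= k)%N.
Proof.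
move=> [k Ak].
have ex : exists n, `[<A n>] by exists k; apply/asboolP.
rewrite /nat_min; case: xgetP => [n _ [An nmin]|/(_ (ex_minn ex))[]] //.
by case: ex_minnP => n /asboolP An nmin; split=> // j Aj; apply/nmin/asboolP.
Qed.

Lemma exists_min_ineqs (b : description R N) :
  exists b', basic_set b' = basic_set b /\ min_ineqs b'.
Proof.
pose A := [set n | exists2 c, basic_set c = basic_set b & num_ineqs c = n].
have [|[c cb cn] cmin] := @nat_minP A; first by exists (num_ineqs b), b.
exists c; split=> // b' b'c; rewrite cn; apply: cmin; exists b' => //.
by rewrite b'c.
Qed.

Lemma exists_decomposition (X : set vec) :
  closed X -> semialgebraic X -> exists s, decomposition X s.
Proof.
move=> Xc Xsa; have [s Xs] := closed_semialgebraic_cnormal Xc Xsa.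
have /choice[f fP] := exists_min_ineqs.
exists [seq f b | b <- s]; split; last by move=> _ /mapP[b _ ->]; case: (fP b).
rewrite Xs big_map -bigcup_seq; apply/seteqP; split=> [x [b bs bx]|x [b /= bs]].
  by exists b => //=; rewrite (fP b).1.
by rewrite (fP b).1; exists b.
Qed.

(** A decomposition attaining [rnum] shows that the set minimized in [kappa] is nonempty, so no
    default value intervenes; one attaining [kappa] within that set meets both bounds. *)
Lemma optimal_decomposition (X : set vec) : closed X -> semialgebraic X ->
  exists s : seq (description R N),
    [/\ forall x, X x <-> exists2 b, b \in s & basic_set b x,
        forall b, b \in s -> (num_ineqs b <= rnum X)%N &
        forall b, b \in s -> forall p, p \in b.1 ++ b.2 -> (pdeg p <= kappa X)%N].
Proof.
move=> Xc Xsa; have [t tX] := exists_decomposition Xc Xsa.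
have [|[u uX uE] _] := @nat_minP [set max_num_ineqs s | s in decomposition X].
  by exists (max_num_ineqs t), t.
have [|[s [sX sr] sE] _] := @nat_minP [set max_degree s | s in
    [set s | decomposition X s /\ forall b, b \in s -> (num_ineqs b <= rnum X)%N]].
  exists (max_degree u), u => //; split=> // b bu.
  have h := le_bigmaxn (fun b : description R N => num_ineqs b) bu.
  by rewrite /rnum -uE; exact: h.
exists s; split=> // [x|b bs p pb].
  by rewrite sX.1 -bigcup_seq; split=> [[b /= bs bx]|[b bs bx]]; exists b.
rewrite /kappa -sE; rewrite /max_degree.
have h1 := le_bigmaxn (fun b : description R N =>
  \max_(p <- b.1 ++ b.2) pdeg p)%N bs.
have h2 := le_bigmaxn (fun p : realpoly R N => pdeg p) pb.
exact: leq_trans h2 h1.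
Qed.

End Finiteness.

(** * Polynomials on a cube *)

Section PolynomialEstimates.
Variables (R : realType) (n : nat).
Implicit Types (p q : realpoly R n) (x y : 'rV[R]_n).

Lemma mpoly_alg_ind (P : realpoly R n -> Prop) :
  (forall c, P (mpoly.mpolyC n c)) -> (forall i, P (pvar R i)) ->
  (forall p q, P p -> P q -> P (p + q)) ->
  (forall p q, P p -> P q -> P (p * q)) -> forall p, P p.
Proof.
move=> PC PX PD PM p; rewrite [p]mpoly.mpolyE.
have PX' m : P (mpoly.mpolyX R m).
  rewrite mpoly.mpolyXE_id; elim: (index_enum _) => [|i s IH].
    by rewrite big_nil -mpoly.mpolyC1; apply: PC.
  rewrite big_cons; apply: (PM) => //; elim: (m i) => [|k IHk].
    by rewrite expr0 -mpoly.mpolyC1; apply: PC.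
  by rewrite exprS; apply: (PM) => //; apply: PX.
elim: (mpoly.msupp p) => [|m s IH].
  by rewrite big_nil -[0](mpoly.mpolyC0 n R); apply: PC.
by rewrite big_cons; apply: (PD) => //; rewrite -mpoly.mul_mpolyC; apply: (PM).
Qed.

Definition cube (B : R) : set 'rV[R]_n := [set x | forall i, `|x 0 i| <= B].

Lemma peval_bounded (B : R) p :
  exists2 M : R, 0 <= M & forall x, cube B x -> `|peval p x| <= M.
Proof.
elim/mpoly_alg_ind: p => [c|i|p q [M M0 pM] [N N0 qN]|p q [M M0 pM] [N N0 qN]].
- by exists `|c| => // x _; rewrite pevalC.
- by exists `|B| => // x /(_ i) xB; rewrite peval_var (le_trans xB)// ler_norm.
- exists (M + N) => [|x xB]; first exact: addr_ge0.
  by rewrite pevalD (le_trans (ler_normD _ _))// lerD ?pM ?qN.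
- exists (M * N) => [|x xB]; first exact: mulr_ge0.
  by rewrite pevalM normrM ler_pM ?pM ?qN.
Qed.

Lemma dist1_coord x y i : `|y 0 i - x 0 i| <= dist1 x y.
Proof. by rewrite /dist1 (bigD1 i)//= lerDl sumr_ge0. Qed.

Lemma peval_lipschitz (B : R) p :
  exists2 G : R, 0 <= G & forall x y, cube B x -> cube B y ->
    `|peval p y - peval p x| <= G * dist1 x y.
Proof.
elim/mpoly_alg_ind: p => [c|i|p q [M M0 pM] [N N0 qN]|p q [M M0 pM] [N N0 qN]].
- by exists 0 => // x y _ _; rewrite !pevalC subrr normr0 mul0r.
- by exists 1 => // x y _ _; rewrite !peval_var mul1r dist1_coord.
- exists (M + N) => [|x y xB yB]; first exact: addr_ge0.
  rewrite !pevalD mulrDl opprD addrACA (le_trans (ler_normD _ _))//.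
  by rewrite lerD ?pM ?qN.
- have [a a0 pa] := peval_bounded B p; have [b b0 qb] := peval_bounded B q.
  exists (M * b + a * N) => [|x y xB yB]; first by rewrite addr_ge0// mulr_ge0.
  have -> : peval (p * q) y - peval (p * q) x =
    (peval p y - peval p x) * peval q y + peval p x * (peval q y - peval q x).
    by rewrite !pevalM; ring.
  rewrite (le_trans (ler_normD _ _))// !normrM mulrDl lerD//.
    by rewrite mulrAC ler_pM ?pM ?qb.
  by rewrite -mulrA ler_pM ?pa ?qN.
Qed.

(** The differential of [p] at [x] applied to [y - x]. *)
Definition pdiff p x y : R :=
  \sum_i peval (mpoly.mderiv i p) x * (y 0 i - x 0 i).

Lemma pdiffD p q x y : pdiff (p + q) x y = pdiff p x y + pdiff q x y.
Proof.
by rewrite /pdiff -big_split; apply: eq_bigr => i _; rewrite mpoly.mderivD pevalD mulrDl.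
Qed.

Lemma pdiffM p q x y :
  pdiff (p * q) x y = pdiff p x y * peval q x + peval p x * pdiff q x y.
Proof.
rewrite /pdiff mulr_suml mulr_sumr -big_split; apply: eq_bigr => i _ /=.
by rewrite mpoly.mderivM pevalD !pevalM; ring.
Qed.

Lemma pdiff_bound p x y (M : R) :
  (forall i, `|peval (mpoly.mderiv i p) x| <= M) -> `|pdiff p x y| <= M * dist1 x y.
Proof.
move=> pM; rewrite /pdiff /dist1 mulr_sumr (le_trans (ler_norm_sum _ _ _))//.
by apply: ler_sum => i _; rewrite normrM ler_wpM2r.
Qed.

Lemma pdiff_bounded (B : R) p :
  exists2 M : R, 0 <= M & forall x y, cube B x -> `|pdiff p x y| <= M * dist1 x y.
Proof.
have /choice[M MP] : forall i, exists M : R, 0 <= M /\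
    forall x, cube B x -> `|peval (mpoly.mderiv i p) x| <= M.
  by move=> i; have [M M0 pM] := peval_bounded B (mpoly.mderiv i p); exists M.
exists (\sum_i M i) => [|x y xB].
  by apply: sumr_ge0 => i _; case: (MP i).
apply: pdiff_bound => i; apply: le_trans ((MP i).2 _ xB) _.
by rewrite (bigD1 i)//= lerDl sumr_ge0// => j _; case: (MP j).
Qed.

Lemma peval_taylor1 (B : R) p :
  exists2 C : R, 0 <= C & forall x y, cube B x -> cube B y ->
    `|peval p y - peval p x - pdiff p x y| <= C * dist1 x y ^+ 2.
Proof.
elim/mpoly_alg_ind: p => [c|i|p q [M M0 pM] [N N0 qN]|p q [M M0 pM] [N N0 qN]].
- exists 0 => // x y _ _; rewrite !pevalC subrr /pdiff big1 ?subrr ?normr0 ?mul0r//.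
  by move=> i _; rewrite mpoly.mderivC peval0 mul0r.
- exists 0 => // x y _ _; rewrite !peval_var /pdiff (bigD1 i)//= big1 => [|j ji].
    rewrite /pvar mpoly.mderivX mpoly.mnm1E eqxx scale1r.
    have -> : mpoly.mnm_sub (mpoly.mnm1 i) (mpoly.mnm1 i) = @mpoly.mnm0 n.
      by apply/mpoly.mnmP => k; rewrite mpoly.mnmBE mpoly.mnm0E subnn.
    by rewrite mpoly.mpolyX0 peval1 mul1r addr0 subrr normr0 mul0r.
  by rewrite /pvar mpoly.mderivX mpoly.mnm1E eq_sym (negbTE ji) scale0r peval0 mul0r.
- exists (M + N) => [|x y xB yB]; first exact: addr_ge0.
  have := pM x y xB yB; have := qN x y xB yB; rewrite !pevalD pdiffD !ler_norml.
  by rewrite mulrDl => /andP[? ?] /andP[? ?]; apply/andP; split; lra.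
- have [a a0 pa] := peval_bounded B p; have [b b0 qb] := peval_bounded B q.
  have [g g0 qg] := peval_lipschitz B q; have [s s0 ps] := pdiff_bounded B p.
  exists (a * N + s * g + M * b) => [|x y xB yB].
    by rewrite !addr_ge0// mulr_ge0.
  have -> : peval (p * q) y - peval (p * q) x - pdiff (p * q) x y =
      peval p x * (peval q y - peval q x - pdiff q x y) +
      pdiff p x y * (peval q y - peval q x) +
      (peval p y - peval p x - pdiff p x y) * peval q y.
    by rewrite !pevalM pdiffM; ring.
  rewrite (le_trans (ler_normD _ _))// [leRHS]mulrDl lerD//; last first.
    by rewrite normrM mulrAC ler_pM ?pM ?qb.
  rewrite (le_trans (ler_normD _ _))// [leRHS]mulrDl lerD// normrM.
    by rewrite -mulrA ler_pM ?pa ?qN.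
  by rewrite expr2 mulrACA ler_pM ?ps ?qg.
Qed.

Lemma mderiv_eq0_of_min p x j (r : R) : 0 < r ->
  (forall s : R, `|s| <= r -> peval p x <= peval p (x + s *: 'e_j)) ->
  peval (mpoly.mderiv j p) x = 0.
Proof.
move=> r0 xmin.
pose B := \sum_i `|x 0 i| + r.
have coordB i : `|x 0 i| <= \sum_i `|x 0 i| by rewrite (bigD1 i)//= lerDl sumr_ge0.
have lineB (s : R) : `|s| <= r -> cube B (x + s *: 'e_j).
  move=> sr i; rewrite !mxE eqxx /= (le_trans (ler_normD _ _))// lerD ?coordB//.
  by case: (i == j); [rewrite mulr1|rewrite mulr0 normr0 ltW].
have xB : cube B x by have := lineB 0; rewrite normr0 scale0r addr0; apply; exact: ltW.
have [C C0 taylor] := peval_taylor1 B p.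
have dl s : pdiff p x (x + s *: 'e_j) = peval (mpoly.mderiv j p) x * s.
  rewrite /pdiff (bigD1 j)//= big1 ?addr0 => [|i ij].
    by rewrite !mxE !eqxx /= mulr1 addrAC subrr add0r.
  by rewrite !mxE eqxx /= (negbTE ij) mulr0 addr0 subrr mulr0.
have ds s : dist1 x (x + s *: 'e_j) = `|s|.
  rewrite /dist1 (bigD1 j)//= big1 ?addr0 => [|i ij].
    by rewrite !mxE !eqxx /= mulr1 addrAC subrr add0r.
  by rewrite !mxE eqxx /= (negbTE ij) mulr0 addr0 subrr normr0.
set g := peval _ x in dl *.
have key s : `|s| <= r -> 0 <= g * s + C * `|s| ^+ 2.
  move=> sr; have := taylor x _ xB (lineB s sr); rewrite dl ds ler_norml => /andP[_].
  by have := xmin s sr; lra.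
apply/eqP; rewrite -normr_le0 leNgt; apply/negP => g0.
(* Moving by [s] against the sign of [g] changes [p] by at most [- |g| s + C s^2], which is negative
   for this [s]. *)
pose s := Num.min r (`|g| / (2 * (C + 1))).
have C1 : 0 < 2 * (C + 1) by lra.
have s0 : 0 < s by rewrite lt_min r0 divr_gt0.
have sr : s <= r by rewrite ge_min lexx.
have sg : s * (2 * (C + 1)) <= `|g| by rewrite -ler_pdivlMr// ge_min lexx orbT.
have := key (- Num.sg g * s); rewrite normrM normrN normr_sg.
rewrite -normr_eq0 gt_eqF//= mul1r (gtr0_norm s0) => /(_ sr).
rewrite mulNr mulrN mulrA [g * _]mulrC -normrEsg.
nra.
Qed.

End PolynomialEstimates.

(** * Critical values do not accumulate at 0 from above *)

Section CriticalValues.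
Variables (R : realType) (n : nat) (p : realpoly R n).

Definition pgrad2 : realpoly R n := \sum_i (mpoly.mderiv i p) ^+ 2.

Lemma pgrad2E x : peval pgrad2 x = \sum_i peval (mpoly.mderiv i p) x ^+ 2.
Proof. by rewrite !pevalE; apply: eq_bigr => i _; rewrite pevalXn. Qed.

Lemma pgrad2_ge0 x : 0 <= peval pgrad2 x.
Proof. by rewrite pgrad2E sumr_ge0// => i _; apply: sqr_ge0. Qed.

Lemma mderiv_le_grad x i :
  `|peval (mpoly.mderiv i p) x| <= Num.sqrt (peval pgrad2 x).
Proof.
rewrite -sqrtr_sqr ler_wsqrtr// pgrad2E (bigD1 i)//= lerDl sumr_ge0// => j _.
exact: sqr_ge0.
Qed.

Lemma dfn_cube k (B : R) : dfn (fun v => cube B (blk n k v)).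
Proof.
apply: (@dfn_ext _ (fun v => forall i, - B <= blk n k v 0 i /\ blk n k v 0 i <= B)).
  by move=> v; split=> H i; have := H i; rewrite ler_norml => /andP.
by apply: dfn_allord => i; apply: dfn_and; apply: dfn_le;
  do ?exact: dterm_const; exact: dterm_blk.
Qed.

Lemma closed_cube (B : R) : closed (cube B : set 'rV[R]_n).
Proof.
have -> : cube B = \bigcap_(i in [set: 'I_n])
    ((fun x : 'rV[R]_n => `|x 0 i|) @^-1` [set t | t <= B]).
  by apply/seteqP; split=> x H i; [move=> _; exact: (H i)|exact: (H i I)].
apply: closed_bigI => i _; apply: closed_comp; last exact: closed_le.
move=> x _; apply: (@continuous_comp _ _ _ (fun x : 'rV[R]_n => x 0 i) (@Num.norm _ _)).
  exact: coord_continuous.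
exact: norm_continuous.
Qed.

Lemma closed_peval_eq (q : realpoly R n) (c : R) : closed [set x | peval q x = c].
Proof.
apply: (@closed_comp _ _ (peval q) [set t | t = c]); last exact: closed_eq.
by move=> x _; apply: peval_continuous.
Qed.

Lemma closed_peval_le (q : realpoly R n) (c : R) : closed [set x | peval q x <= c].
Proof.
apply: (@closed_comp _ _ (peval q) [set t | t <= c]); last exact: closed_le.
by move=> x _; apply: peval_continuous.
Qed.

(** Otherwise every small level [s] carries a critical point, and a regular curve with [p (x s) = s]
    can be selected among them. With a vanishing gradient along the curve, [curve_increment] forbids
    [p] to increase. *)
Lemma critical_value_isolated (B : R) : exists2 tau : R, 0 < tau &
  forall x, cube B x -> 0 < peval p x <= tau -> 0 < peval pgrad2 x.
Proof.
pose A s (x : 'rV[R]_n) := cube B x /\ (peval p x = s /\ peval pgrad2 x = 0).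
have dA : dfn (fun v => A (v 0) (blk n 0 v)).
  apply: dfn_and; first exact: dfn_cube.
  by apply: dfn_and; apply: dfn_eq; do ?exact: dterm_peval;
    [exact: dterm_var|exact: dterm_const].
have dE : dfn (fun v => exists x, A (v 0) x).
  apply: (dfn_exb (k := 0)) => [v x|]; first by [].
  exact: dA.
have [s1 [s10 H]] := dfn_germ (A := fun s => exists x, A s x) dE.
case: H => H; last first.
  exists (s1 / 2) => [|x xB /andP[px0 ps1]]; first by rewrite divr_gt0.
  rewrite lt_neqAle pgrad2_ge0 andbT eq_sym; apply/eqP => g0.
  by apply: (H (peval p x)); [rewrite px0/=; lra|exists x].
exfalso.
have okA : fibers_ok B s1 A.
  split=> // [l hl|l hl x []//].
  have -> : [set x | A l x] = cube B `&`
      ([set x | peval p x = l] `&` [set x | peval pgrad2 x = 0]) by [].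
  by apply: closedI; [exact: closed_cube|apply: closedI; exact: closed_peval_eq].
have [l1 [x [/andP[l10 l1s1] rx xA]]] := curve_selection s10 okA.
have [C C0 taylor] := peval_taylor1 B p.
have h : l1 / 2 - l1 / 4 <= 0 * dist1 (x (l1 / 4)) (x (l1 / 2)).
  apply: (curve_increment (F := id) rx _ _ _ C0) => [|||u w au uw wb]; try lra.
  have hu : 0 < u < l1 by apply/andP; split; lra.
  have hw : 0 < w < l1 by apply/andP; split; lra.
  have [uB [pu gu]] := xA _ hu; have [wB [pw _]] := xA _ hw.
  have := taylor _ _ uB wB; have : `|pdiff p (x u) (x w)| <= 0 * dist1 (x u) (x w).
    by apply: pdiff_bound => i; have := mderiv_le_grad (x u) i; rewrite gu sqrtr0.
  rewrite mul0r normr_le0 => /eqP ->; rewrite pu pw subr0 => /ler_normlP[_].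
  by lra.
by move: h; rewrite mul0r; lra.
Qed.

End CriticalValues.

(** * Limits at 0 and rates of convergence of algebraic functions *)

Section Limits.
Variable R : realType.

(** The second clause, which holds because [f a] lies between the limit and [f b], later bounds
    lengths on the curve by the distance to its end point. *)
Lemma mono_limit (f : R -> R) (l1 B : R) : 0 < l1 -> mono_on f l1 ->
  (forall s, 0 < s < l1 -> `|f s| <= B) ->
  exists L : R,
    (forall e : R, 0 < e -> exists2 d : R, 0 < d <= l1 &
      forall s, 0 < s < d -> `|f s - L| < e) /\
    (forall a b, 0 < a -> a <= b -> b < l1 -> `|f b - f a| <= `|f b - L|).
Proof.
move=> l10.
have nondec (g : R -> R) : (forall s u, 0 < s -> s <= u -> u < l1 -> g s <= g u) ->
    (forall s, 0 < s < l1 -> `|g s| <= B) ->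
  exists L : R,
    (forall e : R, 0 < e -> exists2 d : R, 0 < d <= l1 &
      forall s, 0 < s < d -> `|g s - L| < e) /\
    (forall a b, 0 < a -> a <= b -> b < l1 -> `|g b - g a| <= `|g b - L|).
  move=> gm gB; pose S := [set g s | s in [set s | 0 < s < l1]].
  have Sinf : has_inf S.
    split; first by exists (g (l1 / 2)), (l1 / 2) => //=; apply/andP; split; lra.
    by exists (- B) => _ [s /= hs <-]; have := gB s hs; rewrite ler_norml => /andP[].
  exists (inf S); have infS s : 0 < s < l1 -> inf S <= g s.
    by move=> hs; apply: ge_inf; [case: Sinf|exists s].
  split=> [e e0|a b a0 ab bl].
    have [_ [s /= /[dup] hs /andP[s0 sl] <-] ge] := inf_adherent e0 Sinf.
    exists s => [|u /andP[u0 us]]; first by rewrite s0 ltW.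
    have hu : 0 < u < l1 by rewrite u0 (lt_trans us).
    rewrite ger0_norm ?subr_ge0 ?infS// ltrBlDl (le_lt_trans _ ge)//.
    by apply: gm => //; apply: ltW.
  have h1 := gm a b a0 ab bl.
  have h2 := infS a; have {}h2 : inf S <= g a by apply: h2; rewrite a0 (le_lt_trans ab).
  by rewrite !ger0_norm; lra.
case=> fm fB; first exact: nondec.
have [||L [L1 L2]] := nondec (fun s => - f s).
- by move=> s u s0 su ul; rewrite lerN2; apply: fm.
- by move=> s hs; rewrite normrN; apply: fB.
exists (- L); split=> [e e0|a b a0 ab bl].
  have [d d0 H] := L1 e e0; exists d => // s hs.
  by have := H s hs; rewrite -normrN opprD opprK.
have -> : f b - f a = - (- f b - - f a) by ring.
have -> : f b - - L = - (- f b - L) by ring.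
by rewrite !normrN; apply: L2.
Qed.

(** Bivariate polynomials are given by coefficient matrices of a fixed format, so that limits of
    relations can be taken entrywise. *)
Definition bip (K L : nat) (c : 'M[R]_(K.+1, L.+1)) (y t : R) : R :=
  \sum_k \sum_j c k j * y ^+ k * t ^+ j.

Lemma poly_bounded (q : {poly R}) (B : R) : 0 <= B ->
  exists2 M : R, 0 <= M & forall y : R, `|y| <= B -> `|q.[y]| <= M.
Proof.
move=> B0; elim/poly_ind: q => [|q c [M M0 qM]].
  by exists 0 => // y _; rewrite horner0 normr0.
exists (M * B + `|c|) => [|y yB]; first by rewrite addr_ge0// mulr_ge0.
rewrite !hornerE (le_trans (ler_normD _ _))// lerD2r normrM.
by apply: ler_pM => //; apply: qM.
Qed.

(* Dividing the relation by the largest power of t and letting t tend to 0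
   leaves a nonzero polynomial of degree at most K vanishing at f0. *)
Lemma algebraic_holder (K L : nat) (c : 'M[R]_(K.+1, L.+1)) (k0 : nat)
    (f g : R -> R) (f0 l1 : R) : 0 < l1 ->
  c != 0 -> (forall (k : 'I_K.+1) j, (k0 < k)%N -> c k j = 0) ->
  (forall e : R, 0 < e -> exists2 d : R, 0 < d & forall s, 0 < s < d -> `|f s - f0| < e) ->
  (forall e : R, 0 < e -> exists2 d : R, 0 < d & forall s, 0 < s < d -> g s < e) ->
  (forall s, 0 < s < l1 -> 0 < g s) ->
  (forall s, 0 < s < l1 -> bip c (f s) (g s) = 0) ->
  exists C d : R, [/\ 0 < C, 0 < d &
    forall s, 0 < s < d -> `|f s - f0| ^+ k0 <= C * g s].
Proof.
move=> l10 cn0 ck flim glim gpos rel.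
pose q (j : nat) : {poly R} := \poly_(k < K.+1) (if insub j is Some j' then c (inord k) j' else 0).
have qE (j : 'I_L.+1) y : (q j).[y] = \sum_k c k j * y ^+ k.
  rewrite /q valK horner_poly; apply: eq_bigr => k _; by rewrite inord_val.
have relE s : 0 < s < l1 -> \sum_(j < L.+1) (q j).[f s] * g s ^+ j = 0.
  move=> hs; rewrite -[RHS](rel s hs) /bip [RHS]exchange_big /=; apply: eq_bigr => j _.
  by rewrite qE mulr_suml.
have exq : exists j, (j < L.+1)%N && (q j != 0).
  apply: contrapT => nex; move/eqP: cn0; apply; apply/matrixP => k j; rewrite mxE.
  have : q j == 0 by apply: contrapT => /negP qj; apply: nex; exists (val j); rewrite ltn_ord.
  move=> /eqP /(congr1 (fun r : {poly R} => r`_k)).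
  by rewrite coef0 coef_poly ltn_ord valK inord_val.
pose j0 := ex_minn exq.
have [j0L qj0 j0min] : [/\ (j0 < L.+1)%N, q j0 != 0 & forall j, (j < j0)%N -> q j = 0].
  rewrite /j0; case: ex_minnP => j /andP[jL qj] jmin; split=> // i ij.
  apply/eqP; apply: contrapT => /negP qi.
  by have := jmin i; rewrite qi (ltn_trans ij jL) => /(_ isT); rewrite leqNgt ij.
pose B := `|f0| + 1.
have B0 : 0 <= B by rewrite /B addr_ge0.
have /choice[M MP] : forall j : nat, exists M : R, 0 <= M /\
    forall y, `|y| <= B -> `|(q j).[y]| <= M.
  by move=> j; have [M M0 qM] := poly_bounded (q j) B0; exists M.
pose T := \sum_(j < L.+1) M j.
have T0 : 0 <= T by apply: sumr_ge0 => j _; case: (MP j).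
have [d1 d10 fd1] := flim 1 ltr01.
have [d2 d20 gd2] := glim 1 ltr01.
pose d3 := Num.min l1 (Num.min d1 d2).
have d30 : 0 < d3 by rewrite !lt_min l10 d10 d20.
have small s : 0 < s < d3 -> `|(q j0).[f s]| <= T * g s.
  rewrite !lt_min => /andP[s0 /and3P[sl sd1 sd2]].
  have hs : 0 < s < l1 by rewrite s0.
  have g0 := gpos s hs; have g1 : g s < 1 by apply: gd2; rewrite s0.
  have fB : `|f s| <= B.
    have := fd1 s; rewrite s0 sd1 => /(_ isT) h.
    have -> : f s = f0 + (f s - f0) by rewrite addrC subrK.
    by rewrite (le_trans (ler_normD _ _))// lerD2l ltW.
  have E : (q j0).[f s] * g s ^+ j0 =
      - \sum_(j < L.+1 | (j0 < j)%N) (q j).[f s] * g s ^+ j.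
    apply/eqP; rewrite -addr_eq0; apply/eqP; rewrite -[RHS](relE s hs).
    rewrite [RHS](bigD1 (Ordinal j0L))//=; congr (_ + _).
    rewrite [RHS](bigID (fun j : 'I_L.+1 => (j0 < j)%N))/= [X in _ = _ + X]big1.
      rewrite addr0; apply: eq_bigl => j; rewrite -val_eqE /=.
      by case: ltngtP.
    move=> j /andP[jn]; rewrite -leqNgt leq_eqVlt => /orP[/eqP jj|jj].
      by move: jn; rewrite -val_eqE /= jj eqxx.
    by rewrite j0min// horner0 mul0r.
  have gj0 : 0 < g s ^+ j0 by rewrite exprn_gt0.
  rewrite -(ler_pM2r gj0) -{1}(gtr0_norm gj0) -normrM E normrN.
  rewrite (le_trans (ler_norm_sum _ _ _))// -mulrA -exprS /T mulr_suml.
  rewrite [leRHS](bigID (fun j : 'I_L.+1 => (j0 < j)%N))/=.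
  rewrite -[leLHS]addr0; apply: lerD; last first.
    by apply: sumr_ge0 => j _; rewrite mulr_ge0 ?exprn_ge0 ?(ltW g0)//; case: (MP j).
  apply: ler_sum => j jj; rewrite normrM; apply: ler_pM => //.
    by apply: (MP j).2.
  by rewrite (gtr0_norm (exprn_gt0 _ g0)) ler_wiXn2l// ltW.
have qf0 : (q j0).[f0] = 0.
  have [G G0 qG] : exists2 G : R, 0 <= G & forall y, `|y - f0| <= 1 ->
      `|(q j0).[y] - (q j0).[f0]| <= G * `|y - f0|.
    have /factor_theorem[r rE] : root ((q j0) - ((q j0).[f0])%:P) f0.
      by rewrite /root !hornerE subrr.
    have [G G0 rG] := poly_bounded r B0.
    exists G => // y yf; have -> : (q j0).[y] - (q j0).[f0] = r.[y] * (y - f0).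
      by have := congr1 (fun t : {poly R} => t.[y]) rE; rewrite !hornerE.
    rewrite normrM ler_wpM2r//; apply: rG.
    have -> : y = f0 + (y - f0) by rewrite addrC subrK.
    by rewrite (le_trans (ler_normD _ _))// lerD2l.
  apply/eqP; rewrite -normr_le0 leNgt; apply/negP => qpos.
  pose e := `|(q j0).[f0]| / (2 * (G + T + 1)).
  have GT : 0 < 2 * (G + T + 1) by lra.
  have e0 : 0 < e by rewrite divr_gt0.
  have [d4 d40 fd4] := flim e e0.
  have [d5 d50 gd5] := glim e e0.
  pose s := Num.min d3 (Num.min d4 d5) / 2.
  have m0 : 0 < Num.min d3 (Num.min d4 d5) by rewrite lt_min d30 lt_min d40 d50.
  have s0 : 0 < s by rewrite divr_gt0.
  have : s < Num.min d3 (Num.min d4 d5) by rewrite /s; lra.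
  rewrite lt_min => /andP[sd3]; rewrite lt_min => /andP[sd4 sd5].
  have h1 := small s; rewrite s0 sd3 in h1; have {}h1 := h1 isT.
  have h2 := fd4 s; rewrite s0 sd4 in h2; have {}h2 := h2 isT.
  have h3 := gd5 s; rewrite s0 sd5 in h3; have {}h3 := h3 isT.
  have h4 : `|f s - f0| <= 1.
    move: sd3; rewrite !lt_min => /and3P[_ sd1 _].
    by apply: ltW; apply: fd1; rewrite s0.
  have h5 := qG _ h4.
  have h6 : `|(q j0).[f0]| <= `|(q j0).[f s]| + `|(q j0).[f s] - (q j0).[f0]|.
    rewrite -{1}[(q j0).[f0]](subrK (q j0).[f s]) distrC addrC.
    by rewrite (le_trans (ler_normD _ _))// distrC.
  have h7 : `|(q j0).[f0]| = e * (2 * (G + T + 1)) by rewrite /e divfK// gt_eqF.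
  have h8 : T * g s <= T * e by rewrite ler_wpM2l// ltW.
  have h9 : G * `|f s - f0| <= G * e by rewrite ler_wpM2l// ltW.
  nra.
(* The cofactor [r] stays away from 0 near [f0], so [small] bounds the power [m] of the distance;
   [m <= k0] and distances below 1 give the power [k0]. *)
have [m [r + qr]] := multiplicity_XsubC (q j0) f0.
rewrite qj0 /= => rf0.
have szq : (size (q j0) <= k0.+1)%N.
  apply/leq_sizeP => i ki; rewrite coef_poly; case: ifP => // iK.
  case: insubP => // j _ _; apply: ck; by rewrite inordK.
have rn0 : r != 0 by apply: contraNneq rf0 => ->; rewrite root0.
have mk : (m <= k0)%N.
  move: szq; rewrite qr size_Mmonic ?monic_exp ?monicXsubC// size_exp_XsubC addnS /=.
  have : (0 < size r)%N by rewrite lt0n size_poly_eq0.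
  by case: (size r) => // a _; rewrite addSn ltnS; apply: leq_trans; apply: leq_addl.
have rpos : 0 < `|r.[f0]| by rewrite normr_gt0.
have [d6 [d60 fd6]] : exists d6 : R, 0 < d6 /\
    forall s, 0 < s < d6 -> `|r.[f0]| / 2 <= `|r.[f s]|.
  have /factor_theorem[u uE] : root (r - (r.[f0])%:P) f0.
    by rewrite /root !hornerE subrr.
  have [G G0 uG] := poly_bounded u B0.
  have e0 : 0 < `|r.[f0]| / (2 * (G + 1)) by rewrite divr_gt0//; lra.
  have [d4 d40 fd4] := flim _ e0.
  exists (Num.min d1 d4); split=> [|s]; first by rewrite lt_min d10.
  rewrite lt_min => /andP[s0 /andP[sd1 sd4]].
  have h2 := fd4 s; rewrite s0 sd4 in h2; have {}h2 := h2 isT.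
  have h4 := fd1 s; rewrite s0 sd1 in h4; have {}h4 := h4 isT.
  have h5 : r.[f s] - r.[f0] = u.[f s] * (f s - f0).
    by have := congr1 (fun t : {poly R} => t.[f s]) uE; rewrite !hornerE.
  have h6 : `|u.[f s]| <= G.
    apply: uG; have -> : f s = f0 + (f s - f0) by rewrite addrC subrK.
    by rewrite (le_trans (ler_normD _ _))// lerD2l ltW.
  have h7 : `|r.[f s] - r.[f0]| <= G * `|f s - f0| by rewrite h5 normrM ler_wpM2r.
  have h8 : `|r.[f0]| <= `|r.[f s]| + `|r.[f s] - r.[f0]|.
    by rewrite -{1}[r.[f0]](subKr r.[f s]) (le_trans (ler_normB _ _)).
  have h9 : `|f s - f0| * (2 * (G + 1)) < `|r.[f0]|.
    by rewrite -ltr_pdivlMr// mulr_gt0// ltr_wpDl.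
  nra.
exists (2 * (T + 1) / `|r.[f0]|), (Num.min d3 d6); split.
- by rewrite divr_gt0// mulr_gt0//; lra.
- by rewrite lt_min d30.
move=> s; rewrite lt_min => /andP[s0 /andP[sd3 sd6]].
have h1 := small s; rewrite s0 sd3 in h1; have {}h1 := h1 isT.
have h2 := fd6 s; rewrite s0 sd6 in h2; have {}h2 := h2 isT.
move: sd3; rewrite !lt_min => /and3P[sl sd1 sd2].
have h3 := fd1 s; rewrite s0 sd1 in h3; have {}h3 := h3 isT.
have g0 := gpos s; rewrite s0 sl in g0; have {}g0 := g0 isT.
apply: (@le_trans _ _ (`|f s - f0| ^+ m)).
  by rewrite ler_wiXn2l// ltW.
rewrite mulrAC ler_pdivlMr//; move: h1; rewrite qr !hornerE.
rewrite normrM normrX => h1.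
have h5 : 0 <= `|f s - f0| ^+ m by rewrite exprn_ge0.
nra.
Qed.

End Limits.

(** * Elimination by counting monomials *)

Lemma linear_relation (R : realType) (I J : finType) (M : I -> J -> R) :
  (#|J| < #|I|)%N ->
  exists c : I -> R, (exists i, c i != 0) /\ forall j, \sum_i c i * M i j = 0.
Proof.
move=> JI.
pose A : 'M[R]_(#|I|, #|J|) := \matrix_(a, b) M (enum_val a) (enum_val b).
have kn0 : kermx A != 0.
  by rewrite -mxrank_eq0 mxrank_ker subn_eq0 -ltnNge (leq_ltn_trans (rank_leq_col A)).
have [a [b kab]] : exists a b, kermx A a b != 0.
  apply: contrapT => nex; move/eqP: kn0; apply; apply/matrixP => a b; rewrite [RHS]mxE.
  by apply: contrapT => /eqP kab; apply: nex; exists a, b.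
exists (fun i => kermx A a (enum_rank i)); split.
  by exists (enum_val b); rewrite enum_valK.
move=> j; have := congr1 (fun B : 'M[R]_(#|I|, #|J|) => B a (enum_rank j)) (mulmx_ker A).
rewrite !mxE (reindex (@enum_rank I)) /=; last first.
  by apply: onW_bij; apply: enum_rank_bij.
by move=> h; rewrite -[RHS]h; apply: eq_bigr => i _; rewrite [A _ _]mxE !enum_rankK.
Qed.

Section Monomials.
Variables (R : realType) (n : nat).
Implicit Types (p q : realpoly R n) (x : 'rV[R]_n) (m : mpoly.multinom n).

Definition mono m x : R := \prod_(i < n) x 0 i ^+ m i.

Lemma monoD m1 m2 x : mono (mpoly.mnm_add m1 m2) x = mono m1 x * mono m2 x.
Proof.
by rewrite /mono -big_split; apply: eq_bigr => i _; rewrite mpoly.mnmDE exprD.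
Qed.

Lemma mono_mul1 i k x : mono (mpoly.mnm_muln (mpoly.mnm1 i) k) x = x 0 i ^+ k.
Proof.
rewrite /mono (bigD1 i)//= big1 ?mulr1 => [|j ji].
  by rewrite mpoly.mulmnE mpoly.mnm1E eqxx mul1n.
by rewrite mpoly.mulmnE mpoly.mnm1E eq_sym (negbTE ji) mul0n expr0.
Qed.

Lemma pevalE_mono p x :
  peval p x = \sum_(m <- mpoly.msupp p) mpoly.mcoeff m p * mono m x.
Proof. by rewrite /peval mpoly.mevalE. Qed.

Lemma peval_mono m x : peval (mpoly.mpolyX R m) x = mono m x.
Proof. by rewrite /peval mpoly.mevalX. Qed.

Lemma msizeM_leq p q a b : (mpoly.msize p <= a.+1)%N -> (mpoly.msize q <= b.+1)%N ->
  (mpoly.msize (p * q) <= (a + b).+1)%N.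
Proof.
move=> pa qb; have [->|p0] := eqVneq p 0; first by rewrite mul0r mpoly.msize0.
have [->|q0] := eqVneq q 0; first by rewrite mulr0 mpoly.msize0.
rewrite mpoly.msizeM//; apply: leq_trans (_ : ((a.+1 + b.+1).-1 <= _)%N); last by lia.
by rewrite -!subn1 leq_sub2r// leq_add.
Qed.

Lemma msizeXn_leq p k a : (mpoly.msize p <= a.+1)%N ->
  (mpoly.msize (p ^+ k) <= (a * k).+1)%N.
Proof.
move=> pa; elim: k => [|k IH]; first by rewrite expr0 muln0 mpoly.msize1.
by rewrite exprS mulnS; apply: msizeM_leq.
Qed.

Lemma msizeD_leq p q a : (mpoly.msize p <= a)%N -> (mpoly.msize q <= a)%N ->
  (mpoly.msize (p + q) <= a)%N.
Proof.
by move=> pa qa; rewrite (leq_trans (mpoly.msizeD_le p q))// geq_max pa.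
Qed.

Lemma msize_sum_leq (I : Type) (s : seq I) (F : I -> realpoly R n) a :
  (forall i, (mpoly.msize (F i) <= a)%N) -> (mpoly.msize (\sum_(i <- s) F i) <= a)%N.
Proof.
move=> Fa; elim: s => [|i s IH]; first by rewrite big_nil mpoly.msize0.
by rewrite big_cons; apply: msizeD_leq.
Qed.

Lemma msize_pvar i : mpoly.msize (pvar R i : realpoly R n) = 2.
Proof. by rewrite /pvar mpoly.msizeX mpoly.mdeg1. Qed.

Lemma msizeZ_leq c p a : (mpoly.msize p <= a)%N -> (mpoly.msize (c *: p) <= a)%N.
Proof. by move=> pa; rewrite (leq_trans (mpoly.msizeZ_le p c)). Qed.

Lemma msize_mderiv i p a : (mpoly.msize p <= a.+1)%N ->
  (mpoly.msize (mpoly.mderiv i p) <= a)%N.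
Proof.
move=> pa; rewrite mpoly.msizeE; apply/bigmax_leqP_seq => m mp _.
have : mpoly.mcoeff m (mpoly.mderiv i p) != 0 by rewrite -mpoly.mcoeff_msupp.
rewrite mpoly.mcoeff_deriv => h.
have /mpoly.msize_mdeg_lt : mpoly.mnm_add m (mpoly.mnm1 i) \in mpoly.msupp p.
  by rewrite mpoly.mcoeff_msupp; apply: contra_neq h => ->; rewrite mul0rn.
by rewrite mpoly.mdegD mpoly.mdeg1 addn1 => /leq_trans/(_ pa).
Qed.

End Monomials.

(* On the solutions of x_i^{e_i} = A_i(x) + l B_i(x), with the right-hand sides of
   degree < e_i in x, every polynomial reduces to the prod e_i monomials with
   exponents below e_i. *)
Section Elimination.
Variables (R : realType) (n : nat) (A B : 'I_n -> realpoly R n) (e : 'I_n -> nat).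
Hypothesis e_gt0 : forall i, (0 < e i)%N.
Hypothesis degA : forall i, (mpoly.msize (A i) <= e i)%N.
Hypothesis degB : forall i, (mpoly.msize (B i) <= e i)%N.

Definition elim_sol (x : 'rV[R]_n) (l : R) : Prop :=
  forall i, x 0 i ^+ e i = peval (A i) x + l * peval (B i) x.

Local Notation T := {dffun forall i : 'I_n, 'I_(e i)}.

Definition smallmon (a : T) (x : 'rV[R]_n) : R := \prod_(i < n) x 0 i ^+ a i.

Definition reducible (d : nat) (u : 'rV[R]_n -> R -> R) : Prop :=
  exists a : T -> nat -> R, forall x l, elim_sol x l ->
    u x l = \sum_(t : T) \sum_(j < d.+1) a t j * smallmon t x * l ^+ j.

Lemma reducibleW d d' u : (d <= d')%N -> reducible d u -> reducible d' u.
Proof.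
move=> dd' [a aP]; exists (fun t j => if (j < d.+1)%N then a t j else 0) => x l sxl.
rewrite (aP x l sxl); apply: eq_bigr => t _.
rewrite (big_ord_widen d'.+1 (fun j => a t j * smallmon t x * l ^+ j))//.
by rewrite big_mkcond; apply: eq_bigr => j _; case: ifP; rewrite ?mul0r.
Qed.

Lemma reducible0 d : reducible d (fun _ _ => 0).
Proof.
exists (fun _ _ => 0) => x l _; rewrite big1// => t _; rewrite big1// => j _.
by rewrite !mul0r.
Qed.

Lemma reducible_lin d c u v : reducible d u -> reducible d v ->
  reducible d (fun x l => c * u x l + v x l).
Proof.
move=> [a aP] [b bP]; exists (fun t j => c * a t j + b t j) => x l sxl.
rewrite (aP x l sxl) (bP x l sxl) mulr_sumr -big_split; apply: eq_bigr => t _ /=.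
by rewrite mulr_sumr -big_split; apply: eq_bigr => j _ /=; ring.
Qed.


Lemma reducible_mull d u : reducible d u -> reducible d.+1 (fun x l => l * u x l).
Proof.
move=> [a aP]; exists (fun t j => if j is j'.+1 then a t j' else 0) => x l sxl.
rewrite (aP x l sxl) mulr_sumr; apply: eq_bigr => t _.
rewrite mulr_sumr [RHS]big_ord_recl /= !mul0r add0r; apply: eq_bigr => j _.
by rewrite /bump /= exprS; ring.
Qed.

(** Each replacement of [x_i^(e i)] lowers the degree in [x] by at least one and brings in at most
    one factor [l]; hence a monomial of degree [d] needs at most [d] powers of [l]. *)
Lemma reducible_mono d (m : mpoly.multinom n) : (mpoly.mdeg m <= d)%N ->
  reducible d (fun x _ => mono m x).
Proof.
elim/ltn_ind: d m => d IH m md.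
have [small|] := pselect (forall i, (m i < e i)%N).
  pose t0 : T := finfun (fun i => Ordinal (small i)).
  exists (fun t j => ((t == t0) && (j == 0%N))%:R) => x l _.
  rewrite (bigD1 t0)//= [X in _ + X]big1 ?addr0 => [|t /negbTE tt0]; last first.
    by rewrite big1// => j _; rewrite tt0 !mul0r.
  rewrite big_ord_recl big1 ?addr0 => [|j _]; last by rewrite andbF !mul0r.
  rewrite !eqxx mul1r expr0 mulr1; apply: eq_bigr => i _.
  by rewrite ffunE.
move=> /existsNP[i /negP]; rewrite -leqNgt => ei.
pose m' := mpoly.mnm_sub m (mpoly.mnm_muln (mpoly.mnm1 i) (e i)).
have mE : m = mpoly.mnm_add m' (mpoly.mnm_muln (mpoly.mnm1 i) (e i)).
  rewrite /m' mpoly.submK//; apply/mpoly.mnm_lepP => j.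
  rewrite mpoly.mulmnE mpoly.mnm1E.
  by case: eqP => [<-|_]; rewrite ?mul1n ?mul0n.
have degm : mpoly.mdeg m = (mpoly.mdeg m' + e i)%N.
  by rewrite {1}mE mpoly.mdegD mpoly.mdegMn mpoly.mdeg1 mul1n.
have ei0 := e_gt0 i.
have dpos : (0 < d)%N by lia.
have redq (q : realpoly R n) : (mpoly.msize q <= e i)%N ->
    reducible d.-1 (fun x l => \sum_(k <- mpoly.msupp q | k \in mpoly.msupp q)
      mpoly.mcoeff k q * mono (mpoly.mnm_add m' k) x).
  move=> dq; under [X in reducible _ X]funext do under eq_fun do rewrite -big_filter.
  have all_s : all (mem (mpoly.msupp q)) [seq k <- mpoly.msupp q | k \in mpoly.msupp q].
    exact: filter_all.
  elim: [seq k <- _ | _] all_s => [_|k s IHs /= /andP[kq sq]].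
    by under [X in reducible _ X]funext do under eq_fun do rewrite big_nil;
      exact: reducible0.
  under [X in reducible _ X]funext do under eq_fun do rewrite big_cons.
  apply: reducible_lin; last exact: IHs.
  apply: IH; first by lia.
  have := mpoly.msize_mdeg_lt kq; rewrite mpoly.mdegD; lia.
have redB := reducible_mull (redq _ (degB i)); rewrite prednK// in redB.
have [a aP] := reducible_lin 1 (reducibleW (leq_pred d) (redq _ (degA i))) redB.
exists a => x l sxl; rewrite -(aP x l sxl) mE monoD mono_mul1 sxl mul1r.
rewrite !pevalE_mono mulrDr mulrCA; congr (_ + _ * _);
  rewrite mulr_sumr [RHS]big_seq_cond [RHS]big_mkcondr [LHS]big_seq;
  by apply: eq_bigr => k ->; rewrite monoD mulrCA.
Qed.

(** The [(K+1)(L+1)] products of powers of [x_i] and [l] reduce to combinations of [K (K+L+1)]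
    terms, a small monomial times a power of [l]. The first number is larger exactly when
    [K^2 <= L]. *)
Lemma elimination (i : 'I_n) (L : nat) (K := (\prod_(j < n) e j)%N) : (K * K <= L)%N ->
  exists2 c : 'M[R]_(K.+1, L.+1), c != 0 &
    forall x l, elim_sol x l -> bip c (x 0 i) l = 0.
Proof.
move=> KL.
have /choice[a aP] : forall k : 'I_K.+1, exists a : T -> nat -> R,
    forall x l, elim_sol x l ->
      x 0 i ^+ k = \sum_(t : T) \sum_(j < K.+1) a t j * smallmon t x * l ^+ j.
  move=> k; have [|a aP] := @reducible_mono K (mpoly.mnm_muln (mpoly.mnm1 i) k).
    by rewrite mpoly.mdegMn mpoly.mdeg1 mul1n -ltnS.
  by exists a => x l sxl; rewrite -(aP x l sxl) mono_mul1.
pose M (kj : 'I_K.+1 * 'I_L.+1) (tr : T * 'I_(K + L).+1) : R :=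
  if (kj.2 <= tr.2 <= kj.2 + K)%N then a kj.1 tr.1 (tr.2 - kj.2)%N else 0.
have cardT : #|{: T}| = K.
  rewrite card_dep_ffun /K; under [in RHS]eq_bigr do rewrite -(card_ord (e _)).
  by rewrite foldrE big_map big_enum.
have [|c [[kj ckj] cM]] := @linear_relation R _ _ M.
  rewrite !card_prod !card_ord cardT; nia.
exists (\matrix_(k, j) c (k, j)).
  apply: contra_neq ckj => /matrixP/(_ kj.1 kj.2); rewrite !mxE.
  by case: kj.
move=> x l sxl; rewrite /bip.
have powE (k : 'I_K.+1) (j : 'I_L.+1) : x 0 i ^+ k * l ^+ j =
    \sum_(tr : T * 'I_(K + L).+1) M (k, j) tr * smallmon tr.1 x * l ^+ tr.2.
  rewrite (aP k x l sxl) mulr_suml -(pair_bigA _ (fun t r =>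
    M (k, j) (t, r) * smallmon t x * l ^+ r)) /=.
  apply: eq_bigr => t _; rewrite mulr_suml.
  have jL := ltn_ord j.
  pose G r := (if (j <= r <= j + K)%N then a k t (r - j)%N else 0) * smallmon t x * l ^+ r.
  rewrite -(big_mkord xpredT G) (big_cat_nat (n := j)) //=; last by lia.
  rewrite [X in _ = X + _]big_nat [X in _ = X + _]big1 ?add0r => [|r /andP[_ rj]]; last first.
    by rewrite /G leqNgt rj /= !mul0r.
  rewrite (big_cat_nat (n := (j + K).+1)) //=; [|by lia|by lia].
  rewrite [X in _ = _ + X]big_nat [X in _ = _ + X]big1 ?addr0 => [|r /andP[rj _]].
    2: by rewrite /G [(r <= _)%N]leqNgt rj andbF !mul0r.
  rewrite -[X in index_iota X _]add0n big_addn.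
  have -> : ((j + K).+1 - j = K.+1)%N by rewrite -addnS addKn.
  rewrite big_mkord.
  apply: eq_bigr => r _; rewrite /G addnK leq_addl /= addnC leq_add2l -ltnS ltn_ord.
  by rewrite exprD; ring.
under eq_bigr => k _ do under eq_bigr => j _ do rewrite mxE -mulrA powE.
rewrite pair_bigA /=.
under eq_bigr => kj' _ do rewrite mulr_sumr.
rewrite exchange_big big1// => tr _.
transitivity ((\sum_kj c kj * M kj tr) * (smallmon tr.1 x * l ^+ tr.2)).
  by rewrite mulr_suml; apply: eq_bigr => kj' _; rewrite -surjective_pairing !mulrA.
by rewrite cM mul0r.
Qed.

End Elimination.

Section Relations.
Variables (R : realType) (n : nat) (S : set 'rV[R]_n).

Definition spanned (T : finType) (b : T -> 'rV[R]_n -> R) (u : 'rV[R]_n -> R) : Prop :=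
  exists a : T -> R, forall x, S x -> u x = \sum_t a t * b t x.

Lemma spanned_lin (T : finType) (b : T -> 'rV[R]_n -> R) c u v :
  spanned b u -> spanned b v -> spanned b (fun x => c * u x + v x).
Proof.
move=> [a aP] [a' a'P]; exists (fun t => c * a t + a' t) => x Sx.
rewrite (aP x Sx) (a'P x Sx) mulr_sumr -big_split; apply: eq_bigr => t _ /=.
by ring.
Qed.

Lemma spanned_sum (T : finType) (b : T -> 'rV[R]_n -> R) (I : eqType) (s : seq I)
    (c : I -> R) (u : I -> 'rV[R]_n -> R) :
  (forall i, i \in s -> spanned b (u i)) ->
  spanned b (fun x => \sum_(i <- s) c i * u i x).
Proof.
elim: s => [|i s IH] bu.
  exists (fun=> 0) => x _; rewrite big_nil big1// => t _; by rewrite mul0r.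
under [X in spanned _ X]funext do rewrite big_cons.
apply: spanned_lin; first by apply: bu; rewrite mem_head.
by apply: IH => j js; apply: bu; rewrite inE js orbT.
Qed.

(** The products [x_i^k p^j] with [k <= K] and [j <= L] have degree at most [K + D L], and they
    outnumber the spanning functions [b]. *)
Lemma relation_of_span (T : finType) (b : T -> 'rV[R]_n -> R) (p : realpoly R n)
    (D K L d : nat) (i : 'I_n) :
  (mpoly.msize p <= D.+1)%N -> (K + D * L <= d)%N -> (#|T| < K.+1 * L.+1)%N ->
  (forall m : mpoly.multinom n, (mpoly.mdeg m <= d)%N -> spanned b (mono m)) ->
  exists2 c : 'M[R]_(K.+1, L.+1), c != 0 &
    forall x, S x -> bip c (x 0 i) (peval p x) = 0.
Proof.
move=> pD Kd cardT bm.
have bq (q : realpoly R n) : (mpoly.msize q <= d.+1)%N -> spanned b (peval q).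
  move=> qd; have -> : peval q = fun x => \sum_(m <- mpoly.msupp q)
      mpoly.mcoeff m q * mono m x by apply/funext => x; rewrite pevalE_mono.
  by apply: spanned_sum => m /mpoly.msize_mdeg_lt/leq_trans/(_ qd) md; apply: bm.
have /choice[M MP] : forall kj : 'I_K.+1 * 'I_L.+1, exists M : T -> R,
    forall x, S x -> x 0 i ^+ kj.1 * peval p x ^+ kj.2 = \sum_t M t * b t x.
  move=> [k j] /=; have [|M MP] := bq (pvar R i ^+ k * p ^+ j).
    have h1 : (mpoly.msize (pvar R i ^+ k : realpoly R n) <= (1 * k).+1)%N.
      by apply: msizeXn_leq; rewrite msize_pvar.
    have h2 := msizeXn_leq j pD.
    have := msizeM_leq h1 h2; have := ltn_ord k; have := ltn_ord j; nia.
  by exists M => x Sx; rewrite -(MP x Sx) !pevalE.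
have [|c [[kj ckj] cM]] := @linear_relation R _ _ M; first by rewrite card_prod !card_ord.
exists (\matrix_(k, j) c (k, j)).
  by apply: contra_neq ckj => /matrixP/(_ kj.1 kj.2); rewrite !mxE; case: kj.
move=> x Sx; rewrite /bip.
under eq_bigr => k _ do under eq_bigr => j _ do
  rewrite mxE -mulrA (MP (k, j) x Sx) mulr_sumr.
rewrite pair_bigA /= exchange_big big1// => t _.
have := cM t => h; under eq_bigr => kj' _ do rewrite -surjective_pairing mulrA.
by rewrite -mulr_suml h mul0r.
Qed.

End Relations.

(** The [(D+1)(L+1)] products [x^k p^j] lie in a space of dimension [D + D L + 1], which is smaller
    as soon as [L > 0]. *)
Lemma relation_dim1 (R : realType) (p : realpoly R 1) (D L : nat) (i : 'I_1) :
  (mpoly.msize p <= D.+1)%N -> (0 < L)%N ->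
  exists2 c : 'M[R]_(D.+1, L.+1), c != 0 &
    forall x : 'rV[R]_1, bip c (x 0 i) (peval p x) = 0.
Proof.
move=> pD L0.
have [|m md|c c0 cP] := @relation_of_span R 1 setT 'I_(D + D * L).+1
    (fun k x => x 0 0 ^+ k) p D D L (D + D * L) i pD (leqnn _).
- by rewrite card_ord; nia.
- have mD : (m 0%R < (D + D * L).+1)%N.
    by rewrite ltnS (leq_trans _ md)// mpoly.mdegE big_ord1.
  exists (fun k => (k == Ordinal mD)%:R) => x _.
  rewrite (bigD1 (Ordinal mD))//= eqxx mul1r big1 ?addr0 => [|k /negbTE ->].
    by rewrite /mono big_ord1.
  by rewrite mul0r.
by exists c => // x; apply: cP.
Qed.

(* Modulo a polynomial with leading monomial mu, a plane polynomial of degree at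
   most d reduces to the at most |mu| (d + 1) monomials not divisible by mu. *)
Lemma relation_dim2 (R : realType) (p q : realpoly R 2) (D e L K : nat) (i : 'I_2) :
  (mpoly.msize p <= D.+1)%N -> q != 0 -> (mpoly.msize q <= e.+1)%N ->
  (e * (K + D * L).+1 < K.+1 * L.+1)%N ->
  exists2 c : 'M[R]_(K.+1, L.+1), c != 0 &
    forall x, peval q x = 0 -> bip c (x 0 i) (peval p x) = 0.
Proof.
move=> pD q0 qe KL.
pose mu := mpoly.mlead q; pose d := (K + D * L)%N.
pose i1 : 'I_2 := 1.
have mdeg2 (m : mpoly.multinom 2) : mpoly.mdeg m = (m 0%R + m i1)%N.
  rewrite mpoly.mdegE big_ord_recl big_ord1; congr (_ + m _)%N; exact: val_inj.
have mono2 (m : mpoly.multinom 2) (x : 'rV[R]_2) : mono m x = x 0 0 ^+ m 0%R * x 0 i1 ^+ m i1.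
  rewrite /mono big_ord_recl big_ord1; congr (_ * x _ _ ^+ m _); exact: val_inj.
have mue : (mu 0%R + mu i1 <= e)%N by rewrite -mdeg2 -ltnS mpoly.mlead_deg.
pose T := ('I_(mu 0%R) * 'I_d.+1 + 'I_d.+1 * 'I_(mu i1))%type.
pose ex (t : T) : nat * nat := match t with inl u => (val u.1, val u.2) | inr u => (val u.1, val u.2) end.
pose b (t : T) (x : 'rV[R]_2) : R := x 0 0 ^+ (ex t).1 * x 0 i1 ^+ (ex t).2.
apply: (@relation_of_span R 2 [set x | peval q x = 0] T b p D K L d) => //.
  by rewrite card_sum !card_prod !card_ord; apply: leq_ltn_trans KL; rewrite -/d; nia.
have base (t : T) (m : mpoly.multinom 2) : (ex t).1 = m 0%R -> (ex t).2 = m i1 ->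
    spanned [set x | peval q x = 0] b (mono m).
  move=> t0 t1; exists (fun t' => (t' == t)%:R) => x _.
  rewrite (bigD1 t)//= eqxx mul1r big1 ?addr0 => [|k /negbTE ->]; last by rewrite mul0r.
  by rewrite mono2 /b t0 t1.
move=> m; elim/(well_founded_ind (@mpoly.ltom_wf 2)): m => m IH md.
have m0d : (m 0%R < d.+1)%N by rewrite ltnS (leq_trans _ md)// mdeg2 leq_addr.
have m1d : (m i1 < d.+1)%N by rewrite ltnS (leq_trans _ md)// mdeg2 leq_addl.
have [m0|m0] := ltnP (m 0%R) (mu 0%R).
  by apply: (base (inl (Ordinal m0, Ordinal m1d))).
have [m1|m1] := ltnP (m i1) (mu i1).
  by apply: (base (inr (Ordinal m0d, Ordinal m1))).
pose m' := mpoly.mnm_sub m mu.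
have mE : m = mpoly.mnm_add m' mu.
  rewrite /m' mpoly.submK//; apply/mpoly.mnm_lepP => j.
  by case: j => [[|[|//]]] jl; [rewrite (_ : Ordinal jl = 0)|rewrite (_ : Ordinal jl = i1)];
    rewrite //; exact: val_inj.
pose lc := mpoly.mcoeff mu q.
have lc0 : lc != 0 by rewrite mpoly.mleadc_eq0.
have muq : mu \in mpoly.msupp q by rewrite mpoly.mlead_supp.
pose s := [seq k <- mpoly.msupp q | k != mu].
have [a aP] : spanned [set x | peval q x = 0] b (fun x => \sum_(k <- s)
    (- (mpoly.mcoeff k q / lc)) * mono (mpoly.mnm_add m' k) x).
  apply: spanned_sum => k; rewrite mem_filter => /andP[kmu kq].
  have lt : (mpoly.mnm_add m' k < m)%O.
    by rewrite [X in (_ < X)%O]mE mpoly.ltmc_add2r lt_neqAle kmu mpoly.msupp_le_mlead.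
  apply: IH => //; apply: leq_trans md; apply: mpoly.lemc_mdeg; exact: ltW.
exists a => x qx; rewrite -(aP x qx).
have : lc * mono mu x = - \sum_(k <- s) mpoly.mcoeff k q * mono k x.
  apply/eqP; rewrite -addr_eq0; apply/eqP; have := qx; rewrite /= pevalE_mono => h; rewrite -[RHS]h.
  rewrite [RHS](bigD1_seq mu)//= ?mpoly.msupp_uniq//; congr (_ + _).
  by rewrite /s big_filter.
move=> /(congr1 (fun t => lc^-1 * mono m' x * t)).
rewrite [LHS]mulrACA mulVf// mul1r -monoD -mE => ->.
rewrite mulrN mulr_sumr -sumrN; apply: eq_bigr => k _.
by rewrite monoD; ring.
Qed.

(** * Algebraic relations for the minimizers of |grad p|^2 - l p *)

Section UltraLimits.

Lemma ultra_fmap (S T : Type) (f : S -> T) (F : set_system S) :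
  UltraFilter F -> UltraFilter (f @ F).
Proof.
move=> uF; have pF := @ultra_proper _ _ uF.
apply: Build_UltraFilter => G pG FG; apply/seteqP; split=> // A GA.
case: (in_ultra_setVsetC (f @^-1` A) uF) => // FA.
have GC : G (~` A) by apply: FG; exact: FA.
have GG : G (A `&` ~` A) by apply: filterI.
by have [x []] := filter_ex GG.
Qed.

Lemma ultra_compact_cvg (S : Type) (T : topologicalType) (F : set_system S)
    (f : S -> T) (K : set T) :
  UltraFilter F -> compact K -> (forall s, K (f s)) -> exists2 x, K x & f @ F --> x.
Proof.
move=> uF; have pF := @ultra_proper _ _ uF; rewrite compact_ultra => cK fK.
have [|x [Kx fx]] := cK (f @ F) (ultra_fmap f uF); last by exists x.
by apply: (@filterE _ F) => s; apply: fK.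
Qed.

Lemma ultra_pigeonhole (S : Type) (I : finType) (F : set_system S) (s : S -> I) :
  UltraFilter F -> exists i, F [set a | s a = i].
Proof.
move=> uF; have pF := @ultra_proper _ _ uF.
apply: contrapT => nex.
have /filter_forall/filter_ex[a] : forall i, F (~` [set a | s a = i]).
  move=> i; case: (in_ultra_setVsetC [set a | s a = i] uF) => // Fi.
  by case: nex; exists i.
by move=> /(_ (s a)); apply.
Qed.

Lemma bip_cvg (R : realType) (S : Type) (F : set_system S) {FF : Filter F} (K L : nat)
    (c : S -> 'M[R]_(K.+1, L.+1)) (y t : S -> R) (c0 : 'M[R]_(K.+1, L.+1)) (y0 t0 : R) :
  (forall k j, (fun a => c a k j) @ F --> c0 k j) -> y @ F --> y0 -> t @ F --> t0 ->
  (fun a => bip (c a) (y a) (t a)) @ F --> bip c0 y0 t0.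
Proof.
move=> cc yy tt; apply: cvg_big => [|k _]; first exact: add_continuous.
apply: cvg_big => [|j _]; first exact: add_continuous.
apply: cvgM; first (apply: cvgM; first exact: cc).
  by apply: (cvg_comp y (fun z : R => z ^+ k) yy); apply: exprn_continuous.
by apply: (cvg_comp t (fun z : R => z ^+ j) tt); apply: exprn_continuous.
Qed.

End UltraLimits.

Lemma mderiv_all0 (R : realType) (n : nat) (p : realpoly R n) :
  (forall i, mpoly.mderiv i p = 0) -> p = mpoly.mpolyC n (mpoly.mcoeff (@mpoly.mnm0 n) p).
Proof.
move=> dp; apply/mpoly.mpolyP => m; rewrite mpoly.mcoeffC.
have [->|m0] := eqVneq m (@mpoly.mnm0 n); first by rewrite mulr1.
rewrite mulr0.
have [i mi] : exists i, (0 < m i)%N.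
  apply: contrapT => nex; move/eqP: m0; apply; apply/mpoly.mnmP => i.
  rewrite mpoly.mnm0E; apply/eqP; rewrite -leqn0 leqNgt; apply/negP => mi.
  by apply: nex; exists i.
pose m' := mpoly.mnm_sub m (mpoly.mnm1 i).
have mE : m = mpoly.mnm_add m' (mpoly.mnm1 i).
  rewrite /m' mpoly.submK//; apply/mpoly.mnm_lepP => j; rewrite mpoly.mnm1E.
  by case: eqP => // <-.
have := congr1 (mpoly.mcoeff m') (dp i); rewrite mpoly.mcoeff_deriv -mE mpoly.mcoeff0.
by move=> /eqP; rewrite mulrn_eq0 orFb => /eqP.
Qed.

Section Padding.
Variables (R : realType) (E L : nat).

Lemma bip_pad (K : nat) (c : 'M[R]_(K.+1, L.+1)) : (K <= E)%N -> c != 0 ->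
  exists c' : 'M[R]_(E.+1, L.+1), [/\ c' != 0,
    forall (k : 'I_E.+1) j, (K < k)%N -> c' k j = 0 &
    forall y t, bip c' y t = bip c y t].
Proof.
move=> KE c0.
exists (\matrix_(k, j) if (k < K.+1)%N then c (inord k) j else 0); split.
- apply: contra_neq c0 => /matrixP c'0; apply/matrixP => k j.
  have kE : (k < E.+1)%N by rewrite (leq_trans (ltn_ord k)).
  by have := c'0 (Ordinal kE) j; rewrite !mxE /= ltn_ord inord_val.
- by move=> k j Kk; rewrite mxE ltnS leqNgt Kk.
- move=> y t; rewrite /bip.
  pose G k := \sum_j c (inord k) j * y ^+ k * t ^+ j.
  transitivity (\sum_(k < K.+1) G k); last first.
    by apply: eq_bigr => k _; rewrite /G inord_val.
  rewrite (big_ord_widen E.+1 G)// [RHS]big_mkcond; apply: eq_bigr => k _.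
  rewrite /G; case: ifP => kK.
    by apply: eq_bigr => j _; rewrite mxE kK.
  by rewrite big1// => j _; rewrite mxE kK !mul0r.
Qed.

(** Unit length of the coefficients prevents a relation from vanishing in the limit [eta -> 0]. *)
Lemma bip_normalize (c : 'M[R]_(E.+1, L.+1)) : c != 0 ->
  exists2 a : R, a != 0 & \sum_k \sum_j (a *: c) k j ^+ 2 = 1.
Proof.
move=> c0; pose s := \sum_k \sum_j c k j ^+ 2.
have s0 : 0 < s.
  rewrite lt_neqAle sumr_ge0 ?andbT => [|k _]; last first.
    by apply: sumr_ge0 => j _; apply: sqr_ge0.
  apply: contra_neq c0 => /esym /eqP; rewrite psumr_eq0 => [/allP h|k _]; last first.
    by apply: sumr_ge0 => j _; apply: sqr_ge0.
  apply/matrixP => k j; rewrite mxE.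
  have := h k (mem_index_enum _); rewrite psumr_eq0 => [/allP/(_ j (mem_index_enum _))|j' _].
    by rewrite sqrf_eq0 => /eqP.
  exact: sqr_ge0.
exists (Num.sqrt s)^-1; first by rewrite invr_eq0 gt_eqF// sqrtr_gt0.
transitivity ((Num.sqrt s)^-1 ^+ 2 * s).
  rewrite mulr_sumr; apply: eq_bigr => k _; rewrite mulr_sumr; apply: eq_bigr => j _.
  by rewrite mxE exprMn.
by rewrite exprVn sqr_sqrtr ?ltW// mulVf// gt_eqF.
Qed.

Lemma bipZ (a : R) (c : 'M[R]_(E.+1, L.+1)) y t : bip (a *: c) y t = a * bip c y t.
Proof.
rewrite /bip mulr_sumr; apply: eq_bigr => k _; rewrite mulr_sumr; apply: eq_bigr => j _.
by rewrite mxE !mulrA.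
Qed.

End Padding.

(** * Critical equations of the perturbed Lagrangian *)

Section Perturbation.
Variables (R : realType) (n : nat) (p : realpoly R n) (D : nat).

(** This bounds the degree of [|grad p|^2], so [x_i^pexp], the [i]-th derivative of [powsum], has
    larger degree than every other term of the critical equation. *)
Definition pexp := (2 * D - 2)%N.
Definition gexp := (D * (3 * D - 3) ^ n.-1)%N.
Definition lagr (l : R) : realpoly R n := pgrad2 p - l *: p.
Definition powsum : realpoly R n := \sum_i (pexp.+1%:R)^-1 *: pvar R i ^+ pexp.+1.
Definition pert (l eta : R) : realpoly R n := lagr l + eta *: powsum.

Lemma peval_pert l eta x : peval (pert l eta) x =
  peval (pgrad2 p) x - l * peval p x + eta * peval powsum x.
Proof. by rewrite pevalD pevalB !pevalZ. Qed.

Lemma mderiv_powsum i : mpoly.mderiv i powsum = pvar R i ^+ pexp.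
Proof.
rewrite /powsum linear_sum (bigD1 i)//= big1 ?addr0 => [|j ji].
  rewrite linearZ /= /pvar !mpoly.mpolyXn mpoly.mderivX mpoly.mulmnE mpoly.mnm1E eqxx mul1n.
  rewrite scalerA mulVf ?pnatr_eq0// scale1r; congr mpoly.mpolyX.
  apply/mpoly.mnmP => k; rewrite mpoly.mnmBE !mpoly.mulmnE mpoly.mnm1E.
  by case: (i == k); rewrite ?mul1n ?mul0n// subn1.
rewrite linearZ /= /pvar mpoly.mpolyXn mpoly.mderivX mpoly.mulmnE mpoly.mnm1E (negbTE ji).
by rewrite mul0n scale0r scaler0.
Qed.

Lemma mderiv_pertE i l eta :
  mpoly.mderiv i (pert l eta) =
  mpoly.mderiv i (pgrad2 p) - l *: mpoly.mderiv i p + eta *: pvar R i ^+ pexp.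
Proof. by rewrite /pert /lagr linearD linearB !linearZ /= mderiv_powsum. Qed.

Hypothesis D4 : (4 <= D)%N.
Hypothesis degp : (mpoly.msize p <= D.+1)%N.

Lemma msize_pgrad2 : (mpoly.msize (pgrad2 p) <= pexp.+1)%N.
Proof.
apply: msize_sum_leq => i; rewrite /pexp.
have := @msizeXn_leq R n (mpoly.mderiv i p) 2 (D - 1) _; rewrite mulnBl mul1n mulnC.
by apply; rewrite (leq_trans (msize_mderiv i degp))//; lia.
Qed.

(* Vanishes at the critical points of pert l eta for every l, since it does not
   involve the multiplier. *)
Definition jac2 (i j : 'I_n) (eta : R) : realpoly R n :=
  (mpoly.mderiv i (pgrad2 p) + eta *: pvar R i ^+ pexp) * mpoly.mderiv j p -
  (mpoly.mderiv j (pgrad2 p) + eta *: pvar R j ^+ pexp) * mpoly.mderiv i p.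

Lemma msize_jac2 i j eta : (mpoly.msize (jac2 i j eta) <= (3 * D - 3).+1)%N.
Proof.
have h k : (mpoly.msize (mpoly.mderiv k (pgrad2 p) + eta *: pvar R k ^+ pexp) <= pexp.+1)%N.
  apply: msizeD_leq.
    by apply: leq_trans (leqnSn _); apply: msize_mderiv; apply: msize_pgrad2.
  by apply: msizeZ_leq; rewrite -[X in (_ <= X.+1)%N]mul1n; apply: msizeXn_leq; rewrite msize_pvar.
have g k : (mpoly.msize (mpoly.mderiv k p) <= D.-1.+1)%N.
  by rewrite prednK; [apply: msize_mderiv|lia].
have hg k l : (mpoly.msize ((mpoly.mderiv k (pgrad2 p) + eta *: pvar R k ^+ pexp) *
    mpoly.mderiv l p)%R <= (3 * D - 3).+1)%N.
  by apply: leq_trans (msizeM_leq (h k) (g l)) _; rewrite /pexp; lia.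
by apply: msizeD_leq => //; rewrite mpoly.msizeN.
Qed.

Lemma jac2_eq0 i j l eta x :
  (forall k, peval (mpoly.mderiv k (pert l eta)) x = 0) -> peval (jac2 i j eta) x = 0.
Proof.
move=> crit; have c k : peval (mpoly.mderiv k (pgrad2 p) + eta *: pvar R k ^+ pexp) x =
    l * peval (mpoly.mderiv k p) x.
  by have := crit k; rewrite mderiv_pertE !pevalE => h; lra.
by rewrite /jac2 pevalB !pevalM !c; ring.
Qed.

(** If [m] were the leading monomial of the [i]-th derivative, [x_i^pexp] would have to divide
    [x_j^pexp m], hence [m]; but [m] has degree at most [D - 1 < pexp]. *)
Lemma pvar_mderiv_neq i j : i != j ->
  pvar R i ^+ pexp * mpoly.mderiv j p = pvar R j ^+ pexp * mpoly.mderiv i p ->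
  mpoly.mderiv i p = 0.
Proof.
move=> ij; rewrite /pvar !mpoly.mpolyXn => eqp.
apply/eqP; apply: contrapT => /negP; rewrite -mpoly.mleadc_eq0 -mpoly.mcoeff_msupp => mi.
set m := mpoly.mlead _ in mi.
have : mpoly.mnm_add (mpoly.mnm_muln (mpoly.mnm1 j) pexp) m \in
    mpoly.msupp (mpoly.mpolyX R (mpoly.mnm_muln (mpoly.mnm1 i) pexp) * mpoly.mderiv j p).
  rewrite eqp mulrC (perm_mem (mpoly.msuppMX _ _)); apply: map_f; exact: mi.
rewrite mulrC (perm_mem (mpoly.msuppMX _ _)) => /mapP[m' _ /(congr1 (fun m : mpoly.multinom n => m i))].
rewrite !mpoly.mnmDE !mpoly.mulmnE !mpoly.mnm1E eqxx [j == i]eq_sym (negbTE ij) mul0n add0n mul1n.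
have : (m i <= mpoly.mdeg m)%N by rewrite mpoly.mdegE (bigD1 i)//= leq_addr.
have := mpoly.msize_mdeg_lt mi; have := msize_mderiv i degp; rewrite /pexp; lia.
Qed.

(** [jac2] is affine in [eta] with nonzero slope [s], so at most one value of [eta] has to be
    avoided. *)
Lemma jac2_neq0 (i j : 'I_n) : i != j -> (forall k, k = i \/ k = j) ->
  (exists k, mpoly.mderiv k p != 0) ->
  exists2 eta0 : R, 0 < eta0 & forall eta, 0 < eta < eta0 -> jac2 i j eta != 0.
Proof.
move=> ij allk [k kp].
pose s := pvar R i ^+ pexp * mpoly.mderiv j p - pvar R j ^+ pexp * mpoly.mderiv i p.
have s0 : s != 0.
  apply/eqP => /eqP; rewrite subr_eq0 => /eqP h; move/eqP: kp; apply.
  case: (allk k) => ->; first exact: pvar_mderiv_neq h.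
  by apply: (pvar_mderiv_neq _ (esym h)); rewrite eq_sym.
have jE a b : jac2 i j a - jac2 i j b = (a - b) *: s.
  have gen (y y' u v w t : realpoly R n) : (y + a *: u) * v - (y' + a *: w) * t -
      ((y + b *: u) * v - (y' + b *: w) * t) = (a - b) *: (u * v - w * t).
    by rewrite !mulrDl -!scalerAl scalerBl !scalerBr; ring.
  exact: gen.
have [[a [a0 ja]]|nex] := pselect (exists a : R, 0 < a /\ jac2 i j a = 0).
  exists a => // b /andP[b0 ba]; apply/eqP => jb.
  have := jE a b; rewrite ja jb subrr => /esym/eqP; rewrite scaler_eq0 (negbTE s0) orbF.
  by rewrite subr_eq0 gt_eqF.
by exists 1 => // a /andP[a0 _]; apply/eqP => ja; apply: nex; exists a.
Qed.

End Perturbation.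

(** In the plane the critical points lie on [jac2 = 0], of degree [e = 3D - 3]. With [K = D e] the
    terms [K L] cancel in the count required by [relation_dim2], and [L >= 3D (K+1)] outweighs what
    is left. On the line any point will do. *)
Lemma free_relation (R : realType) (n : nat) (p : realpoly R n) (D : nat) :
  (4 <= D)%N -> (mpoly.msize p <= D.+1)%N -> (exists k, mpoly.mderiv k p != 0) ->
  (n <= 2)%N ->
  exists2 eta0 : R, 0 < eta0 & forall eta (L : nat) (i : 'I_n), 0 < eta < eta0 ->
    (3 * D * (gexp n D).+1 <= L)%N ->
    exists2 c : 'M[R]_((gexp n D).+1, L.+1), c != 0 &
      forall x l, (forall k, peval (mpoly.mderiv k (pert p D l eta)) x = 0) ->
        bip c (x 0 i) (peval p x) = 0.
Proof.
move=> D4; case: n p => [|[|[|//]]] p degp dp _.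
- by exists 1 => // eta L [].
- exists 1 => // eta L i _ hL.
  have := @relation_dim1 R p (gexp 1 D) L i; rewrite /gexp expn0 muln1 => h.
  have [|c c0 cP] := h degp; first by move: hL; rewrite /gexp; nia.
  by exists c => // x l _; apply: cP.
- pose i1 : 'I_2 := 1.
  have [//||eta0 eta00 etaP] := @jac2_neq0 R 2 p D D4 degp 0 i1 _ _ dp.
    by move=> [[|[|//]]] kl; [left|right]; apply: val_inj.
  exists eta0 => // eta L i eta_in hL.
  have [|c c0 cP] := relation_dim2 (L := L) (K := gexp 2 D) i degp (etaP eta eta_in)
    (msize_jac2 D4 degp 0 i1 eta).
    move: hL; rewrite /gexp expn1; set g := (D * _)%N => hL; nia.
  by exists c => // x l crit; apply: cP; apply: jac2_eq0 crit.
Qed.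

(** * Faces of the cube and the degree count on them *)

Section Faces.
Variables (n D : nat).
Hypothesis D4 : (4 <= D)%N.

(** [None] marks a coordinate in the open interval, [Some b] one fixed at [B] or at [-B] according
    to [b]. *)
Definition face := {ffun 'I_n -> option bool}.
Definition face_exp (s : face) (i : 'I_n) : nat := if s i is Some _ then 1 else pexp D.

(* On these faces the degree \prod_i face_exp s i can exceed gexp n D - 2, and the
   relation is taken in the value of p rather than in the multiplier. *)
Definition value_mode (s : face) := (n <= 2)%N && [forall i, s i == None].

Lemma face_exp_gt0 s i : (0 < face_exp s i)%N.
Proof. by rewrite /face_exp; case: (s i) => //; rewrite /pexp; lia. Qed.

Lemma prod_face_exp s : (\prod_i face_exp s i = pexp D ^ #|[set i | s i == None]%SET|)%N.
Proof.
rewrite -prod_nat_const [RHS]big_mkcond; apply: eq_bigr => i _.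
by rewrite finset.inE /face_exp; case: (s i).
Qed.

Lemma prod_face_exp_le s : (\prod_i face_exp s i <= pexp D ^ n)%N.
Proof.
rewrite prod_face_exp leq_pexp2l//; first by rewrite /pexp; lia.
by rewrite (leq_trans (max_card _))// card_ord.
Qed.

Hypothesis n0 : (0 < n)%N.

(** For [n >= 3] the comparison starts from [8 (D-1)^3 <= 9 D (D-1)^2 - 2]. For [n <= 2] some
    coordinate is fixed, and [2D-2 <= 3D(D-1)-2] or [1 <= D-2] suffices. *)
Lemma prod_face_exp_gexp s : ~~ value_mode s ->
  (\prod_i face_exp s i <= gexp n D - 2)%N.
Proof.
rewrite /value_mode negb_and -ltnNge => /orP[n3|].
  apply: leq_trans (prod_face_exp_le s) _; clear s.
  case: n n3 => [|[|[|k]]] // _; rewrite /gexp /pexp /=.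
  have -> : (3 * D - 3 = 3 * (D - 1))%N by lia.
  have -> : (2 * D - 2 = 2 * (D - 1))%N by lia.
  have le : ((2 * (D - 1)) ^ k <= (3 * (D - 1)) ^ k)%N.
    by case: (posnP k) => [->//|k0]; rewrite leq_exp2r// leq_mul2r orbT.
  have pos : (0 < (2 * (D - 1)) ^ k)%N by rewrite expn_gt0; lia.
  rewrite !expnS; move: le pos; set u := expn _ _; set v := expn _ _ => le pos.
  have : (3 <= D - 1)%N by lia.
  have : (D = (D - 1).+1)%N by lia.
  move: (D - 1)%N => a -> a3; nia.
rewrite negb_forall => /existsP[i si].
have fn : (#|[set i | s i == None]%SET| < n)%N.
  rewrite -[X in (_ < X)%N]card_ord -cardsT proper_card// finset.properEneq finset.subsetT andbT.
  by apply: contra_neq si => /finset.setP/(_ i); rewrite !finset.inE => /eqP.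
rewrite prod_face_exp; apply: leq_trans (_ : (pexp D ^ n.-1 <= _)%N).
  by rewrite leq_pexp2l//; [rewrite /pexp; lia|rewrite -ltnS prednK].
clear s i si fn.
have [n3|] := leqP 3 n.
  case: n n3 => [|[|[|k]]] // _; rewrite /gexp /pexp /=.
  have le : ((2 * D - 2) ^ k.+2 <= (3 * D - 3) ^ k.+2)%N by rewrite leq_exp2r//; lia.
  have pos : (0 < (2 * D - 2) ^ k.+2)%N by rewrite expn_gt0; lia.
  by move: le pos; set u := expn _ _; set v := expn _ _ => le pos; nia.
case: n n0 => [|[|[|k]]] // _ _; rewrite /gexp /pexp /= ?expn0 ?expn1; nia.
Qed.

End Faces.

(** * Relations for the minimizers, uniform in the multiplier *)

Section AlgMin.
Variables (R : realType) (n : nat) (p : realpoly R n) (D : nat) (B tau : R) (z : 'rV[R]_n).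
Hypothesis n0 : (0 < n)%N.
Hypothesis p_ge0 : forall x, 0 <= peval p x.
Hypothesis degp : (mpoly.msize p <= D.+1)%N.
Hypothesis D4 : (4 <= D)%N.
Hypothesis p_neq0 : p != 0.
Hypothesis cube_z : cube B z.
Hypothesis p_z : peval p z = 0.
Hypothesis tau_gt0 : 0 < tau.
Hypothesis crit : forall x, cube B x -> 0 < peval p x <= tau -> 0 < peval (pgrad2 p) x.

(** The bound [tau] excludes critical points of [p] with positive value: there [|grad p|^2 - l p] is
    negative although no zero of [p] need be near. *)
Definition sublevel : set 'rV[R]_n := [set x | cube B x /\ peval p x <= tau].

Definition minimizer (W : realpoly R n) (x : 'rV[R]_n) : Prop :=
  sublevel x /\ forall y, sublevel y -> peval W x <= peval W y.

Lemma sublevel_compact : compact sublevel.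
Proof.
apply: (@closed_cube_compact R n B) => [|x []//].
apply: closedI; [exact: closed_cube|exact: closed_peval_le].
Qed.

Lemma sublevel_z : sublevel z.
Proof. by split; rewrite ?p_z ?ltW. Qed.

Lemma minimizer_exists W : exists x, minimizer W x.
Proof.
have [||x xS xmin] := @EVT_min_rV R n (peval W) sublevel _ sublevel_compact.
- by exists z; apply: sublevel_z.
- by apply: continuous_subspaceT; apply: peval_continuous.
- by exists x; split=> [|y Sy]; [exact: set_mem|apply: xmin; apply: mem_set].
Qed.

Lemma pgrad2_z : peval (pgrad2 p) z = 0.
Proof.
rewrite pgrad2E big1// => i _; rewrite (@mderiv_eq0_of_min R n p z i 1) ?expr0n//.
by move=> s _; rewrite p_z.
Qed.

(** On [p = tau] the squared gradient is at least [mu], while at [z] both it and [p] vanish. For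
    small [l] and [eta] the remaining terms are each below [mu / 4], so a point of this level loses
    against [z]. *)
Lemma minimizer_below : exists l0 eta0 : R, [/\ 0 < l0, 0 < eta0 &
  forall l eta x, 0 < l < l0 -> 0 < eta < eta0 -> minimizer (pert p D l eta) x ->
    peval p x < tau].
Proof.
have [mu mu0 muP] : exists2 mu : R, 0 < mu &
    forall x, cube B x -> peval p x = tau -> mu <= peval (pgrad2 p) x.
  pose T := cube B `&` [set x | peval p x = tau].
  have cT : compact T.
    apply: (@closed_cube_compact R n B) => [|x []//].
    by apply: closedI; [exact: closed_cube|exact: closed_peval_eq].
  have [T0|nT] := pselect (T !=set0); last first.
    by exists 1 => // x cx px; case: nT; exists x.
  have [|x xT xmin] := @EVT_min_rV R n (peval (pgrad2 p)) T T0 cT.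
    by apply: continuous_subspaceT; apply: peval_continuous.
  exists (peval (pgrad2 p) x) => [|y cy py]; last by apply: xmin; apply: mem_set.
  by have [cx px] := set_mem xT; apply: crit; rewrite // px tau_gt0 lexx.
have [M M0 SM] := peval_bounded B (powsum R n D).
exists (mu / (4 * tau)), (mu / (4 * (M + 1))).
split; [by rewrite divr_gt0// mulr_gt0|by rewrite divr_gt0// mulr_gt0// ltr_wpDl|].
move=> l eta x /andP[l0 ll0] /andP[eta0 eeta0] [[cx px] xmin].
rewrite lt_neqAle px andbT; apply/eqP => pxt.
have := xmin z sublevel_z; rewrite !peval_pert pgrad2_z p_z pxt.
have := muP x cx pxt; have := SM x cx; have := SM z cube_z.
rewrite !ler_norml => /andP[_ Sz] /andP[Sx _] hx.
have h1 : l * tau < mu / 4.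
  by move: ll0; rewrite invfM mulrA ltr_pdivlMr.
have h2 : eta * M < mu / 4.
  have : eta * (M + 1) < mu / 4 by move: eeta0; rewrite invfM mulrA ltr_pdivlMr// ltr_wpDl.
  by apply: le_lt_trans; rewrite ler_pM2l// lerDl.
have h3 : eta * peval (powsum R n D) z <= eta * M by rewrite ler_pM2l.
have h4 : - (eta * M) <= eta * peval (powsum R n D) x by rewrite -mulrN ler_pM2l.
move: h1 h2 h3 h4 hx; lra.
Qed.

Definition on_face (s : face n) (x : 'rV[R]_n) : Prop := forall i,
  if s i is Some b then x 0 i = (if b then B else - B) else `|x 0 i| < B.

Lemma on_face_exists x : cube B x -> exists s, on_face s x.
Proof.
move=> cx; exists [ffun i => if `|x 0 i| < B then None else Some (0 <= x 0 i)] => i.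
rewrite ffunE; case: ltrP => // Bx.
have : `|x 0 i| = B by apply/eqP; rewrite eq_le Bx cx.
by case: ger0P => _ <-; rewrite ?opprK.
Qed.

Lemma minimizer_critical W s x i : minimizer W x -> peval p x < tau -> on_face s x ->
  s i = None -> peval (mpoly.mderiv i W) x = 0.
Proof.
move=> [[cx _] xmin] pxt /(_ i); rewrite /on_face => fx si; rewrite si in fx.
have [G G0 lip] := peval_lipschitz B p.
pose r := Num.min (B - `|x 0 i|) ((tau - peval p x) / (G + 1)).
have r0 : 0 < r.
  by rewrite lt_min subr_gt0 fx divr_gt0// ?subr_gt0// ltr_wpDl.
apply: (mderiv_eq0_of_min r0) => t tr; apply: xmin.
have ct : cube B (x + t *: 'e_i).
  move=> j; rewrite !mxE eqxx /=; case: eqP => [->|_]; last by rewrite mulr0 addr0.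
  rewrite mulr1 (le_trans (ler_normD _ _))// -lerBrDl (le_trans tr)//.
  by rewrite ge_min lexx.
split=> //.
have := lip x (x + t *: 'e_i) cx ct.
have -> : dist1 x (x + t *: 'e_i) = `|t|.
  rewrite /dist1 (bigD1 i)//= big1 => [|j ji].
    by rewrite !mxE !eqxx mulr1 addrAC subrr add0r addr0.
  by rewrite !mxE eqxx /= (negbTE ji) mulr0 addr0 subrr normr0.
move=> /(le_trans (ler_norm _)) h.
have : `|t| * (G + 1) <= tau - peval p x.
  by rewrite -ler_pdivlMr ?ltr_wpDl// (le_trans tr)// ge_min lexx orbT.
by have := normr_ge0 t; move: h; nra.
Qed.

(** The system for [elimination] takes [x_j = B] or [x_j = -B] at fixed coordinates and, at free
    ones, the critical equation divided by [eta] and solved for [x_j^pexp]. *)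
Lemma bound_relation (s : face n) (eta : R) (L : nat) (i : 'I_n) : eta != 0 ->
  ((pexp D ^ n) * (pexp D ^ n) <= L)%N -> ~~ value_mode s ->
  exists c : 'M[R]_((gexp n D).+1, L.+1), [/\ c != 0,
    forall (k : 'I_(gexp n D).+1) j, (gexp n D - 2 < k)%N -> c k j = 0 &
    forall x l, on_face s x ->
      (forall j, s j = None -> peval (mpoly.mderiv j (pert p D l eta)) x = 0) ->
      bip c (x 0 i) l = 0].
Proof.
move=> eta0 hL ms.
pose A j : realpoly R n := if s j is Some b then mpoly.mpolyC n (if b then B else - B)
  else - eta^-1 *: mpoly.mderiv j (pgrad2 p).
pose C j : realpoly R n := if s j is Some b then 0 else eta^-1 *: mpoly.mderiv j p.
have msC (a : R) : (mpoly.msize (mpoly.mpolyC n a) <= 1)%N.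
  by rewrite mpoly.msizeC; case: (a != 0).
have dA j : (mpoly.msize (A j) <= face_exp D s j)%N.
  rewrite /A /face_exp; case: (s j) => [b|]; first exact: msC.
  by apply: msizeZ_leq; apply: msize_mderiv; apply: msize_pgrad2.
have dC j : (mpoly.msize (C j) <= face_exp D s j)%N.
  rewrite /C /face_exp; case: (s j) => [b|]; first by rewrite mpoly.msize0.
  apply: msizeZ_leq; rewrite (leq_trans (msize_mderiv j degp))// /pexp; lia.
have [|c c0 cP] := elimination (face_exp_gt0 D4 s) dA dC i (L := L).
  by apply: leq_trans hL; rewrite leq_mul// prod_face_exp_le.
have Kg := prod_face_exp_gexp D4 n0 ms.
have [c' [c'0 c'k c'E]] := bip_pad (leq_trans Kg (leq_subr 2 _)) c0.
exists c'; split=> // [k j gk|x l fx cx]; first by apply: c'k; apply: leq_ltn_trans gk.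
rewrite c'E; apply: cP => j; rewrite /A /C /face_exp.
have := fx j; have := cx j; case: (s j) => [b _ ->|/(_ erefl) + _].
  by rewrite pevalC peval0 mulr0 addr0 expr1.
rewrite mderiv_pertE !(pevalD, pevalB, pevalN, pevalZ, pevalXn, peval_var) => h.
apply: (mulfI eta0); move: h; set u := peval _ x; set v := peval _ x.
have -> : eta * (- eta^-1 * u + l * (eta^-1 * v)) = (l * v - u) * (eta * eta^-1) by ring.
rewrite mulfV//; lra.
Qed.

Lemma mderiv_neq0 : exists k, mpoly.mderiv k p != 0.
Proof.
apply: contrapT => nex; move/eqP: p_neq0; apply.
have pc : p = mpoly.mpolyC n (mpoly.mcoeff (@mpoly.mnm0 n) p).
  apply: mderiv_all0 => i; apply/eqP; apply: contrapT => /negP h; apply: nex.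
  by exists i.
by move: p_z; rewrite pc pevalC => ->; rewrite mpoly.mpolyC0.
Qed.

Definition mode_param (s : face n) (l : R) (x : 'rV[R]_n) : R :=
  if value_mode s then peval p x else l.

Let E := gexp n D.

Definition face_rel (L : nat) (c : 'M[R]_(E.+1, L.+1)) (s : face n) (i : 'I_n) (eta : R) :=
  [/\ \sum_k \sum_j c k j ^+ 2 = 1,
    ~~ value_mode s -> forall (k : 'I_E.+1) j, (E - 2 < k)%N -> c k j = 0 &
    forall x l, on_face s x ->
      (forall j, s j = None -> peval (mpoly.mderiv j (pert p D l eta)) x = 0) ->
      bip c (x 0 i) (mode_param s l x) = 0].

(** One [L] serves all [eta], faces and coordinates, so that all coefficient matrices lie in a
    single compact set. *)
Lemma face_rel_exists : exists L : nat, exists2 eta1 : R, 0 < eta1 &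
  forall eta, 0 < eta < eta1 -> forall s i, exists c, @face_rel L c s i eta.
Proof.
pose L := ((pexp D ^ n) * (pexp D ^ n) + 3 * D * E.+1)%N; exists L.
have [eta1 eta10 free] : exists2 eta1 : R, 0 < eta1 & forall eta (i : 'I_n),
    0 < eta < eta1 -> (n <= 2)%N ->
    exists2 c : 'M[R]_(E.+1, L.+1), c != 0 & forall x l,
      (forall k, peval (mpoly.mderiv k (pert p D l eta)) x = 0) ->
        bip c (x 0 i) (peval p x) = 0.
  have [n2|n2] := leqP n 2; last by exists 1 => // eta i _.
  have [eta1 eta10 h] := free_relation D4 degp mderiv_neq0 n2.
  by exists eta1 => // eta i hi _; apply: h => //; rewrite /L leq_addl.
exists eta1 => // eta eta_in s i; rewrite /face_rel /mode_param.
have [ms|ms] := boolP (value_mode s).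
  have /andP[n2 /forallP sN] := ms.
  have [c c0 cP] := free eta i eta_in n2.
  have [a a0 aE] := bip_normalize c0.
  exists (a *: c); split=> // x l _ cr; rewrite bipZ (cP x l) ?mulr0// => k.
  by apply: cr; apply/eqP.
have [||//|c [c0 ck cP]] := @bound_relation s eta L i.
- by case/andP: eta_in => /gt_eqF ->.
- by rewrite /L leq_addr.
have [a a0 aE] := bip_normalize c0.
exists (a *: c); split=> // [_ k j Ek|x l fx cr]; first by rewrite mxE ck ?mulr0.
by rewrite bipZ (cP _ _ fx cr) mulr0.
Qed.

(** Along one ultrafilter with [eta -> 0] the coefficients for all faces and coordinates converge at
    once, and their limits do not depend on [l]. For a given [l] the perturbed minimizers converge
    along the same ultrafilter, and finiteness keeps them on a single face; only this face and the
    limit point vary with [l]. *)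
Lemma algebraic_minimizer : exists (L : nat) (l0 : R)
  (c : face n -> 'I_n -> 'M[R]_(E.+1, L.+1)), [/\ 0 < l0,
    forall s i, c s i != 0,
    forall s i (k : 'I_E.+1) j, ~~ value_mode s -> (E - 2 < k)%N -> c s i k j = 0 &
    forall l, 0 < l < l0 -> exists s, exists2 x, minimizer (lagr p l) x &
      forall i, bip (c s i) (x 0 i) (mode_param s l x) = 0].
Proof.
have [L [eta1 eta10 rel]] := face_rel_exists.
have [l0 [eta2 [l00 eta20 below]]] := minimizer_below.
pose et (k : nat) : R := Num.min eta1 eta2 / 2 * harmonic k.
have m0 : 0 < Num.min eta1 eta2 by rewrite lt_min eta10.
have et_in k : 0 < et k < Num.min eta1 eta2.
  rewrite /et; have h0 : (0 : R) < harmonic k by rewrite /= invr_gt0.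
  have h1 : harmonic k <= (1 : R) by rewrite /= invf_le1// ler1n.
  move: m0 h0 h1; move: (Num.min _ _) (harmonic k) => a b a0 b0 b1.
  by apply/andP; split; nra.
have et1 k : 0 < et k < eta1.
  by have /andP[-> /lt_le_trans ->] := et_in k; rewrite // ge_min lexx.
have et2 k : 0 < et k < eta2.
  by have /andP[-> /lt_le_trans ->] := et_in k; rewrite // ge_min lexx orbT.
have [U [uU ooU]] := ultraFilterLemma (eventually_filter).
have pU := @ultra_proper _ _ uU.
have et_cvg : et @ U --> (0 : R).
  have h : et @ \oo --> (0 : R).
    rewrite -[X in _ --> X](mulr0 (Num.min eta1 eta2 / 2)).
    by apply: cvgM; [exact: cvg_cst|exact: cvg_harmonic].
  by move=> A /h; apply: ooU.
have /choice[c cP] : forall ks : nat * (face n * 'I_n), exists c,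
    @face_rel L c ks.2.1 ks.2.2 (et ks.1).
  by move=> [k [s i]]; apply: rel.
have entry ks k j : `[-1, 1]%classic (c ks k j).
  have [c1 _ _] := cP ks; rewrite /= in_itv /= -ler_norml -(@expr_le1 _ 2)// -normrX.
  rewrite ger0_norm ?sqr_ge0// -c1 (bigD1 k)//= (bigD1 j)//= -addrA lerDl addr_ge0// sumr_ge0// => *.
    exact: sqr_ge0.
  by apply: sumr_ge0 => *; apply: sqr_ge0.
have /choice[cl clP] : forall si : face n * 'I_n, exists cl : 'M[R]_(E.+1, L.+1),
    forall k j, (fun a => c (a, si) k j) @ U --> cl k j.
  move=> si; have /choice[g gP] : forall kj : 'I_E.+1 * 'I_L.+1, exists y : R,
      (fun a => c (a, si) kj.1 kj.2) @ U --> y.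
    move=> kj; have [y _ yP] := ultra_compact_cvg uU (@segment_compact R (-1) 1)
      (fun a => entry (a, si) kj.1 kj.2).
    by exists y.
  by exists (\matrix_(k, j) g (k, j)) => k j; rewrite mxE; apply: (gP (k, j)).
exists L, l0, (fun s i => cl (s, i)); split=> //.
- move=> s i; apply/eqP => cl0.
  have h : (fun a => \sum_k \sum_j c (a, (s, i)) k j ^+ 2) @ U -->
      \sum_k \sum_j (cl (s, i) k j ^+ 2 : R).
    apply: cvg_big => [|k _]; first exact: add_continuous.
    apply: cvg_big => [|j _]; first exact: add_continuous.
    by apply: (cvg_comp _ (fun z : R => z ^+ 2) (clP (s, i) k j)); apply: exprn_continuous.
  have h1 : (fun a => \sum_k \sum_j c (a, (s, i)) k j ^+ 2) @ U --> (1 : R).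
    by apply: cvg_near_cst; apply: nearW => a; case: (cP (a, (s, i))).
  have hu : \sum_k \sum_j (cl (s, i) k j ^+ 2 : R) = 1.
    by apply: (cvg_unique (@Rhausdorff R) h); apply: h1.
  move: hu.
  rewrite cl0 big1 => [/esym/eqP|k _]; first by rewrite oner_eq0.
  by rewrite big1// => j _; rewrite mxE expr0n.
- move=> s i k j ms Ek.
  apply: (cvg_unique (@Rhausdorff R) (clP (s, i) k j)).
  by apply: cvg_near_cst; apply: nearW => a; case: (cP (a, (s, i))) => _ /(_ ms) ->.
- move=> l lin.
  have /choice[x xP] : forall k, exists x, minimizer (pert p D l (et k)) x.
    by move=> k; apply: minimizer_exists.
  have xb k : peval p (x k) < tau := below _ _ _ lin (et2 k) (xP k).
  have /choice[s sP] : forall k, exists s, on_face s (x k).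
    by move=> k; apply: on_face_exists; case: (xP k) => -[].
  have [s0 Us0] := ultra_pigeonhole s uU.
  have [x0 Sx0 x0P] := ultra_compact_cvg uU sublevel_compact (fun k => (xP k).1).
  have pc (q : realpoly R n) : (fun k => peval q (x k)) @ U --> peval q x0.
    by apply: (cvg_comp x (peval q) x0P); apply: peval_continuous.
  exists s0; exists x0.
    split=> // y Sy; rewrite !(pevalB, pevalZ).
    have hx : (fun k => peval (pert p D l (et k)) (x k)) @ U -->
        peval (pgrad2 p) x0 - l * peval p x0 + 0 * peval (powsum R n D) x0.
      under [X in X @ U]eq_fun do rewrite peval_pert.
      apply: cvgD; last by apply: cvgM.
      by apply: cvgB => //; apply: cvgM => //; apply: cvg_cst.
    have hy : (fun k => peval (pert p D l (et k)) y) @ U -->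
        peval (pgrad2 p) y - l * peval p y + 0 * peval (powsum R n D) y.
      under [X in X @ U]eq_fun do rewrite peval_pert.
      by apply: cvgD; [exact: cvg_cst|apply: cvgM => //; exact: cvg_cst].
    rewrite !mul0r !addr0 in hx hy; apply: (ler_cvg_to hx hy).
    by apply: nearW => k; apply: (xP k).2.
  move=> i.
  have h : (fun k => bip (c (k, (s0, i))) (x k 0 i) (mode_param s0 l (x k))) @ U -->
      bip (cl (s0, i)) (x0 0 i) (mode_param s0 l x0).
    apply: bip_cvg; first exact: clP.
      by apply: (cvg_comp x (fun y : 'rV[R]_n => y 0 i) x0P); apply: coord_continuous.
    by rewrite /mode_param; case: ifP => _; [exact: pc|exact: cvg_cst].
  apply: (cvg_unique (@Rhausdorff R) h); apply: cvg_near_cst.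
  near=> k; have sk : s k = s0 by near: k.
  have [_ _ ck] := cP (k, (s0, i)); apply: ck; first by rewrite -sk; apply: sP.
  move=> j sj; apply: (minimizer_critical (xP k) (xb k) (sP k)).
  by rewrite sk.
Unshelve. all: by end_near. Qed.

End AlgMin.

(** * The gradient inequality and the local distance inequality *)

Lemma rootn_exists (R : realType) (k : nat) (v : R) : (0 < k)%N -> 0 <= v ->
  exists2 u : R, 0 <= u & u ^+ k = v.
Proof.
move=> k0 v0; exists (v `^ (k%:R^-1)); first exact: powR_ge0.
by rewrite -powR_mulrn ?powR_ge0// -powRrM mulVf ?powRr1// pnatr_eq0 -lt0n.
Qed.

Lemma sum_pow_le (R : realType) (n k : nat) (a : 'I_n -> R) (M : R) :
  (0 < k)%N -> 0 <= M -> (forall i, 0 <= a i) -> (forall i, a i ^+ k <= M) ->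
  (\sum_i a i) ^+ k <= n%:R ^+ k * M.
Proof.
move=> k0 M0 a0 aM; have [u u0 uE] := rootn_exists k0 M0.
have au i : a i <= u by rewrite -(@ler_pXn2r _ k)// ?nnegrE// uE.
rewrite -uE -exprMn lerXn2r ?nnegrE ?sumr_ge0 ?mulr_ge0//.
rewrite -[X in X%:R * _]card_ord -sumr_const mulr_suml; apply: ler_sum => i _.
by rewrite mul1r.
Qed.

(** * The curve of minimizers and the growth of [p] along it *)

Section MinimizerCurve.
Variables (R : realType) (n : nat) (p : realpoly R n) (B tau : R) (z : 'rV[R]_n).
Hypothesis p_ge0 : forall x, 0 <= peval p x.
Hypothesis cube_z : cube B z.
Hypothesis p_z : peval p z = 0.
Hypothesis tau_gt0 : 0 < tau.
Hypothesis crit : forall x, cube B x -> 0 < peval p x <= tau -> 0 < peval (pgrad2 p) x.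
Variables (x : R -> 'rV[R]_n) (l1 : R).
Hypothesis l1_gt0 : 0 < l1.
Hypothesis x_regular : regular_curve x l1.
Hypothesis x_min : forall l, 0 < l < l1 -> minimizer p B tau (lagr p l) (x l).

Let t l := peval p (x l).

Lemma curve_cube l : 0 < l < l1 -> cube B (x l) /\ t l <= tau.
Proof. by move=> /x_min[]. Qed.

(** The competitor is [z], at which the objective is 0. *)
Lemma curve_grad l : 0 < l < l1 -> peval (pgrad2 p) (x l) <= l * t l.
Proof.
move=> /x_min[_ xmin]; have := xmin z (sublevel_z cube_z p_z tau_gt0).
rewrite !(pevalB, pevalZ) p_z (pgrad2_z p_ge0 p_z) /t; lra.
Qed.

(** Adding the minimality of [x a] against [x b] and of [x b] against [x a] leaves
    [(b - a) (t b - t a) >= 0]. *)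
Lemma curve_value_mono a b : 0 < a -> a <= b -> b < l1 -> t a <= t b.
Proof.
move=> a0; rewrite le_eqVlt => /predU1P[->//|ab] bl.
have [Sa mina] := x_min (introT andP (conj a0 (lt_trans ab bl))).
have [Sb minb] := x_min (introT andP (conj (lt_trans a0 ab) bl)).
have := mina _ Sb; have := minb _ Sa; rewrite !(pevalB, pevalZ) -/(t a) -/(t b).
by move: ab; nra.
Qed.

(** If [t] stayed above [e], the curve would remain in the compact set [e <= p <= tau], where the
    gradient is bounded below, against [curve_grad] for small [l]. *)
Lemma curve_value_lim (e : R) : 0 < e -> exists2 d, 0 < d & forall l, 0 < l < d -> t l < e.
Proof.
move=> e0; apply: contrapT => nex.
have te l : 0 < l < l1 -> e <= t l.
  move=> /andP[l0 ll1]; rewrite leNgt; apply/negP => tl; apply: nex.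
  exists l => // s /andP[s0 sl]; apply: le_lt_trans tl.
  by apply: curve_value_mono => //; apply: ltW.
pose T := cube B `&` ([set y | peval p y <= tau] `&` [set y | peval (- p) y <= - e]).
have cT : compact T.
  apply: (@closed_cube_compact R n B) => [|y []//].
  by apply: closedI; [exact: closed_cube|apply: closedI; exact: closed_peval_le].
have Tx l : 0 < l < l1 -> T (x l).
  move=> hl; have [cl tl] := curve_cube hl; split=> //; split=> //=.
  by rewrite pevalN lerN2; apply: te.
have h2 : 0 < l1 / 2 < l1 by rewrite divr_gt0//= ltr_pdivrMr// ltr_pMr// ltr1n.
have [||y yT ymin] := @EVT_min_rV R n (peval (pgrad2 p)) T _ cT.
- by exists (x (l1 / 2)); apply: Tx.
- by apply: continuous_subspaceT; apply: peval_continuous.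
have [cy [yt /=]] := set_mem yT; rewrite pevalN lerN2 => ye.
have y0 := crit cy (introT andP (conj (lt_le_trans e0 ye) yt)).
pose l := Num.min (l1 / 2) (peval (pgrad2 p) y / (2 * tau)).
have l0 : 0 < l by rewrite lt_min (andP h2).1 divr_gt0// mulr_gt0.
have ll1 : 0 < l < l1 by rewrite l0 (le_lt_trans _ (andP h2).2)// ge_min lexx.
have := ymin _ (mem_set (Tx l ll1)); apply/negP; rewrite -ltNge.
apply: le_lt_trans (curve_grad ll1) _.
have [_ tl] := curve_cube ll1.
apply: le_lt_trans (_ : l * tau < _); first by rewrite ler_pM2l.
have : l <= peval (pgrad2 p) y / (2 * tau) by rewrite ge_min lexx orbT.
rewrite ler_pdivlMr ?mulr_gt0// => h; lra.
Qed.

Lemma curve_limit : exists x0 : 'rV[R]_n,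
  (forall i (e : R), 0 < e -> exists2 d : R, 0 < d &
     forall s, 0 < s < d -> `|x s 0 i - x0 0 i| < e) /\
  (forall a b, 0 < a -> a <= b -> b < l1 -> dist1 (x a) (x b) <= dist1 x0 (x b)).
Proof.
have /choice[L LP] : forall i, exists L : R,
    (forall e : R, 0 < e -> exists2 d : R, 0 < d <= l1 &
      forall s, 0 < s < d -> `|x s 0 i - L| < e) /\
    (forall a b, 0 < a -> a <= b -> b < l1 -> `|x b 0 i - x a 0 i| <= `|x b 0 i - L|).
  move=> i; apply: (@mono_limit R (fun s => x s 0 i) l1 B) => //.
    by case: (x_regular i).
  by move=> s /curve_cube[].
exists (\row_i L i); split=> [i e e0|a b a0 ab bl].
  have [d /andP[d0 _] dP] := (LP i).1 e e0.
  by exists d => // s hs; rewrite mxE; apply: dP.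
by apply: ler_sum => i _; rewrite mxE; apply: (LP i).2.
Qed.

(** Up to [b] the gradient on the curve is at most [M], the square root of [b * t b]. Hence
    [t b <= M * length], and squaring leaves one factor [t b] to cancel. *)
Lemma curve_value_le (x0 : 'rV[R]_n) b :
  (forall a b, 0 < a -> a <= b -> b < l1 -> dist1 (x a) (x b) <= dist1 x0 (x b)) ->
  0 < b < l1 -> t b <= b * dist1 x0 (x b) ^+ 2.
Proof.
move=> x0P /andP[b0 bl]; have tb0 : 0 <= t b by apply: p_ge0.
pose M := Num.sqrt (b * t b).
have M0 : 0 <= M by apply: sqrtr_ge0.
have [C C0 taylor] := peval_taylor1 B p.
have key a : 0 < a -> a <= b -> t b - t a <= M * dist1 x0 (x b).
  move=> a0 ab; apply: (@le_trans _ _ (M * dist1 (x a) (x b))); last first.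
    by apply: ler_wpM2l => //; apply: x0P.
  apply: (curve_increment (F := t) (C := C) x_regular) => // u w au uw wb.
  have u0 : 0 < u := lt_le_trans a0 au.
  have ul : 0 < u < l1 by rewrite u0 (le_lt_trans (le_trans uw wb) bl).
  have wl : 0 < w < l1 by rewrite (lt_le_trans u0 uw) (le_lt_trans wb bl).
  have [cu _] := curve_cube ul; have [cw _] := curve_cube wl.
  have := taylor _ _ cu cw; rewrite ler_norml => /andP[_].
  have : `|pdiff p (x u) (x w)| <= M * dist1 (x u) (x w).
    apply: pdiff_bound => i; apply: le_trans (mderiv_le_grad _ _ _) _.
    rewrite ler_wsqrtr// (le_trans (curve_grad ul))//.
    apply: ler_pM; [exact: ltW|exact: p_ge0|exact: le_trans uw wb|].
    exact: curve_value_mono (le_trans uw wb) bl.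
  by move=> /(le_trans (ler_norm _)); rewrite -/(t u) -/(t w); lra.
have tM : t b <= M * dist1 x0 (x b).
  apply/ler_addgt0Pr => e e0.
  have [d d0 dP] := curve_value_lim e0.
  pose a := Num.min b (d / 2).
  have a0 : 0 < a by rewrite lt_min b0 divr_gt0.
  have ab : a <= b by rewrite ge_min lexx.
  have ad : a < d by rewrite (@le_lt_trans _ _ (d / 2))//; [rewrite ge_min lexx orbT|lra].
  have := key a a0 ab; have := dP a (introT andP (conj a0 ad)); lra.
have [->|tn0] := eqVneq (t b) 0; first by rewrite mulr_ge0 ?sqr_ge0// ltW.
have tb : 0 < t b by rewrite lt_neqAle eq_sym tn0.
rewrite -(ler_pM2l tb) -expr2.
have -> : t b * (b * dist1 x0 (x b) ^+ 2) = (M * dist1 x0 (x b)) ^+ 2.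
  by rewrite exprMn sqr_sqrtr ?mulr_ge0 ?(ltW b0)//; ring.
by rewrite lerXn2r ?nnegrE// mulr_ge0// dist1_ge0.
Qed.

End MinimizerCurve.

(** This fixes the face: among finitely many alternatives with constant germs, one must hold for all
    small [l]. *)
Lemma eventually_exists (R : realType) (T : finType) (P : T -> R -> Prop) (l0 : R) :
  0 < l0 ->
  (forall s, exists2 d, 0 < d &
    (forall l, 0 < l < d -> P s l) \/ (forall l, 0 < l < d -> ~ P s l)) ->
  (forall l, 0 < l < l0 -> exists s, P s l) ->
  exists s, exists2 d, 0 < d & forall l, 0 < l < d -> P s l.
Proof.
move=> l00 germ ex; apply: contrapT => nex.
have [d d0 dP] : exists2 d, 0 < d & forall s, s \in enum T -> forall l, 0 < l < d -> ~ P s l.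
  elim: (enum T) => [|s r [d d0 dP]]; first by exists 1.
  have [d' d'0 [d'P|d'P]] := germ s; first by case: nex; exists s, d'.
  exists (Num.min d d') => [|u]; first by rewrite lt_min d0.
  rewrite inE => /predU1P[->|ur] l; rewrite lt_min => /and3P[l0' ld ld'].
    by apply: d'P; rewrite l0' ld'.
  by apply: (dP u ur); rewrite l0' ld.
pose l := Num.min l0 d / 2.
have m0 : 0 < Num.min l0 d by rewrite lt_min l00.
have l0' : 0 < l by rewrite divr_gt0.
have : l < Num.min l0 d by rewrite ltr_pdivrMr// ltr_pMr// ltr1n.
rewrite lt_min => /andP[ll0 ld]; have [s Ps] := ex l (introT andP (conj l0' ll0)).
by apply: (dP s _ l) Ps; rewrite ?mem_enum ?l0'.
Qed.

Lemma gexp_ge4 (n D : nat) : (4 <= D)%N -> (4 <= gexp n D)%N.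
Proof.
by move=> D4; rewrite /gexp -[X in (X <= _)%N]muln1 leq_mul// expn_gt0; lia.
Qed.

Section GradientInequality.
Variables (R : realType) (n : nat) (p : realpoly R n) (D : nat) (B : R) (z : 'rV[R]_n).
Hypothesis n0 : (0 < n)%N.
Hypothesis p_ge0 : forall x, 0 <= peval p x.
Hypothesis degp : (mpoly.msize p <= D.+1)%N.
Hypothesis D4 : (4 <= D)%N.
Hypothesis cube_z : cube B z.
Hypothesis p_z : peval p z = 0.

Let E := gexp n D.

Lemma dfn_minimizer (tau : R) :
  dfn (fun v => minimizer p B tau (lagr p (v 0%N)) (blk n 0 v)).
Proof.
have dS k : dfn (fun v => sublevel p B tau (blk n k v)).
  apply: dfn_and; first exact: dfn_cube.
  by apply: dfn_le; [exact: dterm_peval|exact: dterm_const].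
have dW k : dterm (fun v : nat -> R => peval (lagr p (v 0%N)) (blk n k v)).
  under [X in dterm X]eq_fun do rewrite pevalB pevalZ.
  apply: dterm_sub; first exact: dterm_peval.
  by apply: dterm_mul; [exact: dterm_var|exact: dterm_peval].
apply: dfn_and => //; apply: (dfn_allb (k := 1)) => [v x|]; first by rewrite blk_updb_neq.
by apply: dfn_imp => //; apply: dfn_le.
Qed.

Lemma minimizer_curve (tau : R) : 0 < tau -> p != 0 ->
  (forall x, cube B x -> 0 < peval p x <= tau -> 0 < peval (pgrad2 p) x) ->
  exists (L : nat) (s : face n) (c : 'I_n -> 'M[R]_(E.+1, L.+1)) (l1 : R) (x : R -> 'rV[R]_n),
  [/\ 0 < l1, regular_curve x l1, forall i, c i != 0,
    ~~ value_mode s -> forall i (k : 'I_E.+1) j, (E - 2 < k)%N -> c i k j = 0 &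
    forall l, 0 < l < l1 -> minimizer p B tau (lagr p l) (x l) /\
      forall i, bip (c i) (x l 0 i) (mode_param p s l (x l)) = 0].
Proof.
move=> tau0 pn0 crit.
have [L [l0 [c [l00 c0 ck cP]]]] :=
  algebraic_minimizer n0 p_ge0 degp D4 pn0 cube_z p_z tau0 crit.
pose A s l (x : 'rV[R]_n) := minimizer p B tau (lagr p l) x /\
  forall i, bip (c s i) (x 0 i) (mode_param p s l x) = 0.
have dA s : dfn (fun v => A s (v 0%N) (blk n 0 v)).
  apply: dfn_and; first exact: dfn_minimizer.
  apply: dfn_allord => i; apply: dfn_eq; last exact: dterm_const.
  apply: dterm_sum => k; apply: dterm_sum => j; apply: dterm_mul.
    by apply: dterm_mul; [exact: dterm_const|apply: dterm_exp; exact: dterm_blk].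
  apply: dterm_exp; rewrite /mode_param; case: (value_mode s); first exact: dterm_peval.
  exact: dterm_var.
have [s [d d0 sP]] : exists s, exists2 d, 0 < d & forall l, 0 < l < d -> exists x, A s l x.
  apply: (eventually_exists l00) => [s|l hl]; last first.
    by have [s [x xm xb]] := cP l hl; exists s, x.
  have [|d [d0 dP]] := @dfn_germ R (fun l => exists x, A s l x); last by exists d.
  apply: (dfn_exb (n := n) (k := 0) (P := fun v x => A s (v 0%N) x)) => [v x|//].
  by [].
have [|l1 [x [/andP[l10 _] xr xA]]] := @curve_selection R n (A s) B d d0.
  split=> // [l hl|l hl x [[[]]]//].
  have cM : closed (\bigcap_(y in sublevel p B tau)
      [set x | peval (lagr p l) x <= peval (lagr p l) y]).
    by apply: closed_bigI => y _; apply: closed_peval_le.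
  have cR : closed (\bigcap_(i in [set: 'I_n])
      [set x : 'rV[R]_n | bip (c s i) (x 0 i) (mode_param p s l x) = 0]).
    apply: closed_bigI => i _.
    apply: (closed_comp (f := fun x : 'rV[R]_n => bip (c s i) (x 0 i) (mode_param p s l x))
      (D := [set 0])); last exact: closed_eq.
    move=> y _; have FF : Filter (nbhs y) := nbhs_filter y.
    apply: (@bip_cvg R _ (nbhs y) FF) => [k j||]; [exact: cvg_cst|exact: coord_continuous|].
    by rewrite /mode_param; case: (value_mode s); [exact: peval_continuous|exact: cvg_cst].
  have := closedI (closedI (closedI (@closed_cube R n B) (@closed_peval_le R n p tau)) cM) cR.
  by congr closed; apply/seteqP; split=> y [[[h1 h2] h3] h4]; split=> // i; [apply: h4|move=> _; apply: h4].
exists L, s, (c s), l1, x; split=> // ms i k j; exact: ck.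
Qed.


Lemma curve_value_power (tau : R) : 0 < tau -> p != 0 ->
  (forall x, cube B x -> 0 < peval p x <= tau -> 0 < peval (pgrad2 p) x) ->
  exists (C d : R) (x : R -> 'rV[R]_n), [/\ 0 < C, 0 < d &
    forall l, 0 < l < d -> minimizer p B tau (lagr p l) (x l) /\
      peval p (x l) ^+ (E - 2) <= C * l ^+ E].
Proof.
move=> tau0 pn0 crit; have E4 := gexp_ge4 n D4.
have [L [s [c [l1 [x [l10 xr c0 ck xP]]]]]] := minimizer_curve tau0 pn0 crit.
have xm l : 0 < l < l1 -> minimizer p B tau (lagr p l) (x l) by case/xP.
have [x0 [xlim xdist]] := curve_limit l10 xr xm.
have tle l (hl : 0 < l < l1) := curve_value_le p_ge0 cube_z p_z tau0 crit l10 xr xm xdist hl.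
have tmono := curve_value_mono xm.
(* Once [p] vanishes at [x l2], it vanishes on the whole earlier part of the curve by
   monotonicity. *)
have [[l2 /andP[l20 l21] tl2]|pos] := pselect (exists2 l2, 0 < l2 < l1 & peval p (x l2) = 0).
  exists 1, l2, x; split=> // l /andP[l0 ll2].
  have hl : 0 < l < l1 by rewrite l0 (lt_trans ll2).
  split; first exact: xm.
  have -> : peval p (x l) = 0.
    by apply/eqP; rewrite eq_le p_ge0 andbT -tl2; apply: tmono => //; apply: ltW.
  by rewrite expr0n subn_eq0 leqNgt (leq_trans _ E4)// mul1r exprn_ge0// ltW.
have tpos l : 0 < l < l1 -> 0 < peval p (x l).
  move=> hl; rewrite lt_neqAle p_ge0 andbT eq_sym; apply/eqP => h.
  by apply: pos; exists l.
pose k0 := if value_mode s then E else (E - 2)%N.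
have k00 : (0 < k0)%N by rewrite /k0; case: ifP => _; lia.
pose par l := mode_param p s l (x l).
have /choice[C CP] : forall i, exists C : R, 0 < C /\ exists2 d, 0 < d <= l1 &
    forall l, 0 < l < d -> `|x l 0 i - x0 0 i| ^+ k0 <= C * par l.
  move=> i; have [||||C [d [C0 d0 CP]]] := @algebraic_holder R E L (c i) k0
      (fun l => x l 0 i) par (x0 0 i) l1 l10 (c0 i) _ (xlim i).
  - move=> k j; rewrite /k0; case: ifPn => [_|ms]; last exact: ck.
    by rewrite ltnNge -ltnS ltn_ord.
  - rewrite /par /mode_param; case: (value_mode s) => e e0; last by exists e => // l /andP[].
    have [d d0 dP] := curve_value_lim p_ge0 cube_z p_z tau0 crit l10 xm e0.
    by exists d.
  - by move=> l hl; rewrite /par /mode_param; case: (value_mode s); [exact: tpos|case/andP: hl].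
  - by move=> l /xP[_]; apply.
  exists C; split=> //; exists (Num.min d l1) => [|l]; first by rewrite lt_min d0 l10 ge_min lexx orbT.
  by rewrite lt_min => /and3P[h1 h2 _]; apply: CP; rewrite h1.
have [d /andP[d0 dl1] dP] : exists2 d, 0 < d <= l1 & forall i, forall l, 0 < l < d ->
    `|x l 0 i - x0 0 i| ^+ k0 <= C i * par l.
  apply: (eventually_all l10) => [i a b /andP[b0 ba] h l /andP[h1 h2]|i].
    by apply: h; rewrite h1 (lt_le_trans h2).
  by case: (CP i).
pose K := n%:R ^+ k0 * \sum_i C i.
have K0 : 0 <= K.
  by rewrite mulr_ge0 ?exprn_ge0// sumr_ge0// => i _; apply: ltW; case: (CP i).
exists (K ^+ 2 + 1), d, x; split=> //; first by rewrite ltr_wpDl ?sqr_ge0.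
move=> l /andP[l0 ld]; have hl : 0 < l < l1 by rewrite l0 (lt_le_trans ld).
split; first exact: xm.
have par0 : 0 < par l.
  by rewrite /par /mode_param; case: ifP => _; [exact: tpos|].
have len : dist1 x0 (x l) ^+ k0 <= K * par l.
  rewrite /K -mulrA; apply: sum_pow_le => // [|i].
    by rewrite mulr_ge0 ?(ltW par0)// sumr_ge0// => i _; apply: ltW; case: (CP i).
  apply: le_trans (dP i l _) _; first by rewrite l0.
  rewrite ler_wpM2r ?(ltW par0)// (bigD1 i)//= lerDl sumr_ge0// => j _.
  by apply: ltW; case: (CP j).
have len0 := dist1_ge0 x0 (x l).
have t0 := tpos l hl.
(* Insert the length bound [len] into [t <= l s^2]. If [par l = l] and [k0 = E - 2], the square
   supplies the missing [l ^+ 2]; in value mode [par l] is [t], [k0 = E], and [t ^+ 2] cancels. *)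
have tk : peval p (x l) ^+ k0 <= l ^+ k0 * (K * par l) ^+ 2.
  apply: (@le_trans _ _ ((l * dist1 x0 (x l) ^+ 2) ^+ k0)).
    by rewrite lerXn2r ?nnegrE ?mulr_ge0 ?sqr_ge0 ?(ltW l0) ?(ltW t0)// tle.
  rewrite exprMn exprAC ler_wpM2l ?exprn_ge0 ?(ltW l0)//.
  by rewrite lerXn2r ?nnegrE ?exprn_ge0// mulr_ge0// ltW.
suff : peval p (x l) ^+ (E - 2) <= K ^+ 2 * l ^+ E.
  by move=> /le_trans; apply; rewrite ler_wpM2r ?exprn_ge0 ?lerDl// ltW.
have EE : E = (E - 2 + 2)%N by rewrite subnK// (leq_trans _ E4).
move: tk; rewrite /k0 /par /mode_param; case: ifP => _ tk; last first.
  by apply: le_trans tk _; rewrite exprMn [X in _ <= _ * _ ^+ X]EE exprD; rewrite mulrCA.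
rewrite -(ler_pM2r (exprn_gt0 2 t0)) -exprD -EE (le_trans tk)// exprMn.
by rewrite mulrA [l ^+ E * _]mulrC.
Qed.

(** For a given [y] put [q = p(y) / 2] and choose [l] with [C * l ^+ E = q ^+ (E - 2)], so that
    [p (x l) <= q]. Minimality of [x l] against [y] gives [|grad p(y)|^2 >= l q], whose [E]-th power
    is [q ^+ (2 * E - 2) / C]. *)
Lemma gradient_inequality : exists c tau : R, [/\ 0 < c, 0 < tau &
  forall y, cube B y -> peval p y <= tau ->
    c * peval p y ^+ (2 * E - 2) <= peval (pgrad2 p) y ^+ E].
Proof.
have E4 := gexp_ge4 n D4; have E0 : (0 < E)%N by rewrite (leq_trans _ E4).
have E22 : (2 * E - 2 == 0)%N = false.
  by rewrite subn_eq0 -[X in (_ <= X)%N]muln1 leq_pmul2l// leqNgt (leq_trans _ E4).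
have [p0|pn0] := eqVneq p 0.
  exists 1, 1; split=> // y _ _; rewrite {1}p0 peval0 expr0n E22.
  by rewrite mulr0 exprn_ge0// pgrad2_ge0.
have [tau tau0 crit] := critical_value_isolated p B.
have [C [d [x [C0 d0 xP]]]] := curve_value_power tau0 pn0 crit.
have Cd : 0 < C * d ^+ E by rewrite mulr_gt0// exprn_gt0.
(* The bounds [1] and [C * d ^+ E] ensure that the multiplier chosen for [y] is below [d]. *)
exists (C^-1 * 2^-1 ^+ (2 * E - 2)), (Num.min tau (Num.min 1 (C * d ^+ E))); split.
- by rewrite mulr_gt0 ?invr_gt0// exprn_gt0// invr_gt0.
- by rewrite !lt_min tau0 ltr01.
move=> y cy; rewrite !le_min => /and3P[ytau y1 yC].
have [py0|pyn0] := eqVneq (peval p y) 0.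
  rewrite py0 expr0n E22.
  by rewrite mulr0 exprn_ge0// pgrad2_ge0.
have py : 0 < peval p y by rewrite lt_neqAle eq_sym pyn0 p_ge0.
pose q := peval p y / 2.
have q0 : 0 < q by rewrite divr_gt0.
have q1 : q < 1 by rewrite /q; lra.
have [||l l0 lE] := @rootn_exists R E (q ^+ (E - 2) / C) => //.
  by rewrite divr_ge0 ?exprn_ge0// ltW.
have lE' : C * l ^+ E = q ^+ (E - 2) by rewrite lE mulrC divfK// gt_eqF.
have ln0 : 0 < l.
  rewrite lt_neqAle l0 andbT eq_sym; apply/eqP => l00; move: lE'.
  by rewrite l00 expr0n; case: (E) E0 => // ? _; rewrite mulr0 => /esym/eqP; rewrite gt_eqF ?exprn_gt0.
have ld : l < d.
  rewrite -(@ltr_pXn2r _ E)// ?nnegrE ?(ltW d0)// -(ltr_pM2l C0) lE'.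
  have qq : q ^+ (E - 2) <= q.
    have -> : (E - 2 = (E - 3).+1)%N by rewrite -subSn// ltnW.
    by rewrite exprS ler_piMr ?(ltW q0)// exprn_ile1// ltW.
  by rewrite (le_lt_trans qq)// (lt_le_trans _ yC)// /q ltr_pdivrMr// ltr_pMr// ltr1n.
have [[_ xmin] tl] := xP l (introT andP (conj ln0 ld)).
have {}tl : peval p (x l) <= q.
  have E20 : (0 < E - 2)%N by rewrite subn_gt0 (leq_trans _ E4).
  by rewrite -(@ler_pXn2r _ (E - 2))// ?nnegrE ?(ltW q0)// -lE'.
have := xmin y (conj cy ytau); rewrite !(pevalB, pevalZ) => hmin.
have hy : l * q <= peval (pgrad2 p) y.
  have h0 := pgrad2_ge0 p (x l).
  have h1 : l * peval p (x l) <= l * q by rewrite ler_pM2l.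
  have h2 : l * peval p y = l * q + l * q by rewrite /q -mulrDr; congr (_ * _); field.
  by move: hmin; rewrite h2; lra.
apply: le_trans (_ : (l * q) ^+ E <= _); last first.
  by rewrite lerXn2r ?nnegrE ?mulr_ge0 ?(ltW q0) ?pgrad2_ge0.
rewrite exprMn lE le_eqVlt; apply/orP; left; apply/eqP.
have -> : (2 * E - 2 = (E - 2) + E)%N.
  by rewrite mul2n -addnn addnBAC// (leq_trans _ E4).
by rewrite /q -mulrA -exprMn [2^-1 * _]mulrC exprD; ring.
Qed.

End GradientInequality.

Lemma exprD_superadd (R : realDomainType) (k : nat) (a b : R) :
  (0 < k)%N -> 0 <= a -> 0 <= b -> a ^+ k + b ^+ k <= (a + b) ^+ k.
Proof.
move=> + a0 b0; case: k => // k _; elim: k => [|k IH]; first by rewrite !expr1.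
rewrite [X in _ <= X]exprS; apply: (@le_trans _ _ ((a + b) * (a ^+ k.+1 + b ^+ k.+1))).
  have h : 0 <= a * b ^+ k.+1 + b * a ^+ k.+1 by rewrite addr_ge0// mulr_ge0// exprn_ge0.
  by rewrite [a ^+ k.+2]exprS [b ^+ k.+2]exprS; move: h; lra.
by rewrite ler_wpM2l// addr_ge0.
Qed.

(** Bernoulli's inequality for [1 - b / a], multiplied by [a ^+ k.+1]. *)
Lemma bernoulli_sub (R : realDomainType) (k : nat) (a b : R) :
  0 <= b -> b <= a -> a ^+ k * (a - k%:R * b) <= a * (a - b) ^+ k.
Proof.
move=> b0 ba; have a0 := le_trans b0 ba.
elim: k => [|k IH]; first by rewrite !expr0 mul0r subr0 mulrC.
rewrite [(a - b) ^+ _]exprS mulrCA.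
apply: (@le_trans _ _ ((a - b) * (a ^+ k * (a - k%:R * b)))); last first.
  by rewrite ler_wpM2l// subr_ge0.
have h : 0 <= a ^+ k * (k%:R * (b * b)) by rewrite !mulr_ge0// exprn_ge0.
by rewrite exprS -natr1; move: h; lra.
Qed.

Lemma root_dist_le (R : realDomainType) (k : nat) (u v : R) :
  (0 < k)%N -> 0 <= u -> 0 <= v -> `|u - v| ^+ k <= `|u ^+ k - v ^+ k|.
Proof.
move=> k0; wlog uv : u v / v <= u.
  move=> H u0 v0; have [vu|/ltW uv] := leP v u; first exact: H.
  by rewrite distrC [X in _ <= X]distrC; apply: H.
move=> u0 v0; have d0 : 0 <= u - v by rewrite subr_ge0.
rewrite ger0_norm// ger0_norm ?subr_ge0 ?lerXn2r ?nnegrE//.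
have := exprD_superadd k0 d0 v0; rewrite subrK; lra.
Qed.

(** * From the gradient inequality to the distance to the zero set *)

Section Descent.
Variables (R : realType) (n : nat) (p : realpoly R n) (E : nat) (c0 tau : R).
Hypothesis n0 : (0 < n)%N.
Hypothesis E0 : (0 < E)%N.
Hypothesis p_ge0 : forall x, 0 <= peval p x.
Hypothesis c0_gt0 : 0 < c0.
Hypothesis grad_ineq : forall y, cube 2 y -> peval p y <= tau ->
  c0 * peval p y ^+ (2 * E - 2) <= peval (pgrad2 p) y ^+ E.

Let phi (y : 'rV[R]_n) : R := peval p y `^ (E%:R^-1).

Lemma root_pow y : phi y ^+ E = peval p y.
Proof.
by rewrite /phi -powR_mulrn ?powR_ge0// -powRrM mulVf ?powRr1// pnatr_eq0 -lt0n.
Qed.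

Lemma root_continuous : continuous phi.
Proof.
move=> y; have FF : Filter (nbhs y) := nbhs_filter y.
apply/(@cvgrPdist_lt _ _ _ _ FF) => e e0.
have eE : 0 < e ^+ E by rewrite exprn_gt0.
have /(@cvgrPdist_lt _ _ _ _ FF)/(_ _ eE) := @peval_continuous R n p y.
apply: filterS => t; rewrite -!root_pow => h.
rewrite -(@ltr_pXn2r _ E)// ?nnegrE ?(ltW e0)//.
by rewrite (le_lt_trans _ h)// root_dist_le ?powR_ge0.
Qed.

(* The minimizer y of phi + k |x - .|, where phi is the E-th root of p, is a zero
   of p: otherwise a small step along - grad p would decrease the functional. *)
Lemma descent (k : R) : 0 < k -> (2 * E%:R * n%:R * k) ^+ (2 * E) < c0 ->
  forall x, cube 1 x -> peval p x < k ^+ E -> peval p x <= tau ->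
  exists2 z, peval p z = 0 & k ^+ E * dist1 x z ^+ E <= peval p x.
Proof.
move=> k0 kc x cx pk ptau.
have expE : (E.-1 * (2 * E) = E * (2 * E - 2))%N.
  have -> : (2 * E - 2 = 2 * E.-1)%N by rewrite -subn1 mulnBr muln1.
  by rewrite mulnCA [RHS]mulnCA [(E.-1 * _)%N]mulnC.
have x2 : cube 2 x by move=> i; rewrite (le_trans (cx i))// ler1n.
have [||y yC ymin] := @EVT_min_rV R n (fun y => phi y + k * dist1 x y) (cube 2) _
  (@closed_cube_compact R n 2 _ (@closed_cube R n 2) (fun _ h => h)).
- by exists x.
- apply: continuous_subspaceT => u.
  apply: (cvgD (f := phi) (g := fun y => k * dist1 x y) (@root_continuous u)).
  apply: cvgM; first exact: cvg_cst.
  rewrite /dist1; apply: (@continuous_bigsum R _ _ _ (fun i (y : 'rV[R]_n) => `|y 0 i - x 0 i|)).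
  move=> i v; have FF : Filter (nbhs v) := nbhs_filter v.
  apply: (@cvg_norm _ _ _ _ FF).
  exact: (@cvgB _ _ _ _ FF _ _ _ _ (@coord_continuous _ _ _ 0 i v) (@cvg_cst _ _ _ _ _)).
have {}yC : cube 2 y := set_mem yC.
have dist0 (u : 'rV[R]_n) : dist1 u u = 0 by rewrite /dist1 big1// => i _; rewrite subrr normr0.
have yx : phi y + k * dist1 x y <= phi x.
  by have := ymin x (mem_set x2); rewrite dist0 mulr0 addr0.
have phi0 u : 0 <= phi u by apply: powR_ge0.
have d0 := dist1_ge0 x y.
have kd0 : 0 <= k * dist1 x y by rewrite mulr_ge0// ltW.
have phixk : phi x < k by rewrite -(@ltr_pXn2r _ E)// ?nnegrE ?(ltW k0)// root_pow.
(* The minimizer thus lies in the cube of radius 2 with room left for a gradient step. *)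
have dxy : dist1 x y < 1.
  rewrite -(ltr_pM2l k0) mulr1; apply: le_lt_trans phixk; have := phi0 y; lra.
have [py0|pyn0] := eqVneq (peval p y) 0.
  exists y => //; rewrite -exprMn -root_pow lerXn2r ?nnegrE//; have := phi0 y; lra.
exfalso.
have py : 0 < peval p y by rewrite lt_neqAle eq_sym pyn0 p_ge0.
have pyx : peval p y <= peval p x by rewrite -!root_pow lerXn2r ?nnegrE//; lra.
have hGI := grad_ineq yC (le_trans pyx ptau).
set h := peval (pgrad2 p) y in hGI.
have h0 : 0 < h.
  rewrite lt_neqAle pgrad2_ge0 andbT eq_sym; apply/eqP => h00; move: hGI.
  rewrite h00 expr0n; case: (E) E0 => // e _; apply/negP; rewrite -ltNge.
  by rewrite mulr_gt0// exprn_gt0.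
pose a := phi y.
have a0 : 0 < a.
  rewrite lt_neqAle phi0 andbT eq_sym; apply/eqP => a00; move: pyn0.
  by rewrite -root_pow -/a a00 expr0n; case: (E) E0 => // e _; rewrite eqxx.
pose q := Num.sqrt h; have q0 : 0 < q by rewrite sqrtr_gt0.
have qh : q ^+ 2 = h by rewrite sqr_sqrtr// ltW.
have [C C0 taylor] := peval_taylor1 2 p.
pose N : R := n%:R; have N0 : 0 < N by rewrite ltr0n.
(* The three bounds keep [w] in the cube, give [b <= a] for the Bernoulli inequality, and make the
   quadratic Taylor error at most half of [s * h]. *)
pose s := Num.min ((1 - dist1 x y) / q) (Num.min (a / (k * N * q)) (1 / (2 * C * N ^+ 2 + 1))).
have den : 0 < 2 * C * N ^+ 2 + 1 by rewrite ltr_wpDl// !mulr_ge0// sqr_ge0.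
have s0 : 0 < s.
  by rewrite lt_min divr_gt0 ?subr_gt0//= lt_min !divr_gt0// !mulr_gt0.
have s1 : s * q <= 1 - dist1 x y by rewrite -ler_pdivlMr// ge_min lexx.
have s2 : s * (k * N * q) <= a.
  by rewrite -ler_pdivlMr ?mulr_gt0// ge_min ge_min lexx orbT.
have s3 : s * (2 * C * N ^+ 2 + 1) <= 1.
  by rewrite -ler_pdivlMr// ge_min ge_min lexx !orbT.
pose g i := peval (mpoly.mderiv i p) y.
have gq i : `|g i| <= q by apply: mderiv_le_grad.
clearbody s q.
pose w : 'rV[R]_n := \row_i (y 0 i - s * g i).
have wy i : w 0 i - y 0 i = - (s * g i) by rewrite mxE addrAC subrr add0r.
have cw : cube 2 w.
  move=> i; rewrite mxE; apply: le_trans (ler_normB _ _) _.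
  have h1 : `|s * g i| <= s * q by rewrite normrM (gtr0_norm s0) ler_wpM2l// ltW.
  have h2 : `|y 0 i - x 0 i| <= dist1 x y := dist1_coord x y i.
  have h3 : `|y 0 i| <= `|y 0 i - x 0 i| + `|x 0 i|.
    by rewrite -{1}[y 0 i](subrK (x 0 i)) ler_normD.
  have h4 := cx i; lra.
have dyw : dist1 y w <= s * (N * q).
  rewrite /dist1 /N -[n in n%:R * _]card_ord -sumr_const mulr_suml mulr_sumr.
  apply: ler_sum => i _; rewrite wy normrN normrM (gtr0_norm s0) mul1r.
  by rewrite ler_wpM2l// ltW.
have dyw0 := dist1_ge0 y w.
have pw : peval p w <= peval p y - s * h + C * (s * (N * q)) ^+ 2.
  have := taylor y w yC cw.
  have -> : pdiff p y w = - (s * h).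
    rewrite /pdiff /h pgrad2E mulr_sumr -sumrN; apply: eq_bigr => i _.
    by rewrite wy /g; ring.
  move=> /(le_trans (ler_norm _)) t1.
  have t2 : C * dist1 y w ^+ 2 <= C * (s * (N * q)) ^+ 2.
    by rewrite ler_wpM2l// lerXn2r ?nnegrE ?mulr_ge0 ?(ltW s0) ?(ltW N0) ?(ltW q0).
  by lra.
have tri : dist1 x w <= dist1 x y + dist1 y w.
  rewrite /dist1 -big_split; apply: ler_sum => i _ /=; rewrite addrC.
  by apply: le_trans (ler_normD _ _); rewrite addrA subrK.
pose b := s * (k * N * q).
have b0 : 0 <= b by rewrite !mulr_ge0// ltW.
have phw : a - b <= phi w.
  have := ymin w (mem_set cw).
  have h1 : k * dist1 x w <= k * (dist1 x y + dist1 y w) by rewrite ler_pM2l.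
  have h2 : k * dist1 y w <= b by rewrite /b -[k * N * q]mulrA mulrCA ler_pM2l.
  rewrite -/a; lra.
have pw2 : (a - b) ^+ E <= peval p w.
  by rewrite -root_pow lerXn2r ?nnegrE// subr_ge0.
have bern := bernoulli_sub E b0 s2.
have aE : a ^+ E = a * a ^+ E.-1 by rewrite -exprS prednK.
have key : s * h <= E%:R * b * a ^+ E.-1 + C * (s * (N * q)) ^+ 2.
  have : a ^+ E - E%:R * b * a ^+ E.-1 <= (a - b) ^+ E.
    by rewrite -(ler_pM2l a0); move: bern; rewrite aE; lra.
  by move: pw pw2; rewrite -[peval p y]root_pow -/a; lra.
(* Raised to the power [2 * E], this contradicts the gradient inequality, since the constant to that
   power is below [c0] and [a ^+ E = p(y)]. *)
have key2 : q <= 2 * E%:R * N * k * a ^+ E.-1.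
  rewrite -(ler_pM2l (mulr_gt0 s0 q0)).
  have e1 : s * q * (2 * E%:R * N * k * a ^+ E.-1) = 2 * (E%:R * b * a ^+ E.-1) by rewrite /b; ring.
  have e2 : s * q * q = s * h by rewrite -qh; ring.
  have e3 : 2 * (C * (s * (N * q)) ^+ 2) <= s * h.
    have -> : 2 * (C * (s * (N * q)) ^+ 2) = (s * h) * (s * (2 * C * N ^+ 2)) by rewrite -qh; ring.
    rewrite -[X in _ <= X]mulr1 ler_pM2l ?mulr_gt0//; move: s3; lra.
  by rewrite e1 e2; lra.
move: hGI; apply/negP; rewrite -ltNge.
have -> : h ^+ E = q ^+ (2 * E) by rewrite exprM qh.
apply: (@le_lt_trans _ _ ((2 * E%:R * N * k * a ^+ E.-1) ^+ (2 * E))).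
  by rewrite lerXn2r ?nnegrE ?(ltW q0)// !mulr_ge0// ?exprn_ge0 ?ltW.
rewrite exprMn -exprM -[peval p y]root_pow -/a -exprM.
rewrite expE.
by rewrite ltr_pM2r// exprn_gt0.
Qed.

End Descent.

(** The first alternative collects the points where [p] is too large for [descent], and the case of
    no zero in the cube of radius 2, where [p] has a positive minimum. *)
Lemma local_lojasiewicz (R : realType) (n : nat) (p : realpoly R n) (D : nat) :
  (0 < n)%N -> (forall x, 0 <= peval p x) -> (mpoly.msize p <= D.+1)%N -> (4 <= D)%N ->
  exists2 c : R, 0 < c & forall x, cube 1 x -> c <= peval p x \/
    exists2 z, peval p z = 0 & c * dist1 x z ^+ gexp n D <= peval p x.
Proof.
move=> n0 p_ge0 degp D4.
have E4 := gexp_ge4 n D4; have E0 : (0 < gexp n D)%N by rewrite (leq_trans _ E4).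
have [[z [cz pz]]|nz] := pselect (exists z, cube 2 z /\ peval p z = 0); last first.
  have [||y yC ymin] := @EVT_min_rV R n (peval p) (cube 2) _
    (@closed_cube_compact R n 2 _ (@closed_cube R n 2) (fun _ h => h)).
  - by exists 0 => i; rewrite mxE normr0.
  - by apply: continuous_subspaceT; apply: peval_continuous.
  exists (peval p y) => [|x cx].
    rewrite lt_neqAle p_ge0 andbT eq_sym; apply/eqP => py; apply: nz; exists y.
    by split=> //; apply: set_mem.
  by left; apply: ymin; apply: mem_set => i; rewrite (le_trans (cx i))// ler1n.
have [c0 [tau [c00 tau0 gi]]] := gradient_inequality n0 p_ge0 degp D4 cz pz.
set E := gexp n D in E4 E0 gi *.
pose m := Num.min 1 c0 / 2.
have min0 : 0 < Num.min 1 c0 by rewrite lt_min ltr01.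
have m0 : 0 < m by rewrite divr_gt0.
have mlt : m < Num.min 1 c0 by rewrite ltr_pdivrMr// ltr_pMr// ltr1n.
have [m1 mc] : m < 1 /\ m < c0 by move: mlt; rewrite lt_min => /andP[].
have den : 0 < 2 * E%:R * n%:R :> R by rewrite !mulr_gt0 ?ltr0n.
pose k := m / (2 * E%:R * n%:R).
have k0 : 0 < k by rewrite divr_gt0.
have kc : (2 * E%:R * n%:R * k) ^+ (2 * E) < c0.
  rewrite /k mulrC divfK ?gt_eqF// (le_lt_trans _ mc)//.
  case: (E) E0 => // e _; rewrite mulnS exprS ler_piMr ?(ltW m0)//.
  by rewrite exprn_ile1 ?ltW.
have kE : 0 < k ^+ E by rewrite exprn_gt0.
exists (Num.min tau (k ^+ E)) => [|x cx]; first by rewrite lt_min tau0.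
have [|lt] := leP (Num.min tau (k ^+ E)) (peval p x); first by left.
right; move: lt; rewrite lt_min => /andP[ltau lk].
have [w pw dw] := descent n0 E0 p_ge0 c00 gi k0 kc cx lk (ltW ltau).
exists w => //; apply: le_trans dw; rewrite ler_wpM2r ?exprn_ge0 ?dist1_ge0//.
by rewrite ge_min lexx orbT.
Qed.

(** * The global distance inequality *)

Section Remap.
Variables (R : realType) (n n' : nat) (h : mpoly.multinom n -> mpoly.multinom n').

Definition remap (q : realpoly R n) : realpoly R n' :=
  \sum_(m <- mpoly.msupp q) mpoly.mcoeff m q *: mpoly.mpolyX R (h m).

Lemma peval_remap q x :
  peval (remap q) x = \sum_(m <- mpoly.msupp q) mpoly.mcoeff m q * mono (h m) x.
Proof.
by rewrite /remap !pevalE; apply: eq_bigr => m _; rewrite pevalZ peval_mono.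
Qed.

Lemma msize_remap q d : (forall m, (mpoly.mdeg m <= d)%N -> (mpoly.mdeg (h m) <= d)%N) ->
  (mpoly.msize q <= d.+1)%N -> (mpoly.msize (remap q) <= d.+1)%N.
Proof.
move=> hd qd; rewrite /remap big_seq.
elim/big_ind: _ => [|p1 p2 h1 h2|m /mpoly.msize_mdeg_lt mq].
- by rewrite mpoly.msize0.
- exact: msizeD_leq.
- apply: msizeZ_leq; rewrite mpoly.msizeX ltnS; apply: hd.
  by rewrite -ltnS (leq_trans mq).
Qed.

End Remap.

Section Chart.
Variables (R : realType) (n d : nat) (j : 'I_n).

(* Homogenizing in degree d and setting the j-th coordinate to 1; the j-th variable
   of the chart becomes the homogenizing one. *)
Definition chart_mon (m : mpoly.multinom n) : mpoly.multinom n :=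
  mpoly.Multinom [tuple if i == j then (d - mpoly.mdeg m)%N else m i | i < n].

Definition chart (q : realpoly R n) : realpoly R n := remap chart_mon q.

Definition flip (u : 'rV[R]_n) : 'rV[R]_n :=
  \row_i (if i == j then (u 0 j)^-1 else u 0 i / u 0 j).

Lemma chart_monE m i : chart_mon m i = if i == j then (d - mpoly.mdeg m)%N else m i.
Proof. by rewrite /chart_mon mpoly.mnmE. Qed.

Lemma mdeg_split (m : mpoly.multinom n) : mpoly.mdeg m = (m j + \sum_(i | i != j) m i)%N.
Proof. by rewrite mpoly.mdegE (bigD1 j). Qed.

Lemma msize_chart q : (mpoly.msize q <= d.+1)%N -> (mpoly.msize (chart q) <= d.+1)%N.
Proof.
apply: msize_remap => m md; rewrite mdeg_split chart_monE eqxx.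
under eq_bigr => i /negbTE ij do rewrite chart_monE ij.
by have := mdeg_split m; move: md; lia.
Qed.

Lemma flip_j (u : 'rV[R]_n) : flip u 0 j = (u 0 j)^-1.
Proof. by rewrite mxE eqxx. Qed.

Lemma flip_neq (u : 'rV[R]_n) i : i != j -> flip u 0 i = u 0 i / u 0 j.
Proof. by move=> /negbTE ij; rewrite mxE ij. Qed.

Lemma flipK (u : 'rV[R]_n) : u 0 j != 0 -> flip (flip u) = u.
Proof.
move=> u0; apply/rowP => i; have [->|ij] := eqVneq i j; first by rewrite !flip_j invrK.
by rewrite flip_neq// flip_neq// flip_j invrK divfK.
Qed.

Lemma mono_chart m (u : 'rV[R]_n) : (mpoly.mdeg m <= d)%N -> u 0 j != 0 ->
  mono (chart_mon m) u = u 0 j ^+ d * mono m (flip u).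
Proof.
move=> md u0; rewrite /mono (bigD1 j)//= [X in _ = _ * X](bigD1 j)//= chart_monE eqxx flip_j.
have -> : \prod_(i < n | i != j) u 0 i ^+ chart_mon m i =
    \prod_(i < n | i != j) (flip u 0 i ^+ m i * u 0 j ^+ m i).
  by apply: eq_bigr => i ij; rewrite chart_monE (negbTE ij) flip_neq// -exprMn divfK.
rewrite big_split /= prodrXr mulrCA -exprD.
set S := (\sum_(i < n | i != j) m i)%N.
have -> : (d - mpoly.mdeg m + S = d - m j)%N.
  by have := mdeg_split m; rewrite -/S; move: md; lia.
have mj : (m j <= d)%N by have := mdeg_split m; lia.
rewrite -{2}(subnK mj) exprD exprVn -[RHS]mulrA mulVKf ?expf_neq0//.
by rewrite mulrC.
Qed.

Lemma peval_chart q (u : 'rV[R]_n) : (mpoly.msize q <= d.+1)%N -> u 0 j != 0 ->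
  peval (chart q) u = u 0 j ^+ d * peval q (flip u).
Proof.
move=> qd u0; rewrite peval_remap pevalE_mono mulr_sumr.
rewrite [LHS]big_seq [RHS]big_seq; apply: eq_bigr => m mq.
rewrite mono_chart// 1?mulrCA// -ltnS (leq_trans _ qd)//.
exact: mpoly.msize_mdeg_lt.
Qed.

End Chart.

Definition norm1 (R : realType) (n : nat) (w : 'rV[R]_n) : R := \sum_i `|w 0 i|.

Definition sos (R : realType) (n : nat) (fs : seq (realpoly R n)) : realpoly R n :=
  \sum_(f <- fs) f ^+ 2.

Section Global.
Variables (R : realType) (n d : nat) (fs : seq (realpoly R n)).
Hypothesis n0 : (0 < n)%N.
Hypothesis d2 : (2 <= d)%N.
Hypothesis deg_fs : forall f, f \in fs -> (mpoly.msize f <= d.+1)%N.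
Implicit Types (u v w z : 'rV[R]_n) (gs : seq (realpoly R n)).

Lemma norm1_ge0 w : 0 <= norm1 w.
Proof. exact: sumr_ge0. Qed.

Lemma norm1_coord w i : `|w 0 i| <= norm1 w.
Proof. by rewrite /norm1 (bigD1 i)//= lerDl sumr_ge0. Qed.

Lemma norm1_triangle w z : norm1 z <= norm1 w + dist1 w z.
Proof.
rewrite /norm1 /dist1 -big_split; apply: ler_sum => i _ /=.
by rewrite -{1}[z 0 i](subrK (w 0 i)) addrC ler_normD.
Qed.

Lemma peval_sos gs w : peval (sos gs) w = \sum_(f <- gs) peval f w ^+ 2.
Proof. by rewrite /sos !pevalE; apply: eq_bigr => f _; rewrite pevalXn. Qed.

Lemma sos_ge0 gs w : 0 <= peval (sos gs) w.
Proof. by rewrite peval_sos sumr_ge0// => f _; apply: sqr_ge0. Qed.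

Lemma msize_sos gs : (forall f, f \in gs -> (mpoly.msize f <= d.+1)%N) ->
  (mpoly.msize (sos gs) <= (2 * d).+1)%N.
Proof.
move=> gd; rewrite /sos big_seq; elim/big_ind: _ => [|p q hp hq|f fg].
- by rewrite mpoly.msize0.
- exact: msizeD_leq.
- by rewrite mulnC; apply: msizeXn_leq; apply: gd.
Qed.

Lemma sos_chart j u : u 0 j != 0 ->
  peval (sos (map (chart d j) fs)) u = u 0 j ^+ (2 * d) * peval (sos fs) (flip j u).
Proof.
move=> u0; rewrite !peval_sos big_map mulr_sumr [LHS]big_seq [RHS]big_seq.
by apply: eq_bigr => f ff; rewrite peval_chart ?deg_fs// exprMn -exprM mulnC.
Qed.

(** With [z = flip j v], each difference of coordinates is [(u_j)^-1 (v_i - u_i + z_i (u_j - v_j))],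
    without the first difference when [i = j]. Only the image of [v] enters the bound, and it is
    compared with the image of [u] afterwards. *)
Lemma flip_dist j u v : u 0 j != 0 -> v 0 j != 0 ->
  dist1 (flip j u) (flip j v) <= `|u 0 j|^-1 * (dist1 u v * (1 + norm1 (flip j v))).
Proof.
move=> u0 v0; have zj : flip j v 0 j = (v 0 j)^-1 by rewrite flip_j.
have coord i : `|flip j v 0 i - flip j u 0 i| <=
    `|u 0 j|^-1 * (`|v 0 i - u 0 i| + `|flip j v 0 i| * `|v 0 j - u 0 j|).
  have [a [au ->]] : exists a, `|a| <= `|v 0 i - u 0 i| /\
      flip j v 0 i - flip j u 0 i = (u 0 j)^-1 * (a + flip j v 0 i * (u 0 j - v 0 j)).
    have [->|ij] := eqVneq i j.
      by exists 0; rewrite normr0; split=> //; rewrite !flip_j; field; rewrite u0 v0.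
    exists (v 0 i - u 0 i); split=> //; rewrite (flip_neq u ij) (flip_neq v ij).
    by field; rewrite u0 v0.
  rewrite normrM normfV ler_wpM2l ?invr_ge0// (le_trans (ler_normD _ _))// lerD//.
  by rewrite normrM [`|u 0 j - _|]distrC.
rewrite /dist1; apply: le_trans (ler_sum _ (fun i _ => coord i)) _.
rewrite -mulr_sumr ler_wpM2l ?invr_ge0// big_split /= mulrDr mulr1 lerD2l -mulr_suml mulrC.
by rewrite ler_wpM2r ?norm1_ge0//; apply: dist1_coord.
Qed.

Let E := gexp n (2 * d).

Lemma local_all : exists2 c : R, 0 < c & forall gs : seq (realpoly R n),
  (gs = fs \/ exists j, gs = map (chart d j) fs) -> forall u, cube 1 u ->
  c <= peval (sos gs) u \/
  exists2 z, peval (sos gs) z = 0 & c * dist1 u z ^+ E <= peval (sos gs) u.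
Proof.
have loc gs : (forall f, f \in gs -> (mpoly.msize f <= d.+1)%N) ->
    exists2 c : R, 0 < c & forall c', 0 < c' <= c -> forall u, cube 1 u ->
    c' <= peval (sos gs) u \/
    exists2 z, peval (sos gs) z = 0 & c' * dist1 u z ^+ E <= peval (sos gs) u.
  move=> gd; have [|c c0 cP] := local_lojasiewicz n0 (sos_ge0 gs) (msize_sos gd).
    by lia.
  exists c => // c' /andP[c'0 c'c] u cu; case: (cP u cu) => [h|[z pz h]].
    by left; apply: le_trans h.
  right; exists z => //; apply: le_trans h; rewrite ler_wpM2r ?exprn_ge0//.
  exact: dist1_ge0.
have [c c0 cP] := loc fs deg_fs.
have [c1 /andP[c10 _] c1P] : exists2 c1 : R, 0 < c1 <= c & forall j,
    forall c', 0 < c' <= c1 -> forall u, cube 1 u ->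
    c' <= peval (sos (map (chart d j) fs)) u \/
    exists2 z, peval (sos (map (chart d j) fs)) z = 0 &
      c' * dist1 u z ^+ E <= peval (sos (map (chart d j) fs)) u.
  apply: (eventually_all c0) => [j s s' /andP[s'0 s's] h c' /andP[h1 h2]|j].
    by apply: h; rewrite h1 (le_trans h2).
  have [|c1 c10 c1P] := loc (map (chart d j) fs).
    by move=> _ /mapP[f ff ->]; apply: msize_chart; apply: deg_fs.
  exists (Num.min c c1); first by rewrite lt_min c0 c10 ge_min lexx.
  by move=> c' /andP[h1]; rewrite le_min => /andP[_ h2]; apply: c1P; rewrite h1.
have m0 : 0 < Num.min c c1 by rewrite lt_min c0.
exists (Num.min c c1) => // gs [->|[j ->]] u cu.
  by apply: cP; rewrite // m0 ge_min lexx.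
by apply: c1P; rewrite // m0 ge_min lexx orbT.
Qed.

(** Outside the unit cube the local estimate is applied in the chart of the largest coordinate. The
    second alternative covers zeros that are absent, at infinity, or much farther out than [w]. *)
Lemma global_lojasiewicz : exists2 c : R, 0 < c & forall w,
  (exists2 z, peval (sos fs) z = 0 &
     c * (dist1 w z / (1 + norm1 w ^+ 2)) ^+ E <= peval (sos fs) w) \/
  c * (1 + norm1 w)^-1 ^+ E <= peval (sos fs) w.
Proof.
have [c c0 cP] := local_all.
have c1 : c / 4 ^+ E <= c by rewrite ler_pdivrMr ?exprn_gt0// ler_peMr ?(ltW c0)// exprn_ege1// ler1n.
exists (c / 4 ^+ E) => [|w]; first by rewrite divr_gt0// exprn_gt0.
have N0 := norm1_ge0 w.
have inv1 : 0 <= (1 + norm1 w)^-1 <= 1.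
  by rewrite invr_ge0 invf_le1 ?lerDl ?addr_ge0// ltr_wpDr.
have far (b : R) : (1 + norm1 w)^-1 <= 4 * b -> c * b ^+ E <= peval (sos fs) w ->
    c / 4 ^+ E * (1 + norm1 w)^-1 ^+ E <= peval (sos fs) w.
  move=> h; apply: le_trans; rewrite -mulrA ler_pM2l// ler_pdivrMl ?exprn_gt0//.
  by rewrite -exprMn lerXn2r ?nnegrE ?(andP inv1).1// (le_trans _ h)// (andP inv1).1.
have [w1|] := pselect (cube 1 w).
  case: (cP fs _ w w1) => [|h|[z pz h]]; first by left.
    right; apply: le_trans h; apply: le_trans c1.
    by rewrite ler_piMr ?divr_ge0 ?exprn_ge0 ?(ltW c0)// exprn_ile1// ?(andP inv1).1 ?(andP inv1).2.
  left; exists z => //; apply: le_trans h; apply: ler_pM; rewrite ?divr_ge0 ?exprn_ge0 ?(ltW c0)//.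
    by rewrite divr_ge0 ?dist1_ge0// addr_ge0// sqr_ge0.
  rewrite lerXn2r ?nnegrE ?dist1_ge0 ?divr_ge0 ?dist1_ge0// ?addr_ge0 ?sqr_ge0//.
  by rewrite ler_pdivrMr ?ltr_wpDr ?sqr_ge0// ler_peMr ?dist1_ge0// lerDl sqr_ge0.
move=> /existsNP[i0 /negP]; rewrite -ltNge => wi0.
pose j := [arg max_(i > i0) `|w 0 i|]%O.
have [wj1 jmax] : 1 < `|w 0 j| /\ forall i, `|w 0 i| <= `|w 0 j|.
  rewrite /j; case: arg_maxP => // i _ imax; split=> [|k]; last exact: imax.
  by apply: lt_le_trans wi0 _; apply: imax.
set M := `|w 0 j| in wj1 jmax.
have M0 : 0 < M := lt_trans ltr01 wj1.
have wj0 : w 0 j != 0 by rewrite -normr_gt0.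
have MN : M <= norm1 w := norm1_coord w j.
pose u := flip j w.
have uj : u 0 j = (w 0 j)^-1 by rewrite /u flip_j.
have uj0 : u 0 j != 0 by rewrite uj invr_eq0.
have fu : flip j u = w by rewrite /u flipK.
have u1 : cube 1 u.
  move=> i; rewrite /u; have [->|ij] := eqVneq i j.
    by rewrite flip_j normfV invf_le1 ?(ltW wj1).
  by rewrite flip_neq// normrM normfV ler_pdivrMr// mul1r.
have nu : `|u 0 j| = M^-1 by rewrite uj normfV.
have pw : peval (sos (map (chart d j) fs)) u <= peval (sos fs) w.
  rewrite sos_chart// fu ler_piMl ?sos_ge0// exprM -real_normK ?num_real// nu.
  by rewrite -exprM exprn_ile1 ?invr_ge0 ?(ltW M0)// invf_le1 ?(ltW wj1).
have invM : (1 + norm1 w)^-1 <= M^-1.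
  by rewrite lef_pV2 ?posrE ?ltr_wpDr// (le_trans MN)// lerDr.
case: (cP (map (chart d j) fs) _ u u1) => [|h|[v pv h]]; first by right; exists j.
  right; apply: (far 1); last by rewrite expr1n mulr1 (le_trans h).
  by rewrite mulr1 (le_trans (andP inv1).2)// ler1n.
have {}h := le_trans h pw.
(* A zero with [v_j = 0] is at infinity and corresponds to no zero of the system; but its distance
   to [u] is at least [|u_j| = M^-1]. *)
have [vj|vj0] := eqVneq (v 0 j) 0.
  right; apply: (far (dist1 u v)) h.
  apply: le_trans invM _; apply: (@le_trans _ _ (dist1 u v)).
    by rewrite -nu -normrN -[- _]add0r -vj dist1_coord.
  by rewrite ler_peMl ?dist1_ge0// ler1n.
pose z := flip j v.
have pz : peval (sos fs) z = 0.
  move: pv; rewrite sos_chart// => /eqP; rewrite mulf_eq0 expf_eq0 (negbTE vj0) andbF.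
  by move=> /eqP.
have dwz : dist1 w z <= M * (dist1 u v * (1 + norm1 z)).
  by rewrite -{1}fu (le_trans (flip_dist uj0 vj0))// nu invrK.
have duv := dist1_ge0 u v.
(* For [z] of size comparable to [w], the chart distorts distances by at most [4 (1 + |w|^2)].
   Otherwise [|w - z| >= |z| / 2], and [flip_dist] forces [dist1 u v >= M^-1 / 4]. *)
have [zsmall|zbig] := leP (norm1 z) (2 * norm1 w + 1).
  left; exists z => //; apply: le_trans h.
  rewrite -mulrA ler_pM2l// ler_pdivrMl ?exprn_gt0// -exprMn.
  have den : 0 < 1 + norm1 w ^+ 2 by rewrite ltr_wpDr ?sqr_ge0.
  rewrite lerXn2r ?nnegrE ?divr_ge0 ?dist1_ge0 ?mulr_ge0 ?(ltW den)//.
  rewrite ler_pdivrMr//; apply: le_trans dwz _.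
  have e1 : dist1 u v * (1 + norm1 z) <= dist1 u v * (2 * norm1 w + 2).
    by rewrite ler_wpM2l//; lra.
  have e2 : M * (dist1 u v * (2 * norm1 w + 2)) <= norm1 w * (dist1 u v * (2 * norm1 w + 2)).
    by rewrite ler_wpM2r// mulr_ge0// addr_ge0// mulr_ge0.
  apply: le_trans (ler_wpM2l (ltW M0) e1) _; apply: le_trans e2 _.
  have e3 : norm1 w * (2 * norm1 w + 2) <= 4 * (1 + norm1 w ^+ 2) by nra.
  have := ler_wpM2l duv e3; lra.
right; apply: (far (dist1 u v)) h; apply: le_trans invM _.
have z0 : 0 < norm1 z by lra.
have t1 := norm1_triangle w z.
rewrite -[M^-1]mulr1 ler_pdivrMl// -(ler_pM2r z0) mul1r.
have e1 : M * dist1 u v * (1 + norm1 z) <= M * dist1 u v * (2 * norm1 z).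
  by rewrite ler_wpM2l ?mulr_ge0 ?(ltW M0)//; lra.
by lra.
Qed.

End Global.

(** * Distance to the zero set on a semialgebraic set *)

Section EuclideanNorm.
Variables (R : realType) (n : nat).
Implicit Types x y : 'rV[R]_n.

Lemma eucl_norm_ge0 x : 0 <= eucl_norm x.
Proof. exact: sqrtr_ge0. Qed.

Lemma eucl_norm_sqr x : eucl_norm x ^+ 2 = \sum_i x 0 i ^+ 2.
Proof. by rewrite sqr_sqrtr// sumr_ge0// => i _; apply: sqr_ge0. Qed.

Lemma eucl_coord x i : `|x 0 i| <= eucl_norm x.
Proof.
rewrite -sqrtr_sqr ler_wsqrtr// (bigD1 i)//= lerDl sumr_ge0// => j _.
exact: sqr_ge0.
Qed.

Lemma eucl_le_norm1 x : eucl_norm x <= norm1 x.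
Proof.
rewrite -(@ler_pXn2r _ 2)// ?nnegrE ?eucl_norm_ge0 ?norm1_ge0// eucl_norm_sqr.
rewrite expr2 {1}/norm1 mulr_suml; apply: ler_sum => i _.
by rewrite -real_normK ?num_real// expr2 ler_wpM2l// norm1_coord.
Qed.

Lemma norm1_le_eucl x : norm1 x <= n%:R * eucl_norm x.
Proof.
rewrite -[n in n%:R * _]card_ord -sumr_const mulr_suml; apply: ler_sum => i _.
by rewrite mul1r eucl_coord.
Qed.

Lemma eucl_sub_dist1 x y : eucl_norm (x - y) <= dist1 x y.
Proof.
apply: le_trans (eucl_le_norm1 _) _; apply: ler_sum => i _.
by rewrite !mxE distrC.
Qed.

Lemma expr_le_add1 (e : R) k D : 0 <= e -> (k <= D)%N -> e ^+ k <= 1 + e ^+ D.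
Proof.
move=> e0 kD; have [e1|/ltW e1] := leP e 1.
  by rewrite (le_trans (exprn_ile1 _ e0 e1))// lerDl exprn_ge0.
by rewrite (le_trans (ler_weXn2l e1 kD))// lerDr.
Qed.

Lemma peval_growth (q : realpoly R n) D : (mpoly.msize q <= D.+1)%N ->
  exists2 C : R, 0 <= C & forall x, `|peval q x| <= C * (1 + eucl_norm x ^+ D).
Proof.
move=> qD; exists (\sum_(m <- mpoly.msupp q) `|mpoly.mcoeff m q|); first by rewrite sumr_ge0.
move=> x; rewrite pevalE_mono (le_trans (ler_norm_sum _ _ _))// mulr_suml.
rewrite [X in X <= _]big_seq [X in _ <= X]big_seq; apply: ler_sum => m mq.
rewrite normrM ler_wpM2l// /mono normr_prod.
have md : (mpoly.mdeg m <= D)%N by rewrite -ltnS (leq_trans _ qD)// mpoly.msize_mdeg_lt.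
apply: le_trans (expr_le_add1 (eucl_norm_ge0 x) md).
rewrite mpoly.mdegE -prodrXr; apply: ler_prod => i _.
by rewrite normr_ge0 normrX lerXn2r ?nnegrE ?eucl_norm_ge0// eucl_coord.
Qed.

Lemma eucl_dist_ge0 x (Z : set 'rV[R]_n) : 0 <= eucl_dist x Z.
Proof.
rewrite /eucl_dist; case: ifPn => // /set0P Z0; apply: lb_le_inf.
  by case: Z0 => z Zz; exists (eucl_norm (x - z)), z.
by move=> _ [z _ <-]; apply: eucl_norm_ge0.
Qed.

Lemma eucl_dist_le x (Z : set 'rV[R]_n) z : Z z -> eucl_dist x Z <= eucl_norm (x - z).
Proof.
move=> Zz; rewrite /eucl_dist; case: ifPn => [/eqP Z0|_]; first by move: Zz; rewrite Z0.
apply: ge_inf; last by exists z.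
by exists 0 => _ [y _ <-]; apply: eucl_norm_ge0.
Qed.

Lemma eucl_dist_growth (Z : set 'rV[R]_n) :
  exists2 A : R, 1 <= A & forall x, 0 <= eucl_dist x Z <= A * (1 + eucl_norm x).
Proof.
have [Z0|Z0] := pselect (Z !=set0); last first.
  exists 1 => // x; rewrite eucl_dist_ge0 mul1r /eucl_dist; case: ifPn => [_|/set0P//].
  by rewrite lerDl eucl_norm_ge0.
have [z Zz] := Z0; exists (1 + n%:R + norm1 z) => [|x].
  by rewrite -addrA lerDl addr_ge0 ?norm1_ge0.
rewrite eucl_dist_ge0 (le_trans (eucl_dist_le x Zz))// (le_trans (eucl_sub_dist1 _ _))//.
have h1 : dist1 x z <= norm1 z + norm1 x.
  rewrite /dist1 /norm1 -big_split; apply: ler_sum => i _; exact: ler_normB.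
have h2 := norm1_le_eucl x; have e0 := eucl_norm_ge0 x; have z0 := norm1_ge0 z.
have n0 : 0 <= n%:R :> R by [].
have h3 := mulr_ge0 z0 e0.
by lra.
Qed.

End EuclideanNorm.

Section Lift.
Variables (R : realType) (N k : nat).

Definition lift_mon (m : mpoly.multinom N) : mpoly.multinom (N + k) :=
  mpoly.Multinom [tuple if fintype.split i is inl a then m a else 0%N | i < N + k].

Definition plift (q : realpoly R N) : realpoly R (N + k) := remap lift_mon q.

Lemma lift_mon_l m a : lift_mon m (lshift k a) = m a.
Proof.
by rewrite /lift_mon mpoly.mnmE (unsplitK (inl a)).
Qed.

Lemma lift_mon_r m a : lift_mon m (rshift N a) = 0%N.
Proof. by rewrite /lift_mon mpoly.mnmE (unsplitK (inr a)). Qed.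

Lemma peval_lift q (w : 'rV[R]_(N + k)) : peval (plift q) w = peval q (lsubmx w).
Proof.
rewrite peval_remap pevalE_mono; apply: eq_bigr => m _; congr (_ * _).
rewrite /mono big_split_ord /= [X in _ * X]big1 ?mulr1 => [|i _].
  by apply: eq_bigr => i _; rewrite lift_mon_l mxE.
by rewrite lift_mon_r expr0.
Qed.

Lemma msize_lift q d : (mpoly.msize q <= d.+1)%N -> (mpoly.msize (plift q) <= d.+1)%N.
Proof.
apply: msize_remap => m; rewrite !mpoly.mdegE big_split_ord /=.
rewrite [X in (_ + X)%N]big1 ?addn0 => [|i _]; last exact: lift_mon_r.
move=> md; suff -> : (\sum_(i < N) lift_mon m (lshift k i) = \sum_(i < N) m i)%N by [].
by apply: eq_bigr => i _; apply: lift_mon_l.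
Qed.

End Lift.

(** * One basic closed piece, lifted by slack variables *)

Section Description.
Variables (R : realType) (N m d D : nat) (F : polymap R N m) (b : description R N).
Hypothesis N0 : (0 < N)%N.
Hypothesis D2 : (2 <= D)%N.
Hypothesis Dd : (D <= d)%N.
Hypothesis degF : forall j, (mpoly.msize (F j) <= d.+1)%N.
Hypothesis degb : forall q, q \in b.1 ++ b.2 -> (mpoly.msize q <= D.+1)%N.

Let k := num_ineqs b.
Let g (i : 'I_k) := nth 0 b.1 i.

Lemma degg i : (mpoly.msize (g i) <= D.+1)%N.
Proof. by apply: degb; rewrite mem_cat mem_nth. Qed.

Definition slack_system : seq (realpoly R (N + k)) :=
  [seq plift k (F j) | j <- index_enum 'I_m] ++ [seq plift k h | h <- b.2] ++
  [seq plift k (g i) - pvar R (rshift N i) ^+ 2 | i <- index_enum 'I_k].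

Lemma msize_slack_system f : f \in slack_system -> (mpoly.msize f <= d.+1)%N.
Proof.
rewrite !mem_cat => /or3P[/mapP[j _ ->]|/mapP[h hb ->]|/mapP[i _ ->]].
- by apply: msize_lift.
- by apply: msize_lift; rewrite (leq_trans (degb _))// mem_cat hb orbT.
- apply: msizeD_leq; first by apply: msize_lift; rewrite (leq_trans (degg i)).
  rewrite mpoly.msizeN; apply: leq_trans (_ : ((1 * 2).+1 <= _)%N).
    by apply: msizeXn_leq; rewrite msize_pvar.
  by rewrite ltnS mul1n (leq_trans D2).
Qed.

Lemma sos_slack (w : 'rV[R]_(N + k)) : peval (sos slack_system) w =
  \sum_j peval (F j) (lsubmx w) ^+ 2 + (\sum_(h <- b.2) peval h (lsubmx w) ^+ 2 +
  \sum_i (peval (g i) (lsubmx w) - rsubmx w 0 i ^+ 2) ^+ 2).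
Proof.
rewrite peval_sos !big_cat !big_map /=; congr (_ + (_ + _)).
- by apply: eq_bigr => j _; rewrite peval_lift.
- by apply: eq_bigr => h _; rewrite peval_lift.
- by apply: eq_bigr => i _; rewrite pevalB pevalXn peval_lift peval_var mxE.
Qed.

Lemma slack_zero (w : 'rV[R]_(N + k)) : peval (sos slack_system) w = 0 ->
  [/\ polymap_eval F (lsubmx w) = 0, basic_set b (lsubmx w) &
    forall i, rsubmx w 0 i ^+ 2 = peval (g i) (lsubmx w)].
Proof.
have s2 (I : Type) (s : seq I) (f : I -> R) : 0 <= \sum_(i <- s) f i ^+ 2.
  by apply: sumr_ge0 => i _; apply: sqr_ge0.
have s0 (I : eqType) (s : seq I) (f : I -> R) : \sum_(i <- s) f i ^+ 2 = 0 ->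
    forall i, i \in s -> f i = 0.
  move=> /eqP; rewrite psumr_eq0 => [/allP h i si|i _]; last exact: sqr_ge0.
  by have := h i si; rewrite sqrf_eq0 => /eqP.
rewrite sos_slack => /eqP; rewrite paddr_eq0 ?addr_ge0// paddr_eq0//.
move=> /and3P[/eqP/s0 hF /eqP/s0 hh /eqP/s0 hg].
have hgi i : rsubmx w 0 i ^+ 2 = peval (g i) (lsubmx w).
  by apply/esym/eqP; rewrite -subr_eq0 hg// mem_index_enum.
split=> //; first by apply/rowP => j; rewrite !mxE hF// mem_index_enum.
split=> // q /(nthP 0)[i ib <-].
by rewrite -[nth _ _ _]/(g (Ordinal (ib : (i < k)%N))) -hgi sqr_ge0.
Qed.

Lemma slack_norm : exists2 C : R, 1 <= C & forall w : 'rV[R]_(N + k),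
  (forall i, rsubmx w 0 i ^+ 2 = peval (g i) (lsubmx w)) ->
  norm1 w ^+ 2 <= C * (1 + eucl_norm (lsubmx w) ^+ D).
Proof.
have /choice[C CP] : forall i, exists C : R, 0 <= C /\
    forall x, `|peval (g i) x| <= C * (1 + eucl_norm x ^+ D).
  by move=> i; have [C C0 CP] := peval_growth (degg i); exists C.
have S0 : 0 <= \sum_i C i by apply: sumr_ge0 => i _; case: (CP i).
have n1 : (1 : R) <= (N + k)%:R ^+ 2 by rewrite exprn_ege1// ler1n addn_gt0 N0.
exists ((N + k)%:R ^+ 2 * (1 + \sum_i C i)) => [|w wg].
  by rewrite -[X in X <= _]mulr1 ler_pM// lerDl.
set e := eucl_norm (lsubmx w).
have e0 : 0 <= e := eucl_norm_ge0 _.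
apply: (@le_trans _ _ ((N + k)%:R ^+ 2 * eucl_norm w ^+ 2)).
  rewrite -exprMn lerXn2r ?nnegrE ?norm1_ge0 ?mulr_ge0 ?eucl_norm_ge0//.
  exact: norm1_le_eucl.
rewrite -mulrA ler_wpM2l ?sqr_ge0// eucl_norm_sqr big_split_ord /= mulrDl mul1r lerD//.
  apply: le_trans (expr_le_add1 e0 D2); rewrite eucl_norm_sqr le_eqVlt; apply/orP; left.
  by apply/eqP; apply: eq_bigr => i _; rewrite mxE.
rewrite mulr_suml; apply: ler_sum => i _; have := wg i; rewrite mxE => ->.
by apply: le_trans (ler_norm _) _; case: (CP i).
Qed.

(** [W] is the size of the lift of [x], [V] that of a lifted zero above [x'], and [delta] the
    distance of the two lifts. [W <= V + delta] is recorded because the estimate at infinity bounds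
    [delta] from below by it. *)
Lemma description_alternative (E := gexp (N + k) (2 * d)) :
  exists c C : R, [/\ 0 < c, 1 <= C & forall x, basic_set b x ->
    exists W : R, [/\ eucl_norm x <= W, W ^+ 2 <= C * (1 + eucl_norm x ^+ D) &
      (exists x' (V delta : R), [/\ zero_set F (basic_set b) x',
         V ^+ 2 <= C * (1 + eucl_norm x' ^+ D), eucl_norm (x - x') <= delta,
         W <= V + delta & c * (delta / (1 + W ^+ 2)) ^+ E <= eucl_norm (polymap_eval F x) ^+ 2]) \/
      c * (1 + W)^-1 ^+ E <= eucl_norm (polymap_eval F x) ^+ 2]].
Proof.
have [||c c0 cP] := global_lojasiewicz (n := N + k) _ _ msize_slack_system.
- by rewrite addn_gt0 N0.
- exact: leq_trans Dd.
have [C C1 CP] := slack_norm.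
exists c, C; split=> // x [bg bh].
pose w : 'rV[R]_(N + k) := row_mx x (\row_i Num.sqrt (peval (g i) x)).
have lw : lsubmx w = x by rewrite row_mxKl.
have gw i : rsubmx w 0 i ^+ 2 = peval (g i) (lsubmx w).
  by rewrite lw row_mxKr mxE sqr_sqrtr//; apply: bg; rewrite mem_nth.
have pw : peval (sos slack_system) w = eucl_norm (polymap_eval F x) ^+ 2.
  have h0 : \sum_(h <- b.2) peval h x ^+ 2 = 0.
    by rewrite big_seq big1// => h hb; rewrite bh ?expr0n.
  rewrite sos_slack lw h0 add0r.
  rewrite [X in _ + X]big1 => [|i _]; last by rewrite gw lw subrr expr0n.
  rewrite addr0 eucl_norm_sqr; apply: eq_bigr => j _.
  by rewrite mxE.
exists (norm1 w); split.
- apply: le_trans (eucl_le_norm1 _) _; rewrite -{1}lw /norm1 big_split_ord /= ler_wpDr ?sumr_ge0//.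
  by apply: ler_sum => i _; rewrite mxE.
- by have := CP w gw; rewrite lw.
rewrite -pw; case: (cP w) => [[z pz hz]|h]; [left|by right].
have [Fz bz gz] := slack_zero pz.
exists (lsubmx z), (norm1 z), (dist1 w z); split=> //.
- exact: CP.
- apply: le_trans (eucl_sub_dist1 _ _) _; rewrite -{1}lw /dist1 big_split_ord /= ler_wpDr ?sumr_ge0//.
  by apply: ler_sum => i _; rewrite !mxE.
- have := norm1_triangle z w; rewrite /dist1.
  by under eq_bigr do rewrite distrC.
Qed.

Let E1 := (d * (6 * d - 3) ^ (N + k - 1))%N.

Lemma gexp_double : gexp (N + k) (2 * d) = (2 * E1)%N.
Proof.
have e6 : (3 * (2 * d) = 6 * d)%N by rewrite mulnA.
by rewrite /gexp /E1 e6 subn1 mulnA.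
Qed.

Lemma sqrt_lower_bound (c a f : R) (n : nat) : 0 < c -> 0 <= a -> 0 <= f ->
  c * a ^+ (2 * n) <= f ^+ 2 -> Num.sqrt c * a ^+ n <= f.
Proof.
move=> c0 a0 f0 h; rewrite -(@ler_pXn2r _ 2)// ?nnegrE ?mulr_ge0 ?sqrtr_ge0 ?exprn_ge0//.
by rewrite exprMn sqr_sqrtr ?(ltW c0)// -exprM mulnC.
Qed.

Lemma description_distance (Z : set 'rV[R]_N) (E : nat) :
  zero_set F (basic_set b) `<=` Z -> (E1 <= E)%N ->
  exists2 c : R, 0 < c & forall x, basic_set b x ->
    c * (eucl_dist x Z / (1 + eucl_norm x ^+ D)) ^+ E <= eucl_norm (polymap_eval F x).
Proof.
move=> bZ EE; have [c [C [c0 C1 alt]]] := description_alternative.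
have [A A1 AP] := eucl_dist_growth Z.
(* With this [K] the quotient [rho / K] is at most 1 and below the base of either alternative, so
   the exponent may be enlarged from [E1] to [E]. *)
pose K := 2 * A * (1 + C).
have K1 : 1 <= K by rewrite /K; nra.
have K0 : 0 < K := lt_le_trans ltr01 K1.
exists (Num.sqrt c * K^-1 ^+ E) => [|x bx].
  by rewrite mulr_gt0 ?sqrtr_gt0// exprn_gt0// invr_gt0.
have [W [eW WC hW]] := alt x bx.
have /andP[dist0 distA] := AP x.
set e := eucl_norm x in eW WC distA *; have e0 : 0 <= e := eucl_norm_ge0 x.
set q := eucl_dist x Z in dist0 distA *.
set a := e ^+ D in WC *; have a0 : 0 <= a by apply: exprn_ge0.
have W0 := le_trans e0 eW.
have a1 : 0 < 1 + a by rewrite ltr_wpDr.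
pose rho := q / (1 + a); have rho0 : 0 <= rho by rewrite divr_ge0// ltW.
have qE : q = rho * (1 + a) by rewrite divfK// gt_eqF.
have rW : rho * (1 + W) <= K.
  rewrite /rho mulrAC ler_pdivrMr//.
  apply: (@le_trans _ _ (A * ((1 + e) * (1 + W)))).
    by rewrite mulrA ler_wpM2r// addr_ge0.
  rewrite /K [2 * A]mulrC -!mulrA ler_wpM2l ?(le_trans ler01 A1)//.
  have h1 : (1 + e) * (1 + W) <= (1 + W) * (1 + W) by rewrite ler_wpM2r ?addr_ge0// lerD2l.
  have h2 : (1 + W) * (1 + W) <= 2 * (1 + W ^+ 2) by have := sqr_ge0 (W - 1); lra.
  have h3 : 1 + W ^+ 2 <= (1 + C) * (1 + a) by lra.
  by lra.
have rK1 : rho / K <= 1.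
  rewrite ler_pdivrMr// mul1r (le_trans _ rW)// ler_peMr// lerDl//.
have rK0 : 0 <= rho / K by rewrite divr_ge0// ltW.
rewrite -/rho -mulrA [_ ^+ E * _]mulrC -exprMn.
apply: sqrt_lower_bound => //; first exact: eucl_norm_ge0.
have mono_pow (y : R) : rho / K <= y -> (rho / K) ^+ (2 * E) <= y ^+ gexp (N + k) (2 * d).
  move=> y_ge; rewrite gexp_double; apply: (@le_trans _ _ ((rho / K) ^+ (2 * E1))).
    by rewrite ler_wiXn2l// leq_mul2l EE orbT.
  by rewrite lerXn2r ?nnegrE// (le_trans rK0).
case: hW => [[x' [V [delta [Zx _ hdelta _ h]]]]|h]; apply: le_trans h; rewrite ler_pM2l//;
  apply: mono_pow.
  have W2 : 0 < 1 + W ^+ 2 by rewrite ltr_wpDr ?sqr_ge0.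
  have qd : q <= delta by apply: le_trans hdelta; apply: eucl_dist_le; apply: bZ.
  rewrite ler_pdivlMr// -mulrA; apply: le_trans qd; rewrite [X in _ <= X]qE ler_wpM2l//.
  rewrite ler_pdivrMl//; apply: (@le_trans _ _ ((1 + C) * (1 + a))); first by lra.
  rewrite ler_wpM2r ?(ltW a1)// /K -[X in X <= _]mul1r ler_wpM2r//; lra.
rewrite ler_pdivrMr// ler_pdivlMl ?ltr_wpDr//; move: rW; lra.
Qed.

(** Lifted zeros have size at most [V0]. For [|x| >= 2 * V0] this forces [delta >= W / 2], so both
    alternatives have base at least [1 / (4 W)], and [W] is of order at most [|x|^(D/2)]. Using [W]
    directly is what gives the factor [D / 2] instead of [D]. *)
Lemma description_growth (Z : set 'rV[R]_N) (E : nat) (B : R) :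
  zero_set F (basic_set b) `<=` Z -> (forall z, Z z -> eucl_norm z <= B) -> (E1 <= E)%N ->
  exists c r : R, [/\ 0 < c, 0 < r & forall x, basic_set b x -> r <= eucl_norm x ->
    c * (eucl_norm x `^ (- (D%:R / 2 * E%:R))) <= eucl_norm (polymap_eval F x)].
Proof.
move=> bZ ZB EE; have [c [C [c0 C1 alt]]] := description_alternative.
pose V0 := 1 + C * (1 + `|B| ^+ D).
have C0 : 0 < C := lt_le_trans ltr01 C1.
have C32 : 0 < (32 * C) ^+ E by rewrite exprn_gt0// mulr_gt0.
have cC : 0 < c / (32 * C) ^+ E by rewrite divr_gt0.
exists (Num.sqrt (c / (32 * C) ^+ E)), (Num.max 1 (2 * V0)).
split; [by rewrite sqrtr_gt0|by rewrite lt_max ltr01|].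
move=> x bx; rewrite ge_max => /andP[e1 eV].
have [W [eW WC hW]] := alt x bx.
set e := eucl_norm x in eW WC e1 eV *.
have W1 := le_trans e1 eW.
have W0 : 0 < W := lt_le_trans ltr01 W1.
have e0 : 0 < e := lt_le_trans ltr01 e1.
set a := e ^+ D in WC *.
have a1 : 1 <= a by apply: exprn_ege1.
have a0 : 0 < a := lt_le_trans ltr01 a1.
pose q := (4 * W)^-1.
have q0 : 0 < q by rewrite invr_gt0 mulr_gt0.
have qW : q * W = 4^-1 by rewrite /q invfM -mulrA mulVf ?mulr1// gt_eqF.
have hq : c * q ^+ (2 * E1) <= eucl_norm (polymap_eval F x) ^+ 2.
  rewrite -gexp_double.
  case: hW => [[x' [V [delta [Zx VC _ hV h]]]]|h]; apply: le_trans h; rewrite ler_pM2l//.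
    have hVV : V <= V0.
      have x'B : eucl_norm x' <= `|B| by rewrite (le_trans (ZB _ (bZ _ Zx)))// ler_norm.
      have : C * (1 + eucl_norm x' ^+ D) <= C * (1 + `|B| ^+ D).
        by rewrite ler_pM2l// lerD2l lerXn2r ?nnegrE ?eucl_norm_ge0.
      by rewrite /V0; have := sqr_ge0 (V - 1); have := sqr_ge0 V; lra.
    have qd : q <= delta / (1 + W ^+ 2).
      rewrite ler_pdivlMr ?ltr_wpDr ?sqr_ge0//.
      have q4 : q <= 4^-1 by rewrite -qW ler_peMr// ltW.
      have -> : q * (1 + W ^+ 2) = q + W / 4 by rewrite mulrDr mulr1 expr2 mulrA qW mulrC.
      by lra.
    by rewrite lerXn2r ?nnegrE ?(ltW q0)// (le_trans (ltW q0)).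
  have qd : q <= (1 + W)^-1 by rewrite /q lef_pV2 ?posrE ?mulr_gt0 ?addr_gt0//; lra.
  by rewrite lerXn2r ?nnegrE ?(ltW q0)// (le_trans (ltW q0)).
rewrite -[e `^ _]expr1; apply: sqrt_lower_bound => //; [exact: powR_ge0|exact: eucl_norm_ge0|].
apply: le_trans hq; rewrite muln1.
have -> : (e `^ (- (D%:R / 2 * E%:R))) ^+ 2 = a^-1 ^+ E.
  rewrite -powR_mulrn ?powR_ge0// -powRrM mulNr powRN exprVn -exprM -powR_mulrn ?(ltW e0)//.
  by congr (_ `^ _)^-1; rewrite natrM; field.
rewrite -mulrA ler_pM2l// -exprVn -exprMn exprM.
have qa : (32 * C)^-1 * a^-1 <= q ^+ 2.
  rewrite -invfM /q exprVn lef_pV2 ?posrE ?exprn_gt0 ?mulr_gt0// exprMn.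
  have -> : (4 : R) ^+ 2 = 16 by rewrite expr2; lra.
  have := ler_wpM2l (ltW C0) a1; lra.
have qa0 : 0 <= (32 * C)^-1 * a^-1 by rewrite mulr_ge0// invr_ge0 ?mulr_ge0// ltW.
apply: (@le_trans _ _ (((32 * C)^-1 * a^-1) ^+ E1)); last by rewrite lerXn2r ?nnegrE ?sqr_ge0.
apply: ler_wiXn2l => //; rewrite -invfM invf_le1 ?mulr_gt0//.
have := ler_wpM2l (ltW C0) a1; lra.
Qed.

End Description.

Lemma common_constant (R : realType) (T : eqType) (s : seq T) (P : T -> R -> Prop) :
  (forall b c c', 0 < c' <= c -> P b c -> P b c') ->
  (forall b, b \in s -> exists2 c, 0 < c & P b c) ->
  exists2 c, 0 < c & forall b, b \in s -> P b c.
Proof.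
move=> down; elim: s => [|b s IH] ex; first by exists 1.
have [c c0 cP] := ex b (mem_head b s).
have [b' b's|c' c'0 c'P] := IH; first by apply: ex; rewrite inE b's orbT.
have m0 : 0 < Num.min c c' by rewrite lt_min c0.
exists (Num.min c c') => // b'; rewrite inE => /predU1P[->|b's].
  by apply: down cP; rewrite m0 ge_min lexx.
by apply: down (c'P _ b's); rewrite m0 ge_min lexx orbT.
Qed.

Theorem corollary2p4 (R : realType) (N m : nat) (hN : (0 < N)%N)
  (X : set 'rV[R]_N) (hXclosed : closed X) (hXsa : semialgebraic X)
  (F : polymap R N m) :
  let D := maxn 2 (kappa X) in
  let d := maxn (polymap_deg F) D in
  let r := (2 * rnum X)%N in
  let E := (d * (6 * d - 3) ^ (N + r - 1))%N in
  (exists C : R, 0 < C /\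
     forall x, X x ->
       C * (eucl_dist x (zero_set F X) / (1 + eucl_norm x ^+ D)) ^+ E
         <= eucl_norm (polymap_eval F x))
  /\
  (~ bounded_set X -> compact (zero_set F X) ->
     ((- (D%:R / 2 * E%:R))%:E <= lojasiewicz_infty F X)%E).
Proof.
move=> D d r E.
have D2 : (2 <= D)%N := leq_maxl _ _.
have Dd : (D <= d)%N := leq_maxr _ _.
have degF j : (mpoly.msize (F j) <= d.+1)%N.
  apply: leq_trans (leqSpred _) _; rewrite ltnS; apply: leq_trans (leq_maxl _ D).
  exact: (leq_bigmax (F := fun j => pdeg (F j)) j).
have [s [sX sk sD]] := optimal_decomposition hXclosed hXsa.
have degb b q : b \in s -> q \in b.1 ++ b.2 -> (mpoly.msize q <= D.+1)%N.
  move=> bs qb; apply: leq_trans (leqSpred _) _; rewrite ltnS.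
  by apply: leq_trans (sD b bs q qb) _; apply: leq_maxr.
have bZ b : b \in s -> zero_set F (basic_set b) `<=` zero_set F X.
  by move=> bs x [Fx bx]; split=> //; apply/sX; exists b.
(* Each piece uses as many slack variables as inequalities, at most [rnum X], hence at most [r]. *)
have EE b : b \in s -> (d * (6 * d - 3) ^ (N + num_ineqs b - 1) <= E)%N.
  move=> bs; rewrite leq_mul2l leq_pexp2l ?orbT//; first by move: D2 Dd; lia.
  by rewrite leq_sub2r// leq_add2l (leq_trans (sk b bs))// /r mul2n -addnn leq_addl.
split.
- have [|b bs|c c0 cP] := @common_constant R _ s (fun b c => forall x, basic_set b x ->
    c * (eucl_dist x (zero_set F X) / (1 + eucl_norm x ^+ D)) ^+ E <=
      eucl_norm (polymap_eval F x)).
  + move=> b c c' /andP[_ c'c] h x bx; apply: le_trans (h x bx).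
    rewrite ler_wpM2r// exprn_ge0// divr_ge0 ?addr_ge0 ?exprn_ge0 ?eucl_norm_ge0//.
    exact: eucl_dist_ge0.
  + exact: (description_distance hN D2 Dd degF (fun q => degb b q bs) (bZ b bs) (EE b bs)).
  + by exists c; split=> // x /sX[b bs bx]; apply: cP bx.
move=> _ cZ.
have [B BP] : exists B : R, forall z, zero_set F X z -> eucl_norm z <= B.
  have [Z0|Z0] := pselect (zero_set F X !=set0); last first.
    by exists 0 => z Zz; case: Z0; exists z.
  have [|z _ zmax] := @EVT_max_rV R N (peval (pnorm2 R N)) _ Z0 cZ.
    by apply: continuous_subspaceT; apply: peval_continuous.
  exists (eucl_norm z) => t /mem_set/zmax; rewrite !peval_norm2 => h.
  exact: ler_wsqrtr.
have [|b bs|c c0 cP] := @common_constant R _ s (fun b c => exists2 r0, 0 < r0 &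
    forall x, basic_set b x -> r0 <= eucl_norm x ->
    c * (eucl_norm x `^ (- (D%:R / 2 * E%:R))) <= eucl_norm (polymap_eval F x)).
- move=> b c c' /andP[_ c'c] [r0 r00 h]; exists r0 => // x bx rx; apply: le_trans (h x bx rx).
  by rewrite ler_wpM2r// powR_ge0.
- have [c [r0 [c0 r00 h]]] := description_growth hN D2 Dd degF (fun q => degb b q bs)
    (bZ b bs) BP (EE b bs).
  by exists c => //; exists r0.
(* [common_constant] works with parameters that may be decreased, so the radius enters through its
   inverse. *)
have [r1 r10 r1P] : exists2 r1 : R, 0 < r1 & forall b, b \in s ->
    forall x, basic_set b x -> r1^-1 <= eucl_norm x ->
    c * (eucl_norm x `^ (- (D%:R / 2 * E%:R))) <= eucl_norm (polymap_eval F x).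
  apply: common_constant => [b r1 r2 /andP[r20 r21] h x bx rx|b bs].
    by apply: h => //; apply: le_trans rx; rewrite lef_pV2 ?posrE// (lt_le_trans r20).
  have [r0 r00 h] := cP b bs; exists r0^-1; first by rewrite invr_gt0.
  by rewrite invrK.
apply: ereal_sup_ubound; exists (- (D%:R / 2 * E%:R)) => //.
exists c, r1^-1; split=> //; first by rewrite invr_gt0.
by move=> x /sX[b bs bx] rx; apply: (r1P b).
Qed.
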